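(* For all $l>0$ and $c>0$, there exists a minimiser $(Q_{11}^*, M_1^* )$ of the order reconstruction energy $$E(Q_{11}, M_1)= \int_{-1}^{1} \Big\{ \tfrac{l}{2} (Q_{11}')^2 + \tfrac{l}{2} (M_1')^2 + (Q_{11}^2 - 1)^2 + \tfrac{1}{4}\left(M_1^2 - 1\right)^2 - cQ_{11} M_1^2 \Big\}\,\mathrm{d}y$$ in the admissible space $\mathcal{A}'$. The corresponding $(\mathbf{Q}^{OR},\mathbf{M}^{OR})=(Q_{11}^*,0,M_1^*,0)$ is a solution of the full system $$l\, Q_{11}'' = 4 Q_{11}(Q_{11}^2 + Q_{12}^2 - 1) - c\left(M_1^2 - M_2^2 \right),$$ $$l\, Q_{12}'' = 4 Q_{12}(Q_{11}^2 + Q_{12}^2 - 1) - 2cM_1 M_2,$$ $$l\, M_1'' = M_1 \left(M_1^2 + M_2^2 - 1 \right) - 2c Q_{11}M_1 - 2c Q_{12}M_2,$$ $$l\, M_2'' = M_2 \left(M_1^2 + M_2^2 - 1 \right) + 2c Q_{11} M_2 - 2c Q_{12} M_1,$$ and thus a critical point of the full energy $F$. Additionally, for fixed $c>0$ and all $l$ large enough (depending on $c$), $(\mathbf{Q}^{OR},\mathbf{M}^{OR})$ is the unique critical point, and hence the global minimiser, of $F$ in $\mathcal{A}$. Moreover, $$|Q_{11}^*(y)|\leq \rho^*,\qquad (M_1^*(y))^2\leq 1+2c\rho^*\qquad\text{for all } y\in[-1,1],$$ where $$\rho^*=\left(\frac{c}{8}+\sqrt{\frac{c^2}{64}-\fr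ac{1}{27}\left(1+\frac{c^2}{2}\right)^3}\right)^{1/3}+\left(\frac{c}{8}-\sqrt{\frac{c^2}{64}-\frac{1}{27}\left(1+\frac{c^2}{2}\right)^3}\right)^{1/3}.$$
   Context: Here $'$ denotes $\frac{\mathrm{d}}{\mathrm{d}y}$. $\mathcal{A}'$ is the set of pairs $(Q_{11},M_1)$ with both components in $W^{1,2}([-1,1];\mathbb{R})$, $Q_{11}(-1)=M_1(-1)=1$ and $Q_{11}(1)=M_1(1)=-1$. $\mathcal{A}$ is the set of all $(Q_{11},Q_{12},M_1,M_2)$ with every component in $W^{1,2}([-1,1];\mathbb{R})$ satisfying $Q_{11}(-1)=M_1(-1)=1$, $Q_{11}(1)=M_1(1)=-1$, $Q_{12}(\pm1)=M_2(\pm1)=0$. The full energy is $$F(Q_{11}, Q_{12}, M_1, M_2) = \int_{-1}^{1} \Big\{\tfrac{l}{2}\left[(Q_{11}')^2 + (Q_{12}')^2 + (M_1')^2 + (M_2')^2 \right] + \left( Q_{11}^2 + Q_{12}^2 - 1 \right)^2 + \tfrac{1}{4}\left(M_1^2 + M_2^2 - 1 \right)^2 - cQ_{11}\left(M_1^2 - M_2^2 \right) - 2c Q_{12}M_1 M_2 \Big\}\,\mathrm{d}y,$$ and a critical point of $F$ in $\mathcal{A}$ is an element of $\mathcal{A}$ at which the first variation of $F$ vanishes for all perturbations with components in $W_0^{1,2}$, i.e. a solution of the full (Euler--Lagrange) system lying in $\mathcal{A}$. In the formula for $\rho^*$ the quantity under the square root is negative; the two cube roots are the principal ones, which are complex conjugates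 of each other; equivalently, $\rho^*$ is the largest positive root of $\rho^3-\rho\left(1+\frac{c^2}{2}\right)-\frac{c}{4}$. *)

(* Defs.v *)
From HB Require Import structures.
From mathcomp Require Import all_boot all_order all_algebra.
From mathcomp Require Import complex ring.
From mathcomp Require Import all_classical all_reals all_analysis.
Set Implicit Arguments.
Unset Strict Implicit.
Unset Printing Implicit Defensive.
Import Order.TTheory GRing.Theory Num.Theory.
Import numFieldNormedType.Exports.
Local Open Scope classical_set_scope.
Local Open Scope ring_scope.

Section Sobolev.
Variable R : realType.
Local Notation mu := (@lebesgue_measure R).
Local Notation I := (`[(-1 : R), 1]%classic).
Implicit Types u v g phi : R -> R.

(* Functions on [-1, 1] are total functions on R whose values outside [-1, 1]
   are ignored: g \_ I is g extended by 0. *)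
Definition L2 g : Prop := (g \_ I) \in Lfun mu 2%:E.

(* C^1_c(]-1, 1[); it yields the same weak derivatives as C^oo_c(]-1, 1[). *)
Definition test_function phi : Prop :=
  [/\ forall x, derivable phi x 1,
      continuous (derive1 phi) &
      exists K : set R,
        [/\ compact K, K `<=` `](-1), 1[ & forall x, ~ K x -> phi x = 0]].

Definition weak_derivative u g : Prop :=
  L2 g /\
  forall phi, test_function phi ->
    \int[mu]_(x in I) (u x * derive1 phi x) = - \int[mu]_(x in I) (g x * phi x).

(* An element of W^{1,2} is represented by its continuous representative, the
   one through which boundary and pointwise values are understood. *)
Definition W12 u : Prop :=
  [/\ {within I, continuous u}, L2 u & exists g, weak_derivative u g].

Definition W012 u : Prop := [/\ W12 u, u (-1) = 0 & u 1 = 0].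

(* A weak derivative of u, chosen among representatives equal a.e. on I;
   only meaningful when W12 u. *)
Definition wderiv u : R -> R := get [set g | weak_derivative u g].

End Sobolev.

Section Energies.
Variables (R : realType) (l c : R).
Local Notation mu := (@lebesgue_measure R).
Local Notation I := (`[(-1 : R), 1]%classic).

Definition or_energy (Q11 M1 : R -> R) : R :=
  \int[mu]_(y in I)
    (l / 2 * wderiv Q11 y ^+ 2 + l / 2 * wderiv M1 y ^+ 2
     + (Q11 y ^+ 2 - 1) ^+ 2 + 1 / 4 * (M1 y ^+ 2 - 1) ^+ 2
     - c * Q11 y * M1 y ^+ 2).

Definition full_energy (Q11 Q12 M1 M2 : R -> R) : R :=
  \int[mu]_(y in I)
    (l / 2 * (wderiv Q11 y ^+ 2 + wderiv Q12 y ^+ 2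
              + wderiv M1 y ^+ 2 + wderiv M2 y ^+ 2)
     + (Q11 y ^+ 2 + Q12 y ^+ 2 - 1) ^+ 2
     + 1 / 4 * (M1 y ^+ 2 + M2 y ^+ 2 - 1) ^+ 2
     - c * Q11 y * (M1 y ^+ 2 - M2 y ^+ 2)
     - 2 * c * Q12 y * M1 y * M2 y).

Definition or_admissible (Q11 M1 : R -> R) : Prop :=
  [/\ W12 Q11, W12 M1, Q11 (-1) = 1 /\ M1 (-1) = 1 & Q11 1 = -1 /\ M1 1 = -1].

Definition admissible (Q11 Q12 M1 M2 : R -> R) : Prop :=
  [/\ [/\ W12 Q11, W12 Q12, W12 M1 & W12 M2],
      Q11 (-1) = 1 /\ M1 (-1) = 1,
      Q11 1 = -1 /\ M1 1 = -1,
      Q12 (-1) = 0 /\ Q12 1 = 0 &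
      M2 (-1) = 0 /\ M2 1 = 0].

Definition or_minimiser (Q11 M1 : R -> R) : Prop :=
  or_admissible Q11 M1 /\
  forall Q M, or_admissible Q M -> or_energy Q11 M1 <= or_energy Q M.

Definition full_minimiser (Q11 Q12 M1 M2 : R -> R) : Prop :=
  admissible Q11 Q12 M1 M2 /\
  forall Q Q' M M', admissible Q Q' M M' ->
    full_energy Q11 Q12 M1 M2 <= full_energy Q Q' M M'.

Definition full_critical (Q11 Q12 M1 M2 : R -> R) : Prop :=
  admissible Q11 Q12 M1 M2 /\
  forall q11 q12 m1 m2 : R -> R, W012 q11 -> W012 q12 -> W012 m1 -> W012 m2 ->
    is_derive (0 : R) 1
      (fun t : R => full_energy
         (fun y => Q11 y + t * q11 y) (fun y => Q12 y + t * q12 y)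
         (fun y => M1 y + t * m1 y) (fun y => M2 y + t * m2 y)) 0.

Definition twice_derivable (u : R -> R) (y : R) : Prop :=
  (\forall z \near y, derivable u z 1) /\ derivable (derive1 u) y 1.

Definition full_system (Q11 Q12 M1 M2 : R -> R) : Prop :=
  forall y : R, -1 < y < 1 ->
  [/\ twice_derivable Q11 y, twice_derivable Q12 y,
      twice_derivable M1 y & twice_derivable M2 y] /\
  [/\ l * derive1n 2 Q11 y = 4 * Q11 y * (Q11 y ^+ 2 + Q12 y ^+ 2 - 1)
                       - c * (M1 y ^+ 2 - M2 y ^+ 2),
      l * derive1n 2 Q12 y = 4 * Q12 y * (Q11 y ^+ 2 + Q12 y ^+ 2 - 1)
                       - 2 * c * M1 y * M2 y,
      l * derive1n 2 M1 y = M1 y * (M1 y ^+ 2 + M2 y ^+ 2 - 1)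
                      - 2 * c * Q11 y * M1 y - 2 * c * Q12 y * M2 y &
      l * derive1n 2 M2 y = M2 y * (M1 y ^+ 2 + M2 y ^+ 2 - 1)
                      + 2 * c * Q11 y * M2 y - 2 * c * Q12 y * M1 y].

End Energies.

Section RhoStar.
Variable R : realType.

(* Principal cube root, argument in ]-pi/3, pi/3]. The library's 3.-root z has
   the least nonnegative argument among the cube roots of z, so it is the
   principal one only when 'Im z >= 0; the other case follows by conjugation. *)
Definition cbrtC (z : R[i]) : R[i] :=
  if 0 <= 'Im z then 3.-root z else Num.conj (3.-root (Num.conj z)).

Definition rho_starC (c : R) : R[i] :=
  let d := sqrtC (c ^+ 2 / 64 - 1 / 27 * (1 + c ^+ 2 / 2) ^+ 3)%:C%C in
  cbrtC ((c / 8)%:C%C + d) + cbrtC ((c / 8)%:C%C - d).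

(* The formula yields a real number, see rho_starE: no information is lost by
   taking the real part. *)
Definition rho_star (c : R) : R := complex.Re (rho_starC c).

Lemma rho_starC_conj (c : R) : 0 < c ->
  exists w : R[i],
    [/\ rho_starC c = w + Num.conj w,
        w ^+ 3 + Num.conj w ^+ 3 = (c / 4)%:C%C &
        w * Num.conj w = ((1 + c ^+ 2 / 2) / 3)%:C%C].
Proof.
move=> c0; rewrite /rho_starC; set D := c ^+ 2 / 64 - _.
have D0 : D < 0.
  have -> : D = - (1 / 27 + c ^+ 2 * (23 / 576) + (c ^+ 2) ^+ 2 / 36
                   + (c ^+ 2) ^+ 3 / 216) by rewrite /D; field.
  rewrite oppr_lt0.
  have c2 : 0 < c ^+ 2 by exact: exprn_gt0.
  by rewrite !addr_gt0 ?mulr_gt0 ?exprn_gt0 ?invr_gt0 ?ltr0n.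
pose s := Num.sqrt (- D).
have s0 : 0 < s by rewrite sqrtr_gt0 oppr_gt0.
have sR : s%:C%C \is Num.real by rewrite complex_real.
have sC0 : 0 < s%:C%C by rewrite lt0r ler0c (ltW s0) fmorph_eq0 gt_eqF.
have aR : (c / 8)%:C%C \is Num.real by rewrite complex_real.
have sE : s ^+ 2 = - D by rewrite sqr_sqrtr // oppr_ge0 ltW.
have -> : sqrtC D%:C%C = 'i * s%:C%C.
  have -> : D%:C%C = ('i * s%:C%C) ^+ 2.
    by rewrite exprMn sqrCi -rmorphXn /= sE rmorphN /= mulN1r opprK.
  apply/sqrCK_P; rewrite ImMil (Creal_ReP _ sR) ler0c (ltW s0) /=.
  apply/negP => /ltr0_real /Creal_ImP; rewrite ImMil (Creal_ReP _ sR) => /eqP.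
  by rewrite fmorph_eq0 gt_eqF.
set z := (c / 8)%:C%C + 'i * s%:C%C.
have zJ : Num.conj z = (c / 8)%:C%C - 'i * s%:C%C by rewrite conjC_rect.
rewrite -zJ {1}/cbrtC Im_rect // ler0c (ltW s0).
rewrite /cbrtC Im_conj Im_rect // oppr_ge0 lt_geF // conjCK.
exists (3.-root z); split=> //.
  rewrite -rmorphXn /= rootCK // zJ /z addrACA subrr addr0 -rmorphD /=.
  by congr (_%:C)%C; field.
apply: (@pexpIrn _ 3) => //; rewrite ?nnegrE ?mul_conjC_ge0 ?ler0c //.
  by rewrite divr_ge0 // addr_ge0 // divr_ge0 // sqr_ge0.
rewrite exprMn -rmorphXn /= rootCK // zJ mulrC -subr_sqr exprMn sqrCi mulN1r opprK.
rewrite -!rmorphXn -rmorphD /= sE /D; by congr (_%:C)%C; field.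
Qed.

Lemma rho_starE (c : R) : 0 < c -> (rho_star c)%:C%C = rho_starC c.
Proof.
move=> /rho_starC_conj [w [wE _ _]]; rewrite /rho_star complexRe.
by apply/Creal_ReP; rewrite CrealE wE rmorphD /= conjCK addrC.
Qed.

Lemma rho_star_root (c : R) : 0 < c ->
  rho_star c ^+ 3 - rho_star c * (1 + c ^+ 2 / 2) - c / 4 = 0.
Proof.
move=> c0; apply: (@complexI R).
have [w [wE w3 ww]] := rho_starC_conj c0.
rewrite !rmorphB rmorphXn rmorphM /= rho_starE // wE -w3.
have -> : (1 + c ^+ 2 / 2)%:C%C = 3 * (w * Num.conj w).
  rewrite ww -(rmorph_nat (real_complex R) 3) -rmorphM /=.
  by congr (_%:C)%C; field.
by rewrite rmorph0; ring.
Qed.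

End RhoStar.

(* Main.v *)
(* Along a line the energy is a quartic polynomial in the parameter, and completing
   squares in its quartic terms bounds the part of the bulk energy of order at least two
   from below by -K |v|^2, with K depending only on c and on a bound for the base point.

   Existence: this local semiconvexity makes any bounded, almost minimising sequence
   whose values at finitely many nodes nearly coincide Cauchy in W^{1,2}, so
   compactness is only needed for the vectors of nodal values.

   Bounds: the weak equation l Q'' = h says that l Q differs from the second primitive of
   h by an affine function, so minimisers are C^2. At interior extrema of Q and M the
   equations and the maximum principle give the cubic inequality defining rho*.

   Large l: the minimiser is bounded independently of l, so the semiconvexity at it holds
   for perturbations of arbitrary size with a fixed K, and the elastic energy dominates
   K |v|^2 by the Poincare inequality. The same estimate for the derivative along the
   line excludes other critical points. *)

(* The chosen weak derivative [wderiv] is additive only almost everywhere, so the computations run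
   on pairs (u, g) with u the primitive of a square-integrable g ([ac u g]); these add exactly. The
   du Bois-Reymond lemma identifies such u with W^{1,2}, and uniqueness of g almost everywhere lets
   the energy be evaluated with any g. Since the expansion along a line is exact, the first
   variation is the linear coefficient of a polynomial in t, and no differentiation under the
   integral sign occurs. The cubic coefficient is the only one of odd order beyond the first;
   Young's inequality splits it between |v|^4, with a weight that the quartic coefficient can
   afford, and |v|^2. In the Cauchy argument the expansion is taken around the midpoint of two
   almost minimisers: their odd-order terms cancel, so no Euler-Lagrange equation is needed before a
   minimiser is known to exist. The same lower bound for the remainder, with weights (1, 1, 1), (1,
   0, 1) and (2, 3, 4) on its three coefficients, serves the comparison of energies, the midpoint
   argument and the uniqueness of critical points. *)
Require Import Defs.
From HB Require Import structures.
From mathcomp Require Import all_boot all_order all_algebra.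
From mathcomp Require Import complex.
From mathcomp Require Import all_classical all_reals all_analysis.
From mathcomp Require Import measurable_realfun ring lra.
Import Order.TTheory GRing.Theory Num.Theory.
Import numFieldNormedType.Exports.
Set Implicit Arguments.
Unset Strict Implicit.
Unset Printing Implicit Defensive.
Local Open Scope classical_set_scope.
Local Open Scope ring_scope.

(** * Integrals over compact intervals *)

Section Integrable.
Variable R : realType.
Local Notation mu := (@lebesgue_measure R).
Implicit Types (f g h : R -> R) (a b c x y : R).

Definition int1 a b f := mu.-integrable `[a, b]%classic (EFin \o f).

Lemma measurable_seg a b : measurable (`[a, b]%classic : set (measurableTypeR R)).
Proof. exact: measurable_itv. Qed.

Hint Resolve measurable_seg : core.

Lemma int1_eq a b f g : (forall x, a <= x <= b -> f x = g x) ->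
  int1 a b f -> int1 a b g.
Proof.
move=> fg; apply: eq_integrable => //= x.
by rewrite inE/= in_itv/= => /fg ->.
Qed.

Lemma int1D a b f g : int1 a b f -> int1 a b g -> int1 a b (fun x => f x + g x).
Proof.
move=> If Ig; rewrite /int1 (_ : _ \o _ = (EFin \o f) \+ (EFin \o g))%E //.
exact: integrableD.
Qed.

Lemma int1Z a b k f : int1 a b f -> int1 a b (fun x => k * f x).
Proof. by move=> If; exact: (integrableZl _ k If). Qed.

Lemma int1N a b f : int1 a b f -> int1 a b (fun x => - f x).
Proof.
move=> /(int1Z (-1)); apply: int1_eq => x _; exact: mulN1r.
Qed.

Lemma int1B a b f g : int1 a b f -> int1 a b g -> int1 a b (fun x => f x - g x).
Proof. by move=> If Ig; apply: int1D => //; exact: int1N. Qed.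

Lemma int1_sub a b x y f : a <= x -> y <= b -> int1 a b f -> int1 x y f.
Proof.
move=> ax yb; apply: integrableS => //.
by apply: subset_itvScc; rewrite bnd_simp.
Qed.

Lemma int1_cont a b f : {within `[a, b], continuous f} -> int1 a b f.
Proof. by move=> fc; apply: continuous_compact_integrable => //; exact: segment_compact. Qed.

Lemma int1_cst a b k : int1 a b (fun=> k).
Proof. by apply: int1_cont; apply: continuous_subspaceT => x; exact: cst_continuous. Qed.

Lemma int1_meas a b f : int1 a b f -> measurable_fun `[a, b] f.
Proof. by move=> /measurable_int /measurable_EFinP. Qed.

Lemma int1_abs a b f : int1 a b f -> int1 a b (fun x => `|f x|).
Proof. by move=> /integrable_norm. Qed.

Lemma int1_le a b f g : measurable_fun `[a, b] f ->
  (forall x, a <= x <= b -> `|f x| <= g x) -> int1 a b g -> int1 a b f.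
Proof.
move=> mf fg Ig; apply: (le_integrable _ _ _ Ig) => //; first exact/measurable_EFinP.
move=> x /=; rewrite in_itv/= => xab; rewrite lee_fin.
by rewrite (le_trans (fg _ xab))// ler_norm.
Qed.

Lemma Rint_eq a b f g : (forall x, a <= x <= b -> f x = g x) ->
  \int[mu]_(x in `[a, b]) f x = \int[mu]_(x in `[a, b]) g x.
Proof. by move=> fg; apply: eq_Rintegral => x; rewrite inE/= in_itv/= => /fg. Qed.

Lemma Rint_le a b f g : int1 a b f -> int1 a b g ->
  (forall x, a <= x <= b -> f x <= g x) ->
  \int[mu]_(x in `[a, b]) f x <= \int[mu]_(x in `[a, b]) g x.
Proof.
by move=> If Ig fg; apply: le_Rintegral => // x /=; rewrite in_itv/= => /fg.
Qed.

Lemma Rint_ge0 a b f : (forall x, a <= x <= b -> 0 <= f x) ->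
  0 <= \int[mu]_(x in `[a, b]) f x.
Proof. by move=> f0; apply: Rintegral_ge0 => x /=; rewrite in_itv/= => /f0. Qed.

Lemma RintD a b f g : int1 a b f -> int1 a b g ->
  \int[mu]_(x in `[a, b]) (f x + g x) =
  \int[mu]_(x in `[a, b]) f x + \int[mu]_(x in `[a, b]) g x.
Proof. by move=> If Ig; exact: RintegralD. Qed.

Lemma RintB a b f g : int1 a b f -> int1 a b g ->
  \int[mu]_(x in `[a, b]) (f x - g x) =
  \int[mu]_(x in `[a, b]) f x - \int[mu]_(x in `[a, b]) g x.
Proof. by move=> If Ig; exact: RintegralB. Qed.

Lemma RintZ a b k f : int1 a b f ->
  \int[mu]_(x in `[a, b]) (k * f x) = k * \int[mu]_(x in `[a, b]) f x.
Proof. by move=> If; exact: RintegralZl. Qed.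

Lemma Rint_cst a b k : a <= b -> \int[mu]_(x in `[a, b]) k = k * (b - a).
Proof.
move=> ab; rewrite Rintegral_cst//= lebesgue_measure_itv/= lte_fin.
by case: (ltgtP a b) ab => [ab _|//|-> _] //=; rewrite subrr.
Qed.

Lemma Rint_point a f : \int[mu]_(x in `[a, a]) f x = 0.
Proof. by rewrite set_itv1 Rintegral_set1. Qed.

Lemma Rint_split a b c f : a <= c -> c <= b -> int1 a b f ->
  \int[mu]_(x in `[a, b]) f x =
  \int[mu]_(x in `[a, c]) f x + \int[mu]_(x in `[c, b]) f x.
Proof.
move=> ac cb If; apply/eqP; rewrite addrC -subr_eq; apply/eqP.
rewrite Rintegral_itvB ?bnd_simp//.
rewrite Rintegral_itv_obnd_cbnd//.
by apply: integrableS If => //; apply: subset_itvr; rewrite bnd_simp.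
Qed.

Lemma Rint_norm a b f : int1 a b f ->
  `|\int[mu]_(x in `[a, b]) f x| <= \int[mu]_(x in `[a, b]) `|f x|.
Proof. by move=> If; exact: le_normr_Rintegral. Qed.

Lemma Rint_subset a b x y f : a <= x -> x <= y -> y <= b -> int1 a b f ->
  (forall z, a <= z <= b -> 0 <= f z) ->
  \int[mu]_(z in `[x, y]) f z <= \int[mu]_(z in `[a, b]) f z.
Proof.
move=> ax xy yb If f0.
rewrite (@Rint_split a b x)//; last exact: le_trans yb.
rewrite (@Rint_split x b y)//; last exact: int1_sub If.
rewrite addrCA lerDl addr_ge0// Rint_ge0// => z /andP[z1 z2]; apply: f0.
  by rewrite z1 (le_trans z2 (le_trans xy yb)).
by rewrite z2 (le_trans (le_trans ax xy) z1).
Qed.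

End Integrable.
#[export] Hint Resolve measurable_seg int1_cst : core.

(** * Square-integrable functions and the Cauchy-Schwarz inequality *)

Section SquareIntegrable.
Variable R : realType.
Local Notation mu := (@lebesgue_measure R).
Implicit Types (f g h : R -> R) (a b c x y : R).

(** Measurability is asked of f itself, since that of f^2 leaves the sign of f free. *)
Definition sq2 a b f := measurable_fun `[a, b] f /\ int1 a b (fun x => f x ^+ 2).

Lemma sq2_mul a b f g : sq2 a b f -> sq2 a b g -> int1 a b (fun x => f x * g x).
Proof.
move=> [mf If] [mg Ig]; apply: int1_le (int1D If Ig).
  exact: measurable_funM.
move=> x _; rewrite normrM -(real_normK (num_real (f x))) -(real_normK (num_real (g x))).
have := sqr_ge0 (`|f x| - `|g x|); have := normr_ge0 (f x); have := normr_ge0 (g x).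
nra.
Qed.

Lemma sq2D a b f g : sq2 a b f -> sq2 a b g -> sq2 a b (fun x => f x + g x).
Proof.
move=> sf sg; split; first by apply: measurable_funD; [case: sf|case: sg].
apply: (@int1_eq _ _ _ (fun x => f x ^+ 2 + g x ^+ 2 + 2 * (f x * g x))).
  by move=> x _; ring.
apply: int1D; first by apply: int1D; [case: sf|case: sg].
by apply: int1Z; exact: sq2_mul.
Qed.

Lemma sq2Z a b k f : sq2 a b f -> sq2 a b (fun x => k * f x).
Proof.
move=> [mf If]; split; first exact: measurable_funM.
apply: (@int1_eq _ _ _ (fun x => k ^+ 2 * f x ^+ 2)); first by move=> x _; ring.
exact: int1Z.
Qed.

Lemma sq2B a b f g : sq2 a b f -> sq2 a b g -> sq2 a b (fun x => f x - g x).
Proof.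
move=> sf /(sq2Z (-1)) sg; have := sq2D sf sg.
by under eq_fun do rewrite mulN1r.
Qed.

Lemma sq2_cont a b f : {within `[a, b], continuous f} -> sq2 a b f.
Proof.
move=> cf; split; first by apply: int1_meas; exact: int1_cont.
apply: int1_cont => x; rewrite (_ : (fun x => _) = f \* f); last first.
  by apply/funext => z; rewrite /= expr2.
by apply: continuousM; exact: cf.
Qed.

Lemma sq2_cst a b k : sq2 a b (fun=> k).
Proof. by apply: sq2_cont; apply: continuous_subspaceT => x; exact: cst_continuous. Qed.

Lemma sq2_int1 a b f : sq2 a b f -> int1 a b f.
Proof.
move=> sf; have := sq2_mul sf (sq2_cst a b 1).
by apply: int1_eq => x _; rewrite mulr1.
Qed.

Lemma sq2_sub a b x y f : a <= x -> y <= b -> sq2 a b f -> sq2 x y f.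
Proof.
move=> ax yb sf; split; last by apply: int1_sub sf.2.
by apply: int1_meas; apply: (int1_sub ax yb); exact: sq2_int1.
Qed.

Lemma sq2_eq a b f g : (forall x, a <= x <= b -> f x = g x) ->
  sq2 a b f -> sq2 a b g.
Proof.
move=> fg sf; split; first by apply: int1_meas; apply: (int1_eq fg); exact: sq2_int1.
by apply: int1_eq sf.2 => x /fg ->.
Qed.

(** Cauchy-Schwarz against the constant 1, read off from the nonnegative variance of f. The mean [t]
    requires a < b, hence the separate degenerate case. *)
Lemma Rint_sqr_le a b f : a <= b -> sq2 a b f ->
  (\int[mu]_(x in `[a, b]) f x) ^+ 2 <= (b - a) * \int[mu]_(x in `[a, b]) f x ^+ 2.
Proof.
rewrite le_eqVlt => /predU1P[->|ab] sf.
  by rewrite !Rint_point subrr mul0r expr2 mul0r.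
set m := \int[mu]_(x in _) f x; set s := \int[mu]_(x in _) _.
have ba : 0 < b - a by rewrite subr_gt0.
pose t := m / (b - a).
have : 0 <= \int[mu]_(x in `[a, b]) (f x - t) ^+ 2.
  by apply: Rint_ge0 => x _; exact: sqr_ge0.
rewrite (@Rint_eq _ _ _ _ (fun x => f x ^+ 2 + ((- (2 * t)) * f x + t ^+ 2))); last first.
  by move=> x _; ring.
have If := sq2_int1 sf.
rewrite RintD; [|exact: sf.2|]; last first.
  by apply: int1D => //; exact: int1Z.
  rewrite RintD//; last by exact: int1Z.
  rewrite RintZ// Rint_cst ?(ltW ab)// -/m -/s => H.
  have tE : t * (b - a) = m by rewrite /t divfK// gt_eqF.
  have := mulr_ge0 (ltW ba) H.
  have -> : (b - a) * (s + (- (2 * t) * m + t ^+ 2 * (b - a))) =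
    (b - a) * s - (t * (b - a)) ^+ 2 by rewrite -tE; ring.
  by rewrite subr_ge0 tE.
Qed.

End SquareIntegrable.

(** * Retraction of the line onto [-1, 1] *)

Section Clamp.
Variable R : realType.
Implicit Types (x y : R) (w : R -> R).

(** Composition with this 1-Lipschitz retraction extends a function continuous on [-1, 1] to one
    continuous on the line, so that the fundamental theorem of calculus applies to it at every
    point. *)
Definition clamp x : R := Num.max (-1) (Num.min x 1).

Lemma clampP x : -1 <= clamp x <= 1.
Proof. by rewrite /clamp le_max lexx/= ge_max ge_min lexx orbT andbT ge0_cp. Qed.

Lemma clamp_id x : -1 <= x <= 1 -> clamp x = x.
Proof. by move=> /andP[x1 x2]; rewrite /clamp (min_idPl x2); exact/max_idPr. Qed.

Lemma clamp_lip x y : `|clamp x - clamp y| <= `|x - y|.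
Proof.
rewrite /clamp ler_norml.
have := ler_norm (x - y); have := ler_norm (- (x - y)); rewrite normrN.
have N11 : Num.max (-1) 1 = 1 :> R by apply/max_idPr; lra.
by case: (leP x 1) => ?; case: (leP y 1) => ?; case: (leP (-1) x) => ?;
  case: (leP (-1) y) => ? ? ?; rewrite ?N11; apply/andP; split; lra.
Qed.

Lemma cont_clamp w : {within `[(-1)%R, 1%R], continuous w} ->
  continuous (fun x => w (clamp x)).
Proof.
move=> /subspace_continuousP cw x; apply/cvgrPdist_lt => e e0.
have cI : `[(-1)%R, 1%R]%classic (clamp x) by rewrite /= in_itv/=; exact: clampP.
have /cvgrPdist_lt/(_ e e0) := cw _ cI.
move=> /nbhs_ballP[d /= d0 dP]; apply/nbhs_ballP; exists d => //= y xy.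
apply: dP; last by rewrite /= in_itv/=; exact: clampP.
by rewrite /ball/= in xy *; apply: le_lt_trans xy; exact: clamp_lip.
Qed.

Lemma cont_eq_oo w k : {within `[(-1)%R, 1%R], continuous w} ->
  (forall x, -1 < x < 1 -> w x = k) -> forall x, -1 <= x <= 1 -> w x = k.
Proof.
move=> cw wk x x1.
have /cvgrPdist_lt cx := @cont_clamp w cw x.
apply/eqP; rewrite -subr_eq0 -normr_le0; apply/ler_addgt0Pl => e e0; rewrite addr0.
have := cx _ e0; rewrite clamp_id// => /nbhs_ballP[d /= d0 dP].
(* Shrinking x towards 0 lands in the open interval and moves x by at most d / 2. *)
pose y := (1 - Num.min 1 (d / 2)) * x.
have m0 : 0 < Num.min 1 (d / 2) by rewrite lt_min ltr01/= divr_gt0.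
have m1 : Num.min 1 (d / 2) <= 1 by rewrite ge_min lexx.
have m2 : Num.min 1 (d / 2) <= d / 2 by rewrite ge_min lexx orbT.
have y1 : -1 < y < 1 by rewrite /y; apply/andP; split; nra.
have bxy : ball x d y.
  rewrite /ball/= /y (_ : x - _ = Num.min 1 (d / 2) * x); last by ring.
  rewrite normrM (gtr0_norm m0).
  have : `|x| <= 1 by rewrite ler_norml.
  have := normr_ge0 x; nra.
have := dP _ bxy; rewrite clamp_id; last by move: y1 => /andP[/ltW -> /ltW ->].
by rewrite (wk y)// => /ltW.
Qed.

End Clamp.

(** * Absolutely continuous functions with square-integrable derivative *)

Section AbsolutelyContinuous.
Variable R : realType.
Local Notation mu := (@lebesgue_measure R).
Local Notation I := (`[(-1 : R), 1]%classic).
Implicit Types (u v w g h phi : R -> R) (x y a b : R).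

Lemma L2E g : L2 g <-> sq2 (-1) 1 g.
Proof.
split.
  move=> L; have /Lfun2_integrable_sqr iL := L.
  split.
    move: L; rewrite /L2 inE => /andP[/[!inE]/= mg _].
    by apply/(measurable_restrictT g (measurable_seg (-1) 1)).
  have : mu.-integrable I (EFin \o (fun x => (g \_ I) x ^+ 2)).
    by apply: integrableS iL.
  apply: int1_eq => x xI; rewrite patchE mem_set//= in_itv//=.
move=> [mg ig]; rewrite /L2 inE; apply/andP; split; rewrite inE/=.
  exact: (iffLR (measurable_restrictT g (measurable_seg (-1) 1)) mg).
rewrite /finite_norm; apply: (@lty_poweRy _ _ 2); first by [].
rewrite powR_Lnorm//.
have /integrableP[_] : mu.-integrable setT (EFin \o (fun x => (g \_ I) x ^+ 2)).
  have /integrable_mkcond-/(_ (measurable_seg (-1) 1)) := ig.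
  apply: eq_integrable => // x _; rewrite /= !patchE; case: ifPn => // _.
  by rewrite expr2 mul0r.
apply: le_lt_trans; rewrite le_eqVlt; apply/orP; left; apply/eqP.
apply: eq_integral => x _ /=.
by rewrite powR_mulrn// -normrX.
Qed.

Definition ac u g := sq2 (-1) 1 g /\
  forall x, -1 <= x <= 1 -> u x = u (-1) + \int[mu]_(t in `[(-1)%R, x]) g t.

Lemma ac_diff u g x y : ac u g -> -1 <= x -> x <= y -> y <= 1 ->
  u y - u x = \int[mu]_(t in `[x, y]) g t.
Proof.
move=> [sg ug] x1 xy y1.
rewrite ug ?(le_trans x1 xy)// [u x]ug ?x1 ?(le_trans xy y1)//.
rewrite (@Rint_split _ (-1) y x)//; first by ring.
by apply: int1_sub (sq2_int1 sg).
Qed.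

Lemma ac_sqr_le u g x y : ac u g -> -1 <= x -> x <= y -> y <= 1 ->
  (u y - u x) ^+ 2 <= (y - x) * \int[mu]_(t in `[x, y]) g t ^+ 2.
Proof.
move=> ug x1 xy y1; rewrite (ac_diff ug)//; apply: Rint_sqr_le => //.
by apply: sq2_sub ug.1.
Qed.

(** The embedding of W^{1,2} into Hölder functions of exponent 1/2; the later nodal, uniform and
    Poincare estimates come from it. *)
Lemma ac_sqr_leI u g x y : ac u g -> -1 <= x <= 1 -> -1 <= y <= 1 ->
  (u y - u x) ^+ 2 <= `|y - x| * \int[mu]_(t in I) g t ^+ 2.
Proof.
move=> ug; wlog xy : x y / x <= y.
  move=> H x1 y1; have [xy|/ltW yx] := leP x y; first exact: H.
  by rewrite -opprB sqrrN distrC; exact: H.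
move=> /andP[x1 x2] /andP[y1 y2]; apply: (le_trans (ac_sqr_le ug x1 xy y2)).
rewrite ger0_norm ?subr_ge0// ler_wpM2l ?subr_ge0//.
apply: Rint_subset => //; first exact: ug.1.2.
by move=> z _; exact: sqr_ge0.
Qed.

Lemma ac_cont u g : ac u g -> {within I, continuous u}.
Proof.
move=> [sg ug].
have N11 : (-1 : R) <= 1 by lra.
have := parameterized_integral_continuous N11 (sq2_int1 sg).
move=> c.
apply: (@subspace_eq_continuous _ _ _
  (fun x => u (-1) + \int[mu]_(t in `[(-1)%R, x]) g t)).
  by move=> x; rewrite inE/= in_itv/= => /ug/esym.
apply: within_continuousD => //.
by apply: continuous_subspaceT => x; exact: cst_continuous.
Qed.

Lemma ac_sq2 u g : ac u g -> sq2 (-1) 1 u.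
Proof. by move=> /ac_cont; exact: sq2_cont. Qed.

Lemma acD u g v h : ac u g -> ac v h -> ac (fun x => u x + v x) (fun x => g x + h x).
Proof.
move=> [sg ug] [sh vh]; split; first exact: sq2D.
move=> x x1; rewrite ug// vh// RintD; first by ring.
  by apply: int1_sub (sq2_int1 sg) => //; case/andP : x1.
by apply: int1_sub (sq2_int1 sh) => //; case/andP : x1.
Qed.

Lemma acZ k u g : ac u g -> ac (fun x => k * u x) (fun x => k * g x).
Proof.
move=> [sg ug]; split; first exact: sq2Z.
move=> x x1; rewrite ug// RintZ; first by ring.
by apply: int1_sub (sq2_int1 sg) => //; case/andP : x1.
Qed.

Lemma ac_cst k : ac (fun=> k) (fun=> 0).
Proof.
split; first exact: sq2_cst.
by move=> x /andP[x1 _]; rewrite Rint_cst// mul0r addr0.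
Qed.

Lemma acB u g v h : ac u g -> ac v h -> ac (fun x => u x - v x) (fun x => g x - h x).
Proof.
move=> ug /(acZ (-1)) vh; have := acD ug vh.
by under eq_fun do rewrite mulN1r; under [X in ac _ X]eq_fun do rewrite mulN1r.
Qed.

Lemma ac_prim g : sq2 (-1) 1 g -> ac (fun x => \int[mu]_(t in `[(-1)%R, x]) g t) g.
Proof. by move=> sg; split => // x _; rewrite Rint_point add0r. Qed.

Lemma ac_id : ac id (fun=> 1).
Proof.
split; first exact: sq2_cst.
by move=> x /andP[x1 _]; rewrite Rint_cst//; ring.
Qed.

(* Telescoping over a uniform subdivision. *)
Lemma superadditive_bound_eq (N W : R -> R) :
  (forall x y, -1 <= x -> x <= y -> y <= 1 ->
    `|N y - N x| <= (y - x) * (W y - W x)) -> N 1 = N (-1).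
Proof.
move=> H; apply/eqP; rewrite -subr_eq0 -normr_le0.
apply/ler_addgt0Pl => /= e e0; rewrite addr0.
pose C : R := `|W 1 - W (-1)|.
pose n := (Num.trunc (2 * C / e)).+1.
have n0 : (0 : R) < n%:R by rewrite ltr0n.
have nC : 2 * C / n%:R <= e.
  rewrite ler_pdivrMr// [leRHS]mulrC -ler_pdivrMr//.
  exact: ltW (truncnS_gt _).
apply: le_trans nC.
pose p (i : nat) : R := -1 + i%:R * (2 / n%:R).
have pn : p n = 1 by rewrite /p mulrC divfK ?gt_eqF//; ring.
have p0 : p 0%N = -1 by rewrite /p mul0r addr0.
have pS i : p i.+1 - p i = 2 / n%:R by rewrite /p -natr1; ring.
have d0 : 0 < 2 / n%:R :> R by rewrite divr_gt0.
have pmono i j : (i <= j)%N -> p i <= p j.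
  by move=> ij; rewrite /p lerD2l ler_pM2r// ler_nat.
have -> : N 1 - N (-1) = N (p n) - N (p 0%N) by rewrite pn p0.
rewrite -(telescope_sumr (fun i => N (p i)))//.
apply: le_trans (ler_norm_sum _ _ _) _.
apply: (@le_trans _ _ (\sum_(0 <= i < n) (2 / n%:R) * (W (p i.+1) - W (p i)))).
  apply: ler_sum_nat => i /andP[_ iN]; rewrite -(pS i); apply: H.
  - by rewrite -p0 pmono.
  - by rewrite pmono.
  - by rewrite -pn pmono.
rewrite -mulr_sumr (telescope_sumr (fun i => W (p i)))// pn p0.
by rewrite mulrAC ler_wpM2r ?invr_ge0 ?ler0n// ler_wpM2l// ler_norm.
Qed.

(** The product rule without Fubini. The increment of [N] over [x, y] is the integral of g (v(y) -
    v) + h (u(x) - u); the Hölder bounds on u and v make it at most y - x times the increment of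
    [W], so the telescoping bound shows that [N] takes the same value at both ends. *)
Lemma ac_parts u g v h : ac u g -> ac v h ->
  \int[mu]_(x in I) (g x * v x + u x * h x) = u 1 * v 1 - u (-1) * v (-1).
Proof.
move=> ug vh.
have sg := ug.1; have sh := vh.1; have su := ac_sq2 ug; have sv := ac_sq2 vh.
have Igv : int1 (-1) 1 (fun x => g x * v x + u x * h x).
  by apply: int1D; exact: sq2_mul.
pose N x := u x * v x - \int[mu]_(t in `[(-1)%R, x]) (g t * v t + u t * h t).
pose W x := \int[mu]_(t in `[(-1)%R, x]) (g t ^+ 2 + h t ^+ 2).
have IW : int1 (-1) 1 (fun t => g t ^+ 2 + h t ^+ 2).
  by apply: int1D; [exact: sg.2|exact: sh.2].
suff : N 1 = N (-1) by rewrite /N Rint_point; lra.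
apply: (@superadditive_bound_eq N W) => x y x1 xy y1.
have -> : W y - W x = \int[mu]_(t in `[x, y]) (g t ^+ 2 + h t ^+ 2).
  rewrite /W (@Rint_split _ (-1) y x)//; first by ring.
  exact: int1_sub IW.
set d := y - x; have d0 : 0 <= d by rewrite subr_ge0.
set G := \int[mu]_(t in `[x, y]) (g t ^+ 2); set H := \int[mu]_(t in `[x, y]) (h t ^+ 2).
have Ig : int1 x y (fun t => g t ^+ 2) by apply: int1_sub sg.2.
have Ih : int1 x y (fun t => h t ^+ 2) by apply: int1_sub sh.2.
rewrite RintD// -/G -/H.
have Ixy : int1 x y (fun x => g x * v x + u x * h x) by exact: int1_sub Igv.
have sgxy : sq2 x y g by exact: sq2_sub sg.
have shxy : sq2 x y h by exact: sq2_sub sh.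
have suxy : sq2 x y u by exact: sq2_sub su.
have svxy : sq2 x y v by exact: sq2_sub sv.
have Iex : int1 x y (fun t => g t * (v y - v t) + h t * (u x - u t)).
  by apply: int1D; apply: sq2_mul => //; apply: sq2B => //; exact: sq2_cst.
have -> : N y - N x = \int[mu]_(t in `[x, y]) (g t * (v y - v t) + h t * (u x - u t)).
  rewrite (@Rint_eq _ _ _ _ (fun t => (v y * g t + u x * h t) -
     (g t * v t + u t * h t))); last by move=> t _; ring.
  have I1 : int1 x y (fun t => v y * g t) by apply: int1Z; exact: sq2_int1.
  have I2 : int1 x y (fun t => u x * h t) by apply: int1Z; exact: sq2_int1.
  rewrite RintB//; last exact: int1D.
  rewrite RintD// !RintZ; [|exact: sq2_int1|exact: sq2_int1].
  rewrite -(ac_diff ug)// -(ac_diff vh)// /N.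
  rewrite (@Rint_split _ (-1) y x)//; first by ring.
  exact: int1_sub Igv.
apply: le_trans (Rint_norm Iex) _.
(* The degenerate interval is set apart because [amgm] cancels a factor d. *)
move: d0; rewrite le_eqVlt => /predU1P[d0|d0].
  have -> : y = x by apply/eqP; rewrite -subr_eq0 -/d d0.
  by rewrite Rint_point -d0 mul0r.
apply: (@le_trans _ _ (\int[mu]_(t in `[x, y])
   (2^-1 * (d * (g t ^+ 2 + h t ^+ 2) + (G + H))))).
  apply: Rint_le; first exact: int1_abs.
    by apply: int1Z; apply: int1D => //; apply: int1Z; exact: int1D.
  move=> t /andP[xt ty].
  have vt : (v y - v t) ^+ 2 <= d * H.
    apply: (le_trans (ac_sqr_le vh (le_trans x1 xt) ty y1)).
    rewrite ler_pM//; [by rewrite subr_ge0|by apply: Rint_ge0 => z _; exact: sqr_ge0|by rewrite lerB|].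
    by apply: Rint_subset => // z _; exact: sqr_ge0.
  have ut : (u x - u t) ^+ 2 <= d * G.
    rewrite -opprB sqrrN; apply: (le_trans (ac_sqr_le ug x1 xt (le_trans ty y1))).
    rewrite ler_pM//; [by rewrite subr_ge0|by apply: Rint_ge0 => z _; exact: sqr_ge0|by rewrite lerB|].
    by apply: Rint_subset => // z _; exact: sqr_ge0.
  (* AM-GM: [2 |a b| <= d a^2 + K] whenever [b^2 <= d K] *)
  have amgm a b K : b ^+ 2 <= d * K -> 2 * `|a * b| <= d * a ^+ 2 + K.
    move=> bK; rewrite normrM -(ler_pM2l d0).
    have := sqr_ge0 (d * `|a| - `|b|).
    rewrite -(real_normK (num_real b)) in bK; rewrite -(real_normK (num_real a)).
    nra.
  have := amgm (g t) _ _ vt; have := amgm (h t) _ _ ut.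
  have := ler_normD (g t * (v y - v t)) (h t * (u x - u t)).
  lra.
rewrite RintZ; last by apply: int1D => //; apply: int1Z; exact: int1D.
rewrite RintD//; last by apply: int1Z; exact: int1D.
rewrite RintZ; last exact: int1D.
rewrite RintD// Rint_cst// -/G -/H -/d; lra.
Qed.

(** Lebesgue differentiation recovers k almost everywhere from its primitive, which is 0. The
    differentiation theorem takes primitives from -oo, hence the extension of k by 0. *)
Lemma prim0_ae k : int1 (-1) 1 k ->
  (forall x, -1 <= x <= 1 -> \int[mu]_(t in `[(-1)%R, x]) k t = 0) ->
  ae_eq mu I k (cst 0).
Proof.
move=> Ik k0.
have IkT : mu.-integrable setT (EFin \o (k \_ I)).
  by have := iffLR (integrable_mkcond _ (measurable_seg (-1) 1)) Ik; rewrite restrict_EFin.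
have F0 x : \int[mu]_(t in `]-oo, x]) (k \_ I) t = 0.
  rewrite -Rintegral_mkcondr.
  have [x1|x1] := ltP x (-1).
    rewrite (_ : _ `&` _ = set0) ?Rintegral_set0//.
    apply/seteqP; split => t //=; rewrite !in_itv/= => -[tx /andP[t1 _]]; lra.
  rewrite (_ : _ `&` _ = `[-1, Num.min x 1]%classic) ?k0//.
    by rewrite le_min x1 ge0_cp//= ge_min lexx orbT.
  apply/seteqP; split => t /=; rewrite !in_itv/= le_min.
    by move=> [-> /andP[-> ->]].
  by move=> /and3P[-> -> ->].
have := @FTC1Ny _ (k \_ I) _ _.
have FF : (fun x => \int[mu]_(t in `]-oo, x]) (k \_ I) t) = cst 0.
  by apply/funext => x; exact: F0.
move=> /(_ _)/(_ _)/=; rewrite FF => H.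
have {}H := H _ _.
have : {ae mu, forall x, (k \_ I) x = 0}.
  have : {ae mu, forall x, derivable (cst 0 : R -> R) x 1 /\ derive1 (cst 0 : R -> R) x = (k \_ I) x}.
    apply: H.
      by move=> y; apply: integrableS IkT.
    split; [by case/integrableP : IkT => /measurable_EFinP|exact: openT|].
    move=> K _ cK; case/integrableP : IkT => m; apply: le_lt_trans.
    apply: ge0_subset_integral => //; first exact: compact_measurable.
    by apply/measurable_EFinP; apply: measurableT_comp => //; exact/measurable_EFinP.
  apply: filterS; first exact: (ae_filter_ringOfSetsType mu).
  by move=> x [_ <-]; rewrite derive1_cst.
apply: filterS; first exact: (ae_filter_ringOfSetsType mu).
by move=> x; rewrite patchE => + xI; rewrite mem_set.
Qed.

Lemma ac_unique u g h : ac u g -> ac u h -> ae_eq mu I g h.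
Proof.
move=> ug uh; have := acB ug uh; move=> [s H].
have : ae_eq mu I (fun x => g x - h x) (cst 0).
  apply: prim0_ae; first exact: sq2_int1.
  by move=> x x1; have := H x x1; rewrite !subrr add0r => <-.
by apply: filterS => x /[apply] /eqP; rewrite subr_eq0 => /eqP.
Qed.

(** The primitive of a nonnegative f is squeezed between 0 and the total integral, so it vanishes
    identically, and f is its derivative. *)
Lemma Rint_cont_pos_eq0 (f : R -> R) : continuous f ->
  (forall x, 0 <= f x) -> \int[mu]_(t in I) f t = 0 ->
  forall x, -1 < x < 1 -> f x = 0.
Proof.
move=> cf f0 If x /andP[x1 x2].
have intf : int1 (-1) 1 f by apply: int1_cont; exact: continuous_subspaceT.
have F0 y : -1 <= y <= 1 -> \int[mu]_(t in `[(-1)%R, y]) f t = 0.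
  move=> /andP[y1 y2]; apply/eqP; rewrite eq_le Rint_ge0 ?andbT//.
  by rewrite -If; apply: Rint_subset.
have [_ <-] := continuous_FTC1_closed x2 intf x1 (cf x).
rewrite derive1E (@near_eq_derive _ _ _ _ (cst 0)) ?derive_cst//.
near=> y; apply: F0; apply/andP; split; apply: ltW; near: y.
- exact: lt_nbhsr.
- exact: lt_nbhsl.
Unshelve. all: by end_near. Qed.

Lemma test_ac phi : test_function phi ->
  [/\ ac phi (derive1 phi), phi (-1) = 0 & phi 1 = 0].
Proof.
move=> [dphi cphi [K [cK K1 K0]]].
have c' : {within I, continuous (derive1 phi)} by exact: continuous_subspaceT.
have cp x : {for x, continuous phi}.
  by apply: differentiable_continuous; apply/derivable1_diffP.
split; last 2 first.
- by apply: K0 => /K1/=; rewrite in_itv/= ltxx.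
- by apply: K0 => /K1/=; rewrite in_itv/= ltxx andbF.
split; first exact: sq2_cont.
move=> x /andP[]; rewrite le_eqVlt => /predU1P[<-|x1 x2].
  by rewrite Rint_point addr0.
have E : (\int[mu]_(t in `[(-1)%R, x]) (derive1 phi t)%:E)%E =
    ((phi x)%:E - (phi (-1))%:E)%E.
  apply: (@continuous_FTC2 _ _ phi _ _ x1).
  - apply: continuous_subspaceT; exact: cphi.
  - split; first by move=> z _; exact: dphi.
    + apply: cvg_at_right_filter; exact: cp.
    + apply: cvg_at_left_filter; exact: cp.
  - by [].
by rewrite /Rintegral E -EFinB [fine _]/= addrC subrK.
Qed.

Lemma ac_weak u g : ac u g -> weak_derivative u g.
Proof.
move=> ug; split; first by apply/L2E; exact: ug.1.
move=> phi /test_ac[ap p0 p1].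
have := ac_parts ug ap; rewrite p0 p1 !mulr0 subrr RintD.
- by move/eqP; rewrite addrC addr_eq0 => /eqP.
- by apply: sq2_mul; [exact: ug.1|exact: ac_sq2 ap].
- by apply: sq2_mul; [exact: ac_sq2 ug|exact: ap.1].
Qed.

Lemma ac_W12 u g : ac u g -> W12 u.
Proof.
move=> ug; split; [exact: ac_cont ug|by apply/L2E; exact: ac_sq2 ug|].
by exists g; exact: ac_weak.
Qed.

End AbsolutelyContinuous.

(** * The du Bois-Reymond lemma, and W^{1,2} as a space of primitives *)

Section DuBoisReymond.
Variable R : realType.
Local Notation mu := (@lebesgue_measure R).
Local Notation I := (`[(-1 : R), 1]%classic).
Implicit Types (u v w g h phi : R -> R) (x y a b : R).

Lemma lipschitz1_continuous (f : R -> R) :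
  (forall x y, `|f x - f y| <= `|x - y|) -> continuous f.
Proof.
move=> fl x; apply/cvgrPdist_lt => e e0; apply/nbhs_ballP; exists e => //= y.
by apply: le_lt_trans; exact: fl.
Qed.

(** Supplies test functions with prescribed derivative. The support of [psi] makes the primitive
    vanish near -1, and the zero mean makes it vanish near 1 as well. *)
Lemma test_function_prim (psi : R -> R) (e : R) : 0 < e -> e < 1 -> continuous psi ->
  (forall x, 1 - e <= `|x| -> psi x = 0) -> \int[mu]_(t in I) psi t = 0 ->
  let phi := fun x => \int[mu]_(t in `[(-1)%R, x]) psi t in
  test_function phi /\ derive1 phi = psi.
Proof.
move=> e0 e1 cpsi psi0 Ipsi phi.
have ipsi a b : int1 a b psi by apply: int1_cont; exact: continuous_subspaceT.
have phiL x : x <= -1 + e -> phi x = 0.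
  move=> xe; rewrite /phi (@Rint_eq _ _ _ _ (fun=> 0)).
    have [x1|x1] := leP (-1) x; first by rewrite Rint_cst ?mul0r.
    by rewrite set_itv_ge ?Rintegral_set0// bnd_simp -ltNge.
  by move=> z /andP[z1 z2]; apply: psi0; rewrite ler0_norm; lra.
have phiR x : 1 - e <= x -> phi x = 0.
  move=> xe; have ex : -1 <= 1 - e by lra.
  have -> : phi x = phi (1 - e) + \int[mu]_(t in `[1 - e, x]) psi t.
    by rewrite /phi (@Rint_split _ _ _ (1 - e)).
  move: Ipsi; rewrite (@Rint_split _ _ _ (1 - e))//; last by lra.
  rewrite -/(phi _) (@Rint_eq _ (1 - e) 1 _ (fun=> 0)).
    rewrite Rint_cst; last by lra.
    rewrite mul0r addr0 => ->; rewrite add0r (@Rint_eq _ _ _ _ (fun=> 0)) ?Rint_cst ?mul0r//.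
    by move=> z /andP[z1 z2]; apply: psi0; rewrite ger0_norm; lra.
  by move=> z /andP[z1 z2]; apply: psi0; rewrite ger0_norm; lra.
have dphi x : derivable phi x 1 /\ derive1 phi x = psi x.
  (* The fundamental theorem of calculus covers x > -1; for the other x the primitive is 0 on a
     neighbourhood, by [phiL]. *)
  have [x1|x1] := ltP (-1) x.
    have xx : x < x + 1 by rewrite ltrDl.
    exact: (continuous_FTC1_closed xx (ipsi _ _) x1 (cpsi x)).
  have nx : {near x, (cst 0 : R -> R) =1 phi}.
    near=> y; rewrite phiL//; apply: ltW; near: y; apply: lt_nbhsl; lra.
  split; first by apply: near_eq_derivable nx _; exact: derivable_cst.
  rewrite derive1E -(near_eq_derive _ nx) derive_cst psi0// ler0_norm; lra.
have E : derive1 phi = psi by apply/funext => x; have [] := dphi x.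
split => //; split; first by move=> x; have [] := dphi x.
  by rewrite E.
exists `[-1 + e, 1 - e]%classic; split; first exact: segment_compact.
  by move=> z /=; rewrite !in_itv/= => /andP[? ?]; apply/andP; split; lra.
move=> x /negP; rewrite /= in_itv/= negb_and -!ltNge => /orP[/ltW|/ltW].
  exact: phiL.
exact: phiR.
Unshelve. all: by end_near. Qed.

(* Testing against [phi' = chi (w - m)], with [m] the mean of [w] weighted by
   the cut-off [chi], turns the hypothesis into [int chi (w - m)^2 = 0]. *)
Lemma du_bois_reymond w : {within I, continuous w} ->
  (forall phi, test_function phi -> \int[mu]_(x in I) (w x * derive1 phi x) = 0) ->
  forall x, -1 <= x <= 1 -> w x = w (-1).
Proof.
move=> cw Hw.
pose w' x := w (clamp x).
have cw' : continuous w' by exact: cont_clamp.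
have wE x : -1 <= x <= 1 -> w x = w' x by move=> x1; rewrite /w' clamp_id.
(* Test functions have compact support in the open interval, so constancy is first proved on |x| < 1
   - e, exactly where the tent [chi] is positive. *)
have loc (e : R) : 0 < e -> e < 1 ->
    forall x y, `|x| < 1 - e -> `|y| < 1 - e -> w x = w y.
  move=> e0 e1.
  pose chi x : R := Num.max 0 (1 - e - `|x|).
  have cchi : continuous chi.
    apply: lipschitz1_continuous => x y; rewrite /chi.
    have := lerB_dist x y; have := lerB_dist y x; rewrite (distrC y x).
    have := normr_ge0 (x - y).
    case: (leP 0 (1 - e - `|x|)) => ?; case: (leP 0 (1 - e - `|y|)) => ? ? ? ?;
    rewrite ler_norml; apply/andP; split; lra.
  have chi0 x : 0 <= chi x by rewrite /chi le_max lexx.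
  have chi_out x : 1 - e <= `|x| -> chi x = 0.
    by move=> xe; apply/max_idPl; lra.
  have chi_in x : `|x| < 1 - e -> 0 < chi x.
    by move=> xe; rewrite /chi lt_max orbC subr_gt0 xe.
  have ic (f : R -> R) : continuous f -> int1 (-1) 1 f.
    by move=> cf; apply: int1_cont; exact: continuous_subspaceT.
  set C := \int[mu]_(x in I) chi x.
  have C0 : 0 < C.
    rewrite lt_neqAle Rint_ge0// andbT; apply/eqP => /esym C0.
    have := Rint_cont_pos_eq0 cchi chi0 C0 (x := 0).
    rewrite ltrN10 ltr01 => /(_ isT) c0.
    by have := chi_in 0; rewrite normr0 c0 ltxx subr_gt0 => /(_ e1).
  pose m := (\int[mu]_(x in I) (chi x * w' x)) / C.
  have ccw : continuous (fun x => chi x * w' x).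
    by move=> x; apply: continuousM; [exact: cchi|exact: cw'].
  pose psi x := chi x * (w' x - m).
  have cpsi : continuous psi.
    move=> x; apply: continuousM; [exact: cchi|].
    by apply: continuousB; [exact: cw'|exact: cst_continuous].
  have Ipsi : \int[mu]_(x in I) psi x = 0.
    rewrite (@Rint_eq _ _ _ _ (fun x => chi x * w' x - m * chi x)); last first.
      by move=> x _; rewrite /psi; ring.
    rewrite RintB; [|exact: ic|by apply: int1Z; exact: ic].
    by rewrite RintZ; [rewrite -/C /m divfK ?gt_eqF// subrr|exact: ic].
  have [tphi dphi] := @test_function_prim psi e e0 e1 cpsi
    (fun x xe => etrans (congr1 (fun z => z * _) (chi_out x xe)) (mul0r _)) Ipsi.
  have := Hw _ tphi; rewrite dphi => Hpsi.
  pose q x := chi x * (w' x - m) ^+ 2.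
  have q0 x : 0 <= q x by rewrite mulr_ge0// sqr_ge0.
  have cq : continuous q.
    have -> : q = (fun x => psi x * (w' x - m)).
      by apply/funext => x; rewrite /q/psi; ring.
    move=> x; apply: continuousM; [exact: cpsi|].
    by apply: continuousB; [exact: cw'|exact: cst_continuous].
  have Iq : \int[mu]_(x in I) q x = 0.
    rewrite (@Rint_eq _ _ _ _ (fun x => w' x * psi x - m * psi x)); last first.
      by move=> x _; rewrite /q /psi; ring.
    rewrite RintB; [|by apply: ic => x; apply: continuousM; [exact: cw'|exact: cpsi]
                    |by apply: int1Z; exact: ic].
    rewrite RintZ ?Ipsi ?mulr0 ?subr0; last exact: ic.
    by rewrite -[RHS]Hpsi; apply: Rint_eq => x x1; rewrite wE.
  have wm x : `|x| < 1 - e -> w x = m.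
    move=> xe; have x1 : -1 < x < 1 by move: xe; rewrite ltr_norml => /andP[? ?]; lra.
    have /eqP := Rint_cont_pos_eq0 cq q0 Iq x1.
    rewrite /q mulf_eq0 gt_eqF ?chi_in//= sqrf_eq0 subr_eq0 => /eqP <-.
    by rewrite wE//; move: x1 => /andP[/ltW -> /ltW ->].
  by move=> x y /wm -> /wm ->.
have w0 x : -1 < x < 1 -> w x = w 0.
  move=> /andP[x1 x2].
  have nx : `|x| < 1 by rewrite ltr_norml x1.
  (* This e gives 1 - e = (1 + |x|) / 2 > |x|, so that both x and 0 are in range. *)
  apply: (loc ((1 - `|x|) / 2)); rewrite ?normr0; have := normr_ge0 x; lra.
have W := cont_eq_oo cw w0.
by move=> x x1; rewrite W// W// lexx ge0_cp.
Qed.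

(** Subtracting the primitive of g, which has the same weak derivative, leaves a continuous function
    with weak derivative 0. *)
Lemma weak_ac u g : {within I, continuous u} -> weak_derivative u g -> ac u g.
Proof.
move=> cu [/L2E sg H]; split => //.
pose G x := \int[mu]_(t in `[(-1)%R, x]) g t.
have aG : ac G g by exact: ac_prim.
have cG := ac_cont aG.
move=> x x1; rewrite -/(G x).
have : u x - G x = u (-1) - G (-1).
  apply: (@du_bois_reymond (fun x => u x - G x)) => //.
    by apply: within_continuousB.
  move=> phi tphi; have [ap p0 p1] := test_ac tphi.
  have iu : int1 (-1) 1 (fun x => u x * derive1 phi x).
    by apply: sq2_mul; [exact: sq2_cont|exact: ap.1].
  have iG : int1 (-1) 1 (fun x => G x * derive1 phi x).
    by apply: sq2_mul; [exact: sq2_cont|exact: ap.1].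
  rewrite (@Rint_eq _ _ _ _ (fun x => u x * derive1 phi x - G x * derive1 phi x)).
    by rewrite RintB// H// (ac_weak aG).2// subrr.
  by move=> y _; ring.
rewrite {2}/G Rint_point; lra.
Qed.

Lemma W12_ac u : W12 u -> ac u (wderiv u).
Proof.
move=> [cu _ ex]; apply: weak_ac => //.
by case: ex => g gP; exact: (@getPex _ [set g | weak_derivative u g] (ex_intro _ g gP)).
Qed.

Lemma ac_wderiv u g : ac u g -> ae_eq mu I (wderiv u) g.
Proof. by move=> ug; apply: ac_unique (ug); apply: W12_ac; exact: (ac_W12 ug). Qed.

End DuBoisReymond.

(* Locked so that conversion never unfolds the integral. *)
HB.lock Definition sqnorm (R : realType) (g : R -> R) : R :=
  \int[@lebesgue_measure R]_(x in `[(-1 : R), 1]) g x ^+ 2.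

(** * Completeness of L^2 with a geometric rate *)

Section L2Complete.
Variable R : realType.
Local Notation mu := (@lebesgue_measure R).
Local Notation I := (`[(-1 : R), 1]%classic).

Lemma sqnormE (g : R -> R) : sqnorm g = \int[mu]_(x in I) g x ^+ 2.
Proof. by rewrite unlock. Qed.

Lemma limn_einf_le (u : (\bar R)^nat) (c : \bar R) :
  (forall n, (u n <= c)%E) -> (limn_einf u <= c)%E.
Proof.
move=> uc; rewrite limn_einf_lim; apply: lime_le; first exact: is_cvg_einfs.
apply: nearW => n; apply: le_trans (uc n); apply: ereal_inf_lbound.
by exists n => /=.
Qed.

Lemma measurable_fun_limn_einf (D : set (measurableTypeR R)) (f : (measurableTypeR R -> \bar R)^nat) :
  (forall n, measurable_fun D (f n)) ->
  measurable_fun D (fun x => limn_einf (f ^~ x)).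
Proof.
move=> mf.
have -> : (fun x => limn_einf (f ^~ x)) =
    -%E \o (fun x => limn_esup (fun n => - f n x)%E).
  apply/funext => x /=; rewrite -limn_einfN; congr limn_einf.
  by apply/funext => n /=; rewrite oppeK.
apply: measurableT_comp => //.
by apply: measurable_fun_limn_esup => n; exact: measurableT_comp.
Qed.

Lemma measurable_sqr_sub (D : set (measurableTypeR R)) (f g : R -> R) :
  measurable_fun D f -> measurable_fun D g ->
  measurable_fun D (fun x => ((f x - g x) ^+ 2)%:E).
Proof.
move=> mf mg; apply/measurable_EFinP.
exact: (measurable_funX 2 (measurable_funB mf mg)).
Qed.

(** By monotone convergence the series of the |g (n+1) - g n| has a finite integral, so it is finite
    almost everywhere; there the telescoping series converges absolutely. *)
Lemma ae_cvg_of_summable (g : nat -> R -> R) (M : R) :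
  (forall n, sq2 (-1) 1 (g n)) ->
  (forall n, \sum_(0 <= k < n) \int[mu]_(x in I) `|g k.+1 x - g k x| <= M) ->
  {ae mu, forall x, I x -> cvgn (fun n => g n x)}.
Proof.
move=> sg gM.
pose D n x : \bar R := `|g n.+1 x - g n x|%:E.
have iD n : int1 (-1) 1 (fun x => `|g n.+1 x - g n x|).
  by apply: int1_abs; apply: sq2_int1; exact: sq2B.
have mD n : measurable_fun I (D n) by case/integrableP : (iD n).
have D0 n x : I x -> (0 <= D n x)%E by rewrite lee_fin.
have mI := @measurable_seg R (-1) 1.
have S : (\int[mu]_(x in I) \big[+%E/0%R]_(0 <= n <oo) D n x <= M%:E)%E.
  rewrite integral_nneseries//; apply: lime_le.
    by apply: is_cvg_nneseries => n _ _; apply: integral_ge0 => x xI; exact: D0.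
  apply: nearW => n; have := gM n; rewrite -lee_fin; apply: le_trans.
  rewrite -sumEFin le_eqVlt; apply/orP; left; apply/eqP; apply: eq_bigr => k _.
  by rewrite /Rintegral fineK//; exact: (integrable_fin_num mI (iD k)).
have : mu.-integrable I (fun x => \big[+%E/0%R]_(0 <= n <oo) D n x)%E.
  apply/integrableP; split.
    by apply: (@ge0_emeasurable_sum _ _ _ _ D xpredT) => // k x xI _; exact: D0.
  rewrite (le_lt_trans _ (ltry M))//; apply: le_trans S.
  rewrite le_eqVlt; apply/orP; left; apply/eqP; apply: eq_integral => x.
  by rewrite inE => xI; rewrite gee0_abs// nneseries_ge0// => n _ _; exact: D0.
move=> /(integrable_ae mI); apply: (@filterS _ _ (ae_filter_ringOfSetsType mu)) => x /[apply] fx.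
have cs : cvgn (series (fun n => g n.+1 x - g n x)).
  apply: normed_cvg; apply: nondecreasing_is_cvgn.
    apply: nondecreasing_series => n _ _; exact: normr_ge0.
  exists (fine (\big[+%E/0%R]_(0 <= n <oo) D n x)) => _ [n _ <-].
  rewrite -lee_fin fineK// /series/= -sumEFin.
  by apply: nneseries_lim_ge => k _ _; rewrite lee_fin.
have -> : (fun n => g n x) = (fun n => series (fun n => g n.+1 x - g n x) n + g 0%N x).
  by apply/funext => n; rewrite /series/= telescope_sumr// subrK.
by apply: is_cvgD => //; exact: is_cvg_cst.
Qed.

(** The Riesz-Fischer argument for a sequence that is already geometrically Cauchy: no subsequence
    has to be extracted, and the rate passes to the limit. *)
Lemma sq2_complete (g : nat -> R -> R) (C : R) :
  (forall n, sq2 (-1) 1 (g n)) ->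
  (forall n m, (n <= m)%N ->
    sqnorm (fun x => g n x - g m x) <= C * (1/4) ^+ n) ->
  exists2 h, sq2 (-1) 1 h &
    forall n, sqnorm (fun x => g n x - h x) <= C * (1/4) ^+ n.
Proof.
move=> sg gC'.
have gC n m : (n <= m)%N ->
    \int[mu]_(x in I) (g n x - g m x) ^+ 2 <= C * (1/4) ^+ n.
  by move=> /gC'; rewrite sqnormE.
have mI := @measurable_seg R (-1) 1.
have C0 : 0 <= C.
  have := gC 0%N 0%N (leqnn _); rewrite expr0 mulr1; apply: le_trans.
  by apply: Rint_ge0 => x _; exact: sqr_ge0.
have cae : {ae mu, forall x, I x -> cvgn (fun n => g n x)}.
  apply: (@ae_cvg_of_summable g (C + 2)) => // n.
  apply: (@le_trans _ _ (\sum_(0 <= k < n) ((C + 2) / 2) * (1/2) ^+ k)).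
    apply: ler_sum_nat => k _.
    have s := sq2B (sg k) (sg k.+1).
    have p0 : (0 : R) < (1/2) ^+ k by rewrite exprn_gt0// divr_gt0.
    (* Young's inequality |a| <= (a^2 / p + p) / 2 with p = 2^-k turns the bound C 4^-k on squares
       into (C + 2) / 2 times 2^-k, the 2 being the length of the interval; summing over k gives the
       bound C + 2. *)
    apply: (@le_trans _ _ (\int[mu]_(x in I) (1/2 * (((1/2) ^+ k)^-1 * (g k x - g k.+1 x) ^+ 2 + (1/2) ^+ k)))).
      apply: Rint_le.
      - by apply: int1_abs; apply: sq2_int1; exact: sq2B.
      - by apply: int1Z; apply: int1D => //; apply: int1Z; exact: s.2.
      move=> x _; rewrite distrC; set a := g k x - _; set p := _ ^+ k in p0 *.
      have q0 : 0 < p^-1 by rewrite invr_gt0.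
      have pq : p^-1 * p = 1 by rewrite mulVf// gt_eqF.
      rewrite -(real_normK (num_real a)).
      have := mulr_ge0 (ltW q0) (sqr_ge0 (`|a| - p)).
      have -> : p^-1 * (`|a| - p) ^+ 2 = p^-1 * `|a| ^+ 2 - 2 * (p^-1 * p) * `|a| + (p^-1 * p) * p by ring.
      rewrite pq; lra.
    rewrite RintZ; last by apply: int1D => //; apply: int1Z; exact: s.2.
    rewrite RintD//; last by apply: int1Z; exact: s.2.
    rewrite RintZ; last exact: s.2.
    rewrite Rint_cst; last by lra.
    have := gC k k.+1 (leqnSn _).
    have -> : (1/4 : R) ^+ k = (1/2) ^+ k * (1/2) ^+ k.
      by rewrite -exprMn; congr (_ ^+ _); field.
    set p := _ ^+ k in p0 *.
    have q0 : 0 < p^-1 by rewrite invr_gt0.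
    have pq : p^-1 * p = 1 by rewrite mulVf// gt_eqF.
    move=> /(ler_wpM2l (ltW q0)).
    have -> : p^-1 * (C * (p * p)) = (p^-1 * p) * C * p by ring.
    rewrite pq; lra.
  rewrite -mulr_sumr.
  have := @geometric_le_lim R n 1 (1/2) _ _ _.
  rewrite /series/= ger0_norm; last by lra.
  under eq_bigr do rewrite mul1r.
  move=> /(_ _ _ _); have -> : 1 / (1 - 1 / 2) = 2 :> R by field.
  move=> H; have {}H : \sum_(0 <= k < n) (1/2 : R) ^+ k <= 2 by under eq_bigr do rewrite div1r; under eq_bigr do rewrite -[_ ^+ _]mul1r; apply: H; lra.
  have : 0 <= (C + 2) / 2 by lra.
  nra.
(* The upper limit is measurable everywhere and is the limit wherever there is one. *)
pose h x := fine (limn_esup (fun n => (g n x)%:E)).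
have mg n : measurable_fun I (g n) by case: (sg n).
have mh : measurable_fun I h.
  apply: measurableT_comp; first exact: fine_measurable.
  by apply: measurable_fun_limn_esup => n; exact/measurable_EFinP.
have ch : {ae mu, forall x, I x -> (fun n => g n x) @ \oo --> h x}.
  move: cae; apply: (@filterS _ _ (ae_filter_ringOfSetsType mu)) => x /[apply] cx.
  have /(cvg_limn_einf_sup)[_ E] : (fun n => (g n x)%:E) @ \oo --> (limn (fun n => g n x))%:E.
    by apply: cvg_EFin => //; exact: nearW.
  by rewrite /h E.
(* Fatou's lemma passes to the limit m -> oo in the Cauchy estimate between g n and g (m + n). *)
have F n : (\int[mu]_(x in I) ((g n x - h x) ^+ 2)%:E <= (C * (1/4) ^+ n)%:E)%E.
  have -> : (\int[mu]_(x in I) ((g n x - h x) ^+ 2)%:E =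
     \int[mu]_(x in I) limn_einf (fun m => ((g n x - g (m + n)%N x) ^+ 2)%:E))%E.
    apply: ae_eq_integral => //.
    - exact: (measurable_sqr_sub (mg n) mh).
    - apply: measurable_fun_limn_einf => m; exact: (measurable_sqr_sub (mg n) (mg _)).
    move: ch; apply: (@filterS _ _ (ae_filter_ringOfSetsType mu)) => x /[apply] cx.
    have /(cvg_limn_einf_sup)[-> _] // : (fun m => ((g n x - g (m + n)%N x) ^+ 2)%:E) @ \oo --> ((g n x - h x) ^+ 2)%:E.
    apply: cvg_EFin; first exact: nearW.
    have cs : (fun m => g (m + n)%N x) @ \oo --> h x by move: cx; rewrite -(cvg_shiftn n).
    have cd : (fun m => g n x - g (m + n)%N x) @ \oo --> g n x - h x by apply: cvgB => //; exact: cvg_cst.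
    rewrite expr2; exact: cvgM.
  apply: (le_trans (fatou mu mI _ _)).
  - move=> m; exact: (measurable_sqr_sub (mg n) (mg _)).
  - by move=> m x _; rewrite lee_fin sqr_ge0.
  apply: limn_einf_le => m.
  have s : sq2 (-1) 1 (fun x => g n x - g (m + n)%N x) by exact: sq2B.
  have := gC n (m + n)%N (leq_addl _ _); rewrite -lee_fin; apply: le_trans.
  rewrite /Rintegral fineK//; apply: integrable_fin_num => //; exact: s.2.
have sd n : sq2 (-1) 1 (fun x => g n x - h x).
  split; first exact: (measurable_funB (mg n) mh).
  apply/integrableP; split.
    exact: (measurable_sqr_sub (mg n) mh).
  rewrite (le_lt_trans _ (ltry (C * (1/4) ^+ n)))//; apply: le_trans (F n).
  rewrite le_eqVlt; apply/orP; left; apply/eqP; apply: eq_integral => x _.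
  by rewrite /= ger0_norm// sqr_ge0.
exists h.
  by apply: sq2_eq (sq2B (sg 0%N) (sd 0%N)) => x _; ring.
move=> n; rewrite sqnormE -lee_fin; apply: le_trans (F n).
rewrite /Rintegral fineK//; apply: integrable_fin_num => //; exact: (sd n).2.
Qed.

End L2Complete.

(** * Continuity on [-1, 1] of polynomial expressions *)

Section ContinuousOnI.
Variable R : realType.
Implicit Types (f g : R -> R).

Definition cI f := {within `[(-1 : R), 1], continuous f}.

Lemma cI_cst k : cI (fun=> k).
Proof. by apply: continuous_subspaceT => x; exact: cst_continuous. Qed.

Lemma cID f g : cI f -> cI g -> cI (fun x => f x + g x).
Proof. by move=> cf cg x; apply: continuousD; [exact: cf|exact: cg]. Qed.

Lemma cIM f g : cI f -> cI g -> cI (fun x => f x * g x).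
Proof. by move=> cf cg x; apply: continuousM; [exact: cf|exact: cg]. Qed.

Lemma cIB f g : cI f -> cI g -> cI (fun x => f x - g x).
Proof. by move=> cf cg x; apply: continuousB; [exact: cf|exact: cg]. Qed.

Lemma cIX2 f : cI f -> cI (fun x => f x ^+ 2).
Proof.
move=> cf; rewrite (_ : (fun x => _) = (fun x => f x * f x)); first exact: cIM.
by apply/funext => x; rewrite expr2.
Qed.

Lemma cI_int1 f : cI f -> int1 (-1) 1 f. Proof. exact: int1_cont. Qed.

End ContinuousOnI.

(** The clause for differences comes before the one for sums, since a difference is a sum with an
    opposite and no clause treats opposites alone. Powers are assumed to be squares. *)
Ltac tac_cI := repeat match goal with
  | |- cI (fun x => GRing.add (@?f x) (GRing.opp (@?g x))) => apply (@cIB _ f g)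
  | |- cI (fun x => GRing.add (@?f x) (@?g x)) => apply (@cID _ f g)
  | |- cI (fun x => GRing.mul (@?f x) (@?g x)) => apply (@cIM _ f g)
  | |- cI (fun x => GRing.exp (@?f x) _) => apply (@cIX2 _ f)
  | |- cI (fun _ => ?k) => apply (@cI_cst _ k)
  | |- _ => assumption
  end.

(** * Expansion of the bulk potential along a line *)

Section Polynomials.
Variables (R : realType) (l c : R).
Implicit Types (x y m n t : R).

(* The Taylor coefficients [V1], ..., [V4] of the bulk potential are taken at
   (x, y, m, n) in the direction (d1, d2, e1, e2). *)
Definition V x y m n : R :=
  (x ^+ 2 + y ^+ 2 - 1) ^+ 2 + 1 / 4 * (m ^+ 2 + n ^+ 2 - 1) ^+ 2
  - c * x * (m ^+ 2 - n ^+ 2) - 2 * c * y * m * n.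

Definition V1 x y m n (d1 d2 e1 e2 : R) : R :=
  4 * (x ^+ 2 + y ^+ 2 - 1) * (x * d1 + y * d2)
  + (m ^+ 2 + n ^+ 2 - 1) * (m * e1 + n * e2)
  - c * (d1 * (m ^+ 2 - n ^+ 2) + 2 * d2 * m * n + 2 * x * (m * e1 - n * e2)
         + 2 * y * (m * e2 + n * e1)).

Definition V2 x y m n (d1 d2 e1 e2 : R) : R :=
  4 * (x * d1 + y * d2) ^+ 2 + 2 * (x ^+ 2 + y ^+ 2 - 1) * (d1 ^+ 2 + d2 ^+ 2)
  + (m * e1 + n * e2) ^+ 2 + 1 / 2 * (m ^+ 2 + n ^+ 2 - 1) * (e1 ^+ 2 + e2 ^+ 2)
  - c * (2 * d1 * (m * e1 - n * e2) + 2 * d2 * (m * e2 + n * e1)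
         + x * (e1 ^+ 2 - e2 ^+ 2) + 2 * y * e1 * e2).

Definition V3 x y m n (d1 d2 e1 e2 : R) : R :=
  4 * (x * d1 + y * d2) * (d1 ^+ 2 + d2 ^+ 2)
  + (m * e1 + n * e2) * (e1 ^+ 2 + e2 ^+ 2)
  - c * (d1 * (e1 ^+ 2 - e2 ^+ 2) + 2 * d2 * e1 * e2).

Definition V4 (d1 d2 e1 e2 : R) : R :=
  (d1 ^+ 2 + d2 ^+ 2) ^+ 2 + 1 / 4 * (e1 ^+ 2 + e2 ^+ 2) ^+ 2.

Lemma V_taylor x y m n (d1 d2 e1 e2 t : R) :
  V (x + t * d1) (y + t * d2) (m + t * e1) (n + t * e2) =
  V x y m n + t * V1 x y m n d1 d2 e1 e2 + t ^+ 2 * V2 x y m n d1 d2 e1 e2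
  + t ^+ 3 * V3 x y m n d1 d2 e1 e2 + t ^+ 4 * V4 d1 d2 e1 e2.
Proof. by rewrite /V /V1 /V2 /V3 /V4; field. Qed.

(** The first-order condition at a minimum t = 0. For small t the linear term dominates, and testing
    t and -t excludes both signs of c1. *)
Lemma poly4_ge0 c1 c2 c3 c4 :
  (forall t, 0 <= t * c1 + t ^+ 2 * c2 + t ^+ 3 * c3 + t ^+ 4 * c4) -> c1 = 0 :> R.
Proof.
move=> H; apply/eqP/negPn/negP => c10.
pose K := `|c2| + `|c3| + `|c4|.
have K0 : 0 <= K by rewrite !addr_ge0.
have n1 : 0 < `|c1| by rewrite normr_gt0.
have s0 : 0 < 2 * (K + `|c1| + 1) by lra.
(* Small enough that t <= 1 and t K < |c1|, contradicting t |c1| <= t^2 K. *)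
pose t := `|c1| / (2 * (K + `|c1| + 1)).
have t0 : 0 < t by rewrite divr_gt0.
have tE : t * (2 * (K + `|c1| + 1)) = `|c1| by rewrite /t divfK// gt_eqF.
have t1 : t <= 1 by rewrite /t ler_pdivrMr//; lra.
have Hp := H t; have Hm := H (- t).
have t2 : 0 < t ^+ 2 by rewrite exprn_gt0.
have B2 := ler_norm c2; have B4 := ler_norm c4.
have B3 := ler_norm c3; have B3' := ler_norm (- c3); rewrite normrN in B3'.
have t32 : t ^+ 3 <= t ^+ 2 by rewrite (exprS t 2) ger_pMl.
have t42 : t ^+ 4 <= t ^+ 2.
  by apply: le_trans t32; rewrite (exprS t 3) ger_pMl// exprn_gt0.
have t30 : 0 < t ^+ 3 by rewrite exprn_gt0.
have t40 : 0 < t ^+ 4 by rewrite exprn_gt0.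
have key : t * `|c1| <= t ^+ 2 * K.
  have c2b : t ^+ 2 * c2 <= t ^+ 2 * `|c2| by rewrite ler_pM2l.
  have c4b : t ^+ 4 * c4 <= t ^+ 2 * `|c4|.
    by apply: (@le_trans _ _ (t ^+ 4 * `|c4|)); [rewrite ler_pM2l|rewrite ler_wpM2r].
  have c3b : t ^+ 3 * c3 <= t ^+ 2 * `|c3|.
    by apply: (@le_trans _ _ (t ^+ 3 * `|c3|)); [rewrite ler_pM2l|rewrite ler_wpM2r].
  have c3b' : t ^+ 3 * (- c3) <= t ^+ 2 * `|c3|.
    by apply: (@le_trans _ _ (t ^+ 3 * `|c3|)); [rewrite ler_pM2l|rewrite ler_wpM2r].
  have e2 : (- t) ^+ 2 = t ^+ 2 by ring.
  have e3 : (- t) ^+ 3 = - t ^+ 3 by ring.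
  have e4 : (- t) ^+ 4 = t ^+ 4 by ring.
  rewrite e2 e3 e4 in Hm.
  move: Hp Hm c2b c4b c3b c3b'; rewrite /K; clear - t0.
  by case: (ger0P c1) => _; lra.
have : `|c1| <= t * K by move: key; rewrite expr2 -mulrA ler_pM2l.
have : 0 < t * (`|c1| + 1) by rewrite mulr_gt0//; lra.
lra.
Qed.

Lemma is_derive_poly4 k c1 c2 c3 c4 :
  is_derive (0 : R) 1 (fun t : R => k + t * c1 + t ^+ 2 * c2 + t ^+ 3 * c3 + t ^+ 4 * c4) c1.
Proof.
apply: is_derive_eq.
rewrite /GRing.scale/=; ring.
Qed.

End Polynomials.

(** * The energy and its exact expansion along a line *)

Section Energy.
Variables (R : realType) (l c : R).
Local Notation mu := (@lebesgue_measure R).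
Local Notation I := (`[(-1 : R), 1]%classic).
Implicit Types (u v g h f : R -> R).

Lemma ac_cI u g : ac u g -> cI u. Proof. exact: ac_cont. Qed.

Lemma Rint_ae_eq f g : int1 (-1) 1 f -> int1 (-1) 1 g -> ae_eq mu I f g ->
  \int[mu]_(x in I) f x = \int[mu]_(x in I) g x.
Proof.
move=> If Ig fg; rewrite /Rintegral; congr fine; apply: ae_eq_integral.
- exact: measurable_seg.
- by case/integrableP : If.
- by case/integrableP : Ig.
- by move: fg; apply: (@filterS _ _ (ae_filter_ringOfSetsType mu)) => x /[apply] ->.
Qed.

Section FourComponents.
Variables (u1 u2 u3 u4 g1 g2 g3 g4 : R -> R).
Hypotheses (a1 : ac u1 g1) (a2 : ac u2 g2) (a3 : ac u3 g3) (a4 : ac u4 g4).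

Definition dens (x : R) := l / 2 * (g1 x ^+ 2 + g2 x ^+ 2 + g3 x ^+ 2 + g4 x ^+ 2)
  + V c (u1 x) (u2 x) (u3 x) (u4 x).

Lemma int1_V : int1 (-1) 1 (fun x => V c (u1 x) (u2 x) (u3 x) (u4 x)).
Proof.
apply: cI_int1; have := ac_cI a1; have := ac_cI a2; have := ac_cI a3; have := ac_cI a4.
rewrite /V => ? ? ? ?; tac_cI.
Qed.

Lemma int1_dens : int1 (-1) 1 dens.
Proof.
apply: int1D; last exact: int1_V.
by apply: int1Z; do ![apply: int1D]; [exact: a1.1.2|exact: a2.1.2|exact: a3.1.2|exact: a4.1.2].
Qed.

End FourComponents.

(** Frees the energy from the representatives chosen by [wderiv]: two derivatives of the same
    function agree almost everywhere. *)
Lemma full_energyE u1 u2 u3 u4 g1 g2 g3 g4 :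
  ac u1 g1 -> ac u2 g2 -> ac u3 g3 -> ac u4 g4 ->
  full_energy l c u1 u2 u3 u4 =
  \int[mu]_(x in I) dens u1 u2 u3 u4 g1 g2 g3 g4 x.
Proof.
move=> a1 a2 a3 a4.
have w1 := W12_ac (ac_W12 a1); have w2 := W12_ac (ac_W12 a2).
have w3 := W12_ac (ac_W12 a3); have w4 := W12_ac (ac_W12 a4).
transitivity (\int[mu]_(x in I) dens u1 u2 u3 u4 (wderiv u1) (wderiv u2) (wderiv u3) (wderiv u4) x).
  by apply: Rint_eq => x _; rewrite /dens /V; ring.
apply: Rint_ae_eq; [exact: int1_dens|exact: int1_dens|].
have e1 := ac_wderiv a1; have e2 := ac_wderiv a2.
have e3 := ac_wderiv a3; have e4 := ac_wderiv a4.
have F := ae_filter_ringOfSetsType mu.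
move: (@filterI _ _ F _ _ (@filterI _ _ F _ _ e1 e2) (@filterI _ _ F _ _ e3 e4)).
apply: (@filterS _ _ F) => x [[E1 E2] [E3 E4]] xI.
by rewrite /dens E1// E2// E3// E4.
Qed.

(** The integrands need not agree pointwise, since [wderiv (cst 0)] is 0 only almost everywhere. *)
Lemma or_full u3 u1 g1 g3 : ac u1 g1 -> ac u3 g3 ->
  or_energy l c u1 u3 = full_energy l c u1 (cst 0) u3 (cst 0).
Proof.
move=> a1 a3.
have w1 := W12_ac (ac_W12 a1); have w3 := W12_ac (ac_W12 a3).
have z := @ac_cst R 0.
rewrite (full_energyE w1 z w3 z); apply: Rint_eq => x _.
by rewrite /dens /V /=; ring.
Qed.

Section Perturbation.
Variables (u1 u2 u3 u4 g1 g2 g3 g4 : R -> R).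
Variables (v1 v2 v3 v4 h1 h2 h3 h4 : R -> R).
Hypotheses (a1 : ac u1 g1) (a2 : ac u2 g2) (a3 : ac u3 g3) (a4 : ac u4 g4).
Hypotheses (b1 : ac v1 h1) (b2 : ac v2 h2) (b3 : ac v3 h3) (b4 : ac v4 h4).

Definition dens1 x :=
  l * (g1 x * h1 x + g2 x * h2 x + g3 x * h3 x + g4 x * h4 x)
  + V1 c (u1 x) (u2 x) (u3 x) (u4 x) (v1 x) (v2 x) (v3 x) (v4 x).
Definition dens2 x :=
  l / 2 * (h1 x ^+ 2 + h2 x ^+ 2 + h3 x ^+ 2 + h4 x ^+ 2)
  + V2 c (u1 x) (u2 x) (u3 x) (u4 x) (v1 x) (v2 x) (v3 x) (v4 x).
Definition dens3 x := V3 c (u1 x) (u2 x) (u3 x) (u4 x) (v1 x) (v2 x) (v3 x) (v4 x).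
Definition dens4 x := V4 (v1 x) (v2 x) (v3 x) (v4 x).

Let cs := (ac_cI a1, ac_cI a2, ac_cI a3, ac_cI a4, ac_cI b1, ac_cI b2, ac_cI b3, ac_cI b4).

Lemma int1_dens1 : int1 (-1) 1 dens1.
Proof.
apply: int1D.
  apply: int1Z; do ![apply: int1D]; apply: sq2_mul;
  by [exact: a1.1|exact: a2.1|exact: a3.1|exact: a4.1|exact: b1.1|exact: b2.1|exact: b3.1|exact: b4.1].
apply: cI_int1; case: cs => [[[[[[[? ?] ?] ?] ?] ?] ?] ?]; rewrite /V1; tac_cI.
Qed.

Lemma int1_dens2 : int1 (-1) 1 dens2.
Proof.
apply: int1D.
  by apply: int1Z; do ![apply: int1D]; [exact: b1.1.2|exact: b2.1.2|exact: b3.1.2|exact: b4.1.2].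
apply: cI_int1; case: cs => [[[[[[[? ?] ?] ?] ?] ?] ?] ?]; rewrite /V2; tac_cI.
Qed.

Lemma int1_dens3 : int1 (-1) 1 dens3.
Proof.
apply: cI_int1; case: cs => [[[[[[[? ?] ?] ?] ?] ?] ?] ?]; rewrite /dens3 /V3; tac_cI.
Qed.

Lemma int1_dens4 : int1 (-1) 1 dens4.
Proof.
apply: cI_int1; case: cs => [[[[[[[? ?] ?] ?] ?] ?] ?] ?]; rewrite /dens4 /V4; tac_cI.
Qed.

(** Exact because the elastic density is quadratic and the bulk potential quartic, so v may have any
    size. *)
Lemma full_energy_taylor (t : R) :
  full_energy l c (fun x => u1 x + t * v1 x) (fun x => u2 x + t * v2 x)
    (fun x => u3 x + t * v3 x) (fun x => u4 x + t * v4 x) =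
  full_energy l c u1 u2 u3 u4 + t * (\int[mu]_(x in I) dens1 x)
  + t ^+ 2 * (\int[mu]_(x in I) dens2 x) + t ^+ 3 * (\int[mu]_(x in I) dens3 x)
  + t ^+ 4 * (\int[mu]_(x in I) dens4 x).
Proof.
rewrite (full_energyE (acD a1 (acZ t b1)) (acD a2 (acZ t b2)) (acD a3 (acZ t b3)) (acD a4 (acZ t b4))).
rewrite (full_energyE a1 a2 a3 a4).
rewrite (@Rint_eq _ _ _ _ (fun x => dens u1 u2 u3 u4 g1 g2 g3 g4 x + t * dens1 x +
  t ^+ 2 * dens2 x + t ^+ 3 * dens3 x + t ^+ 4 * dens4 x)); last first.
  by move=> x _; rewrite /dens V_taylor /dens1 /dens2 /dens3 /dens4; field.
have i0 := int1_dens a1 a2 a3 a4.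
have i1 := int1Z t int1_dens1; have i2 := int1Z (t ^+ 2) int1_dens2.
have i3 := int1Z (t ^+ 3) int1_dens3; have i4 := int1Z (t ^+ 4) int1_dens4.
have i01 := int1D i0 i1; have i012 := int1D i01 i2; have i0123 := int1D i012 i3.
rewrite (RintD i0123 i4) (RintD i012 i3) (RintD i01 i2) (RintD i0 i1).
by rewrite (RintZ _ int1_dens1) (RintZ _ int1_dens2) (RintZ _ int1_dens3) (RintZ _ int1_dens4).
Qed.

Lemma full_energy_derive :
  is_derive (0 : R) 1 (fun t : R => full_energy l c
    (fun x => u1 x + t * v1 x) (fun x => u2 x + t * v2 x)
    (fun x => u3 x + t * v3 x) (fun x => u4 x + t * v4 x)) (\int[mu]_(x in I) dens1 x).
Proof.
rewrite (_ : (fun t : R => _) = (fun t => full_energy l c u1 u2 u3 u4 + t * (\int[mu]_(x in I) dens1 x)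
  + t ^+ 2 * (\int[mu]_(x in I) dens2 x) + t ^+ 3 * (\int[mu]_(x in I) dens3 x)
  + t ^+ 4 * (\int[mu]_(x in I) dens4 x))); first exact: is_derive_poly4.
by apply/funext => t; exact: full_energy_taylor.
Qed.

End Perturbation.
End Energy.

(** * Regularity of weak solutions and the second derivative test *)

Section Regularity.
Variable R : realType.
Local Notation mu := (@lebesgue_measure R).
Local Notation I := (`[(-1 : R), 1]%classic).
Implicit Types (u v g h f q qg : R -> R) (x y a b : R).

Lemma prim_derive h x : continuous h -> -1 < x ->
  derivable (fun y => \int[mu]_(t in `[(-1)%R, y]) h t) x 1 /\
  derive1 (fun y => \int[mu]_(t in `[(-1)%R, y]) h t) x = h x.
Proof.
move=> ch x1; have xx : x < x + 1 by rewrite ltrDl.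
have ih : int1 (-1) (x + 1) h by apply: int1_cont; exact: continuous_subspaceT.
exact: (continuous_FTC1_closed xx ih x1 (ch x)).
Qed.

(* Testing the weak equation against [w] minus its affine interpolant, where
   [w = l u - H2] and [H2'' = h], shows that [w] is affine. *)
Lemma weak_solution_affine (l : R) u g h : 0 < l -> ac u g -> continuous h ->
  (forall q qg, ac q qg -> q (-1) = 0 -> q 1 = 0 ->
     \int[mu]_(x in I) (l * (g x * qg x) + h x * q x) = 0) ->
  let H1 := fun y => \int[mu]_(t in `[(-1)%R, y]) h t in
  let H2 := fun y => \int[mu]_(t in `[(-1)%R, y]) H1 (clamp t) in
  exists a b, forall x, -1 <= x <= 1 -> l * u x = H2 x + (b + a * x).
Proof.
move=> l0 ug ch weak H1 H2.
have sh : sq2 (-1) 1 h by apply: sq2_cont; exact: continuous_subspaceT.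
have aH1 : ac H1 h by exact: ac_prim.
have cH1 : continuous (fun x => H1 (clamp x)) by apply: cont_clamp; exact: ac_cont aH1.
have aH2 : ac H2 (fun x => H1 (clamp x)).
  by apply: ac_prim; apply: sq2_cont; exact: continuous_subspaceT.
pose w x := l * u x - H2 x.
have aw : ac w (fun x => l * g x - H1 (clamp x)) by apply: acB => //; exact: acZ.
pose a := (w 1 - w (-1)) / 2; pose b := w (-1) + a.
pose phi x := w x - (b + a * x).
pose dphi x := (l * g x - H1 (clamp x)) - (0 + a * 1).
have aphi : ac phi dphi.
  by apply: acB => //; apply: acD; [exact: ac_cst|apply: acZ; exact: ac_id].
have p0 : phi (-1) = 0 by rewrite /phi /b; ring.
have p1 : phi 1 = 0 by rewrite /phi /b /a; field.
have I0 : \int[mu]_(x in I) (dphi x ^+ 2) = 0.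
  have E1 := weak _ _ aphi p0 p1.
  have E2 := ac_parts aH1 aphi; rewrite p0 p1 !mulr0 subrr in E2.
  have E3 := ac_parts (ac_cst (R := R) a) aphi; rewrite p0 p1 !mulr0 subrr in E3.
  have i1 : int1 (-1) 1 (fun x => l * (g x * dphi x) + h x * phi x).
    apply: int1D; first by apply: int1Z; apply: sq2_mul; [exact: ug.1|exact: aphi.1].
    by apply: sq2_mul => //; exact: ac_sq2 aphi.
  have i2 : int1 (-1) 1 (fun x => h x * phi x + H1 x * dphi x).
    by apply: int1D; apply: sq2_mul; [|exact: ac_sq2 aphi|exact: ac_sq2 aH1|exact: aphi.1].
  have i3 : int1 (-1) 1 (fun x => 0 * phi x + a * dphi x).
    by apply: int1D; apply: int1Z; apply: sq2_int1; [exact: ac_sq2 aphi|exact: aphi.1].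
  (* On [-1, 1], dphi = l g - H1 - a. Hence dphi^2 is the weak equation tested with [phi], minus the
     derivatives of [H1 * phi] and [a * phi], whose integrals vanish because [phi] does at both
     ends. *)
  rewrite (@Rint_eq _ _ _ _ (fun x => ((l * (g x * dphi x) + h x * phi x) -
     (h x * phi x + H1 x * dphi x)) - (0 * phi x + a * dphi x))); last first.
    move=> x x1; have dE : dphi x = l * g x - H1 x - a by rewrite /dphi clamp_id//; ring.
    by rewrite dE; ring.
  by rewrite (RintB (int1B i1 i2) i3) (RintB i1 i2) E1 E2 E3 !subrr.
exists a, b => x x1.
have := ac_sqr_leI aphi (x := -1) (y := x); rewrite lexx ge0_cp//= I0 mulr0.
move=> /(_ isT x1); rewrite p0 subr0 real_exprn_even_le0//= => /eqP.
rewrite /phi /w; lra.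
Qed.

(** Two applications of the fundamental theorem of calculus. The formula for u is known on [-1, 1]
    only, so derivatives are transferred through equality near interior points. *)
Lemma affine_twice_derivable (l : R) u h a b : 0 < l -> continuous h ->
  let H1 := fun y => \int[mu]_(t in `[(-1)%R, y]) h t in
  let H2 := fun y => \int[mu]_(t in `[(-1)%R, y]) H1 (clamp t) in
  (forall x, -1 <= x <= 1 -> l * u x = H2 x + (b + a * x)) ->
  forall x, -1 < x < 1 -> twice_derivable u x /\ l * derive1n 2 u x = h x.
Proof.
move=> l0 ch H1 H2 uE.
have sh : sq2 (-1) 1 h by apply: sq2_cont; exact: continuous_subspaceT.
have aH1 : ac H1 h by exact: ac_prim.
have cH1 : continuous (fun x => H1 (clamp x)) by apply: cont_clamp; exact: ac_cont aH1.
have oo x : -1 < x < 1 -> \forall y \near x, -1 < y < 1.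
  move=> /andP[x1 x2]; near=> y; apply/andP; split; near: y.
    exact: lt_nbhsr.
  exact: lt_nbhsl.
have uE' x : -1 < x < 1 -> u x = l^-1 * (H2 x + (b + a * x)).
  move=> /andP[x1 x2]; rewrite -uE; first by rewrite mulKf// gt_eqF.
  by rewrite !ltW.
have d1 x : -1 < x < 1 -> is_derive x 1 u (l^-1 * (H1 x + a)).
  move=> x1; have [dH2 eH2] := prim_derive cH1 (andP x1).1.
  have iH2 : is_derive x 1 H2 (H1 x).
    rewrite clamp_id in eH2; last by case/andP: x1 => /ltW -> /ltW ->.
    exact: (DeriveDef dH2 (etrans (esym (derive1E _ _)) eH2)).
  have : is_derive x 1 (fun x => l^-1 * (H2 x + (b + a * x))) (l^-1 * (H1 x + a)).
    apply: is_derive_eq; rewrite /GRing.scale/=; ring.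
  apply: near_eq_is_derive; rewrite ?oner_eq0//.
  by near=> y; rewrite uE'//; near: y; exact: oo.
have d1E x : -1 < x < 1 -> derive1 u x = l^-1 * (H1 x + a).
  by move=> /d1 dx; rewrite derive1E derive_val.
move=> x x1.
have d2 : is_derive x 1 (derive1 u) (l^-1 * h x).
  have [dH1 eH1] := prim_derive ch (andP x1).1.
  have iH1 : is_derive x 1 H1 (h x) by exact: (DeriveDef dH1 (etrans (esym (derive1E _ _)) eH1)).
  have : is_derive x 1 (fun x => l^-1 * (H1 x + a)) (l^-1 * h x).
    apply: is_derive_eq; rewrite /GRing.scale/=; ring.
  apply: near_eq_is_derive; rewrite ?oner_eq0//.
  by near=> y; rewrite d1E//; near: y; exact: oo.
split; last first.
  by rewrite /derive1n/= derive1E derive_val mulrA divff ?mul1r// gt_eqF.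
split; last exact: ex_derive.
by near=> y; have : -1 < y < 1; [near: y; exact: oo|move=> /d1 ?; exact: ex_derive].
Unshelve. all: by end_near. Qed.

Lemma weak_solution_C2 (l : R) u g h : 0 < l -> ac u g -> cI h ->
  (forall q qg, ac q qg -> q (-1) = 0 -> q 1 = 0 ->
     \int[mu]_(x in I) (l * (g x * qg x) + h x * q x) = 0) ->
  forall x, -1 < x < 1 -> twice_derivable u x /\ l * derive1n 2 u x = h x.
Proof.
move=> l0 ug /cont_clamp ch weak x x1.
have [q qg aq q0 q1|a [b uE]] := weak_solution_affine l0 ug ch.
  rewrite -[RHS](weak _ _ aq q0 q1); apply: Rint_eq => y y1.
  by rewrite clamp_id.
have [d e] := affine_twice_derivable l0 ch uE x1; split => //.
by rewrite e clamp_id//; case/andP: x1 => /ltW -> /ltW ->.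
Qed.

(** If l u'' = h were positive at an interior maximum y, it would be so just to the right of y; with
    u'(y) = 0, the mean value theorem for u and then for u' would give u(z) > u(y). *)
Lemma C2_max_le0 (l : R) u h y : 0 < l -> cI h -> -1 < y < 1 ->
  (forall x, -1 < x < 1 -> twice_derivable u x /\ l * derive1n 2 u x = h x) ->
  (forall x, -1 < x < 1 -> u x <= u y) -> h y <= 0.
Proof.
move=> l0 ch y1 tu um; rewrite leNgt; apply/negP => pos.
have du x : -1 < x < 1 -> is_derive x 1 u (derive1 u x).
  move=> /tu[[/nbhs_singleton dx _] _]; apply: DeriveDef => //; by rewrite derive1E.
have d2u x : -1 < x < 1 -> is_derive x 1 (derive1 u) (l^-1 * h x).
  move=> /tu[[_ dx] <-]; apply: DeriveDef => //.
  by rewrite -derive1E mulKf// gt_eqF.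
have u'y : derive1 u y = 0.
  have : is_derive y 1 u 0.
    apply: (@derive1_at_max _ u (-1) 1 y) => //.
    by move=> x; rewrite in_itv/= => /du dx; exact: ex_derive.
  by move=> dy; rewrite derive1E derive_val.
have cy := @cont_clamp _ _ ch y; move: cy => /cvgrPdist_lt/(_ _ pos).
move=> /nbhs_ballP[d /= d0 dP]; case/andP: (y1) => y1' y2'.
rewrite clamp_id in dP; last by rewrite !ltW.
(* To the right of y, inside the neighbourhood where h is positive, and below 1. *)
pose z := Num.min (y + d / 2) ((y + 1) / 2).
have yz : y < z by rewrite /z lt_min; apply/andP; split; lra.
have z1 : z < 1 by rewrite /z gt_min; apply/orP; right; lra.
have zd : z <= y + d / 2 by rewrite /z ge_min lexx.
have hpos x : y < x -> x < z -> 0 < h x.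
  move=> yx xz.
  have bx : ball y d x by rewrite /ball/= ltr0_norm; lra.
  have := dP _ bx; rewrite clamp_id; last by apply/andP; split; lra.
  by rewrite ltr_distl => /andP[]; lra.
have ioo a b x : -1 < a -> b < 1 -> x \in `[a, b] -> -1 < x < 1.
  by rewrite in_itv/= => ? ? /andP[? ?]; apply/andP; split; lra.
have icc a b x : x \in `]a, b[ -> x \in `[a, b].
  by rewrite !in_itv/= => /andP[/ltW -> /ltW ->].
have [x xyz E] := @MVT _ u (derive1 u) y z yz
  (fun x xi => du x (ioo _ _ _ y1' z1 (icc _ _ _ xi)))
  (derivable_within_continuous (fun x xi => @ex_derive _ _ _ _ _ _ _ (du x (ioo _ _ _ y1' z1 xi)))).
move: (xyz); rewrite in_itv/= => /andP[yx xz].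
have x2 : x < 1 by exact: lt_trans z1.
have [s syx E2] := @MVT _ (derive1 u) (fun x => l^-1 * h x) y x yx
  (fun x xi => d2u x (ioo _ _ _ y1' x2 (icc _ _ _ xi)))
  (derivable_within_continuous (fun x xi => @ex_derive _ _ _ _ _ _ _ (d2u x (ioo _ _ _ y1' x2 xi)))).
move: syx; rewrite in_itv/= => /andP[ys sx].
have p1 : 0 < derive1 u x.
  have -> : derive1 u x = l^-1 * h s * (x - y) by rewrite -E2 u'y subr0.
  by rewrite mulr_gt0 ?subr_gt0// mulr_gt0 ?invr_gt0// hpos// (lt_trans sx).
have : 0 < derive1 u x * (z - y) by rewrite mulr_gt0// subr_gt0.
by rewrite -E subr_gt0 ltNge um// z1 (lt_trans y1' yz).
Qed.

End Regularity.

(** * The number rho* as the largest root of its cubic *)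

Section RhoStarBound.
Variable R : realType.
Implicit Types (c r : R).

(* If the principal root [w] had a nonpositive real part, its argument would lie
   in ]2pi/3, 5pi/6[, and rotating it by -2pi/3 would give a cube root in the upper
   half-plane with a larger real part. *)
Lemma cube_root_Re_gt0 (a b : R) : 0 < a -> 0 < b ->
  0 < complex.Re (3.-root (a +i* b)%C).
Proof.
move=> a0 b0.
set z := (a +i* b)%C.
have w3 : (3.-root z) ^+ 3 = z by rewrite rootCK.
have wI : 0 <= 'Im (3.-root z) by rewrite Im_rootC_ge0.
have wmax y : y ^+ 3 = z -> 0 <= 'Im y -> 'Re y <= 'Re (3.-root z).
  by move=> y3 yI; apply: rootC_Re_max.
move: w3 wI wmax; case: (3.-root z) => x y.
rewrite -complexIm ler0c /= => /eqP; rewrite eq_complex /= => /andP[/eqP E1 /eqP E2] y0 wmax.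
rewrite ltNge; apply/negP => x0.
pose k : R := Num.sqrt 3.
have k3 : k ^+ 2 = 3 by rewrite sqr_sqrtr// ler0n.
have k0 : 0 < k by rewrite sqrtr_gt0 ltr0n.
have {}E1 : x * (x ^+ 2 - 3 * y ^+ 2) = a by rewrite -E1; ring.
have {}E2 : y * (3 * x ^+ 2 - y ^+ 2) = b by rewrite -E2; ring.
have xlt0 : x < 0.
  by rewrite lt_neqAle x0 andbT; apply/eqP => xE; move: E1; rewrite xE; lra.
have ygt0 : 0 < y.
  by rewrite lt_neqAle y0 andbT; apply/eqP => yE; move: E2; rewrite -yE; lra.
have y2 : y ^+ 2 < (k * - x) ^+ 2.
  have : 0 < y * (3 * x ^+ 2 - y ^+ 2) by rewrite E2.
  by rewrite pmulr_rgt0// subr_gt0 exprMn sqrrN k3.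
have ykx : y < k * - x.
  by move: y2; rewrite ltr_sqr ?nnegrE// mulr_ge0// ?oppr_ge0// ltW.
(* This is exp(-2 pi i / 3). For w = x + i y the imaginary part of w zeta is nonnegative by [ykx],
   and its real part (k y - x) / 2 is positive, hence larger than x. *)
pose zeta : R[i] := (- 1 / 2 +i* (- (k / 2)))%C.
have zeta3 : zeta ^+ 3 = 1.
  have kk : k * k = 3 by rewrite -expr2.
  apply/eqP; rewrite !exprS expr0 mulr1 eq_complex /=; apply/andP; split; apply/eqP.
    have -> : -1 / 2 * (-1 / 2 * (-1 / 2) - - (k / 2) * - (k / 2)) -
      - (k / 2) * (-1 / 2 * - (k / 2) + - (k / 2) * (-1 / 2)) = (3 * (k * k) - 1) / 8 by field.
    rewrite kk; lra.
  have -> : -1 / 2 * (-1 / 2 * - (k / 2) + - (k / 2) * (-1 / 2)) +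
    - (k / 2) * (-1 / 2 * (-1 / 2) - - (k / 2) * - (k / 2)) = k * (k * k - 3) / 8 by field.
  rewrite kk; lra.
have := wmax ((x +i* y)%C * zeta); rewrite exprMn zeta3 mulr1.
have -> : (x +i* y)%C ^+ 3 = z.
  apply/eqP; rewrite !exprS expr0 mulr1 eq_complex /=; apply/andP; split; apply/eqP.
    by rewrite -E1; ring.
  by rewrite -E2; ring.
have ky : 0 < k * y by rewrite mulr_gt0.
rewrite -complexIm ler0c -!complexRe lecR /= => /(_ erefl).
have -> : 0 <= x * - (k / 2) + y * (-1 / 2) by lra.
by move=> /(_ isT); lra.
Qed.

(** The square root is purely imaginary, so rho* is twice the real part of the principal cube root
    of a number in the open first quadrant. *)
Lemma rho_star_gt0 c : 0 < c -> 0 < rho_star c.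
Proof.
move=> c0.
pose D := c ^+ 2 / 64 - 1 / 27 * (1 + c ^+ 2 / 2) ^+ 3.
have D0 : 0 < - D.
  have -> : - D = 1 / 27 + c ^+ 2 * (23 / 576) + (c ^+ 2) ^+ 2 / 36
                   + (c ^+ 2) ^+ 3 / 216 by rewrite /D; field.
  have c2 : 0 < c ^+ 2 by exact: exprn_gt0.
  by rewrite !addr_gt0 ?mulr_gt0 ?exprn_gt0 ?invr_gt0 ?ltr0n.
pose s := Num.sqrt (- D).
have s0 : 0 < s by rewrite sqrtr_gt0.
have sE : s ^+ 2 = - D by rewrite sqr_sqrtr // ltW.
have sqD : sqrtC D%:C%C = (0 +i* s)%C :> R[i].
  have -> : D%:C%C = (0 +i* s)%C ^+ 2 :> R[i].
    apply/eqP; rewrite expr2 eq_complex /=; apply/andP; split; apply/eqP; lra.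
  apply/sqrCK_P; rewrite -complexIm ler0c /= (ltW s0) /=.
  by rewrite ltcE /= ltxx andbF.
have c8 : 0 < c / 8 by rewrite divr_gt0.
have R0 := cube_root_Re_gt0 c8 s0.
have E : rho_starC c = 3.-root (c / 8 +i* s)%C + Num.conj (3.-root (c / 8 +i* s)%C).
  rewrite /rho_starC -/D sqD.
  have -> : (c / 8)%:C%C + (0 +i* s)%C = (c / 8 +i* s)%C :> R[i].
    by apply/eqP; rewrite eq_complex /= addr0 add0r !eqxx.
  have -> : (c / 8)%:C%C - (0 +i* s)%C = Num.conj (c / 8 +i* s)%C :> R[i].
    by apply/eqP; rewrite eq_complex /= subr0 add0r !eqxx.
  rewrite /cbrtC Im_conj -complexIm ler0c /= (ltW s0) conjCK.
  by rewrite oppr_ge0 lecR leNgt s0.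
rewrite /rho_star E; move: R0; case: (3.-root _) => x y /= x0.
by rewrite addr_gt0.
Qed.

(** With k = 1 + c^2 / 2 and p = rho*, the root equation p (p^2 - k) = c / 4 > 0 forces p^2 > k.
    Beyond p both factors of r (r^2 - k) are positive and increasing, so the cubic is positive
    there. *)
Lemma le_rho_star c r : 0 < c ->
  r ^+ 3 - r * (1 + c ^+ 2 / 2) - c / 4 <= 0 -> r <= rho_star c.
Proof.
move=> c0 r3; rewrite leNgt; apply/negP => lt.
have p0 := rho_star_gt0 c0; have root := rho_star_root c0.
set p := rho_star c in lt p0 root.
have c2 : 0 < c ^+ 2 by rewrite exprn_gt0.
set k := 1 + c ^+ 2 / 2 in r3 root.
have pk : 0 < p ^+ 2 - k.
  have : p * (p ^+ 2 - k) = c / 4 by rewrite mulrBr -exprS; lra.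
  move=> E; have : 0 < p * (p ^+ 2 - k) by rewrite E; lra.
  by rewrite pmulr_rgt0.
have : p ^+ 2 < r ^+ 2 by rewrite ltr_sqr ?nnegrE; lra.
move=> pr.
have : p * (p ^+ 2 - k) < r * (r ^+ 2 - k).
  apply: ltr_pM; lra.
rewrite !mulrBr -!exprS; lra.
Qed.

(** Makes the bound on Q hold at the ends of the interval, where |Q| = 1. *)
Lemma rho_star_ge1 c : 0 < c -> 1 <= rho_star c.
Proof.
by move=> c0; apply: le_rho_star => //; have := sqr_ge0 c; lra.
Qed.

End RhoStarBound.

(** * The maximum principle and the pointwise bounds *)

Section MaximumPrinciple.
Variable R : realType.
Local Notation mu := (@lebesgue_measure R).
Local Notation I := (`[(-1 : R), 1]%classic).
Implicit Types (u g h f q qg Q M : R -> R) (x y l c : R).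

Definition weak_solution l u g h := forall q qg, ac q qg -> q (-1) = 0 -> q 1 = 0 ->
  \int[mu]_(x in I) (l * (g x * qg x) + h x * q x) = 0.

Lemma weak_max_le0 l u g h y : 0 < l -> ac u g -> cI h -> weak_solution l u g h ->
  -1 < y < 1 -> (forall x, -1 <= x <= 1 -> u x <= u y) -> h y <= 0.
Proof.
move=> l0 ug ch weak y1 um.
apply: (@C2_max_le0 _ l u h) => //.
  by move=> x; exact: weak_solution_C2 ug ch weak x.
by move=> x /andP[/ltW x1 /ltW x2]; apply: um; rewrite x1.
Qed.

Lemma weak_min_ge0 l u g h y : 0 < l -> ac u g -> cI h -> weak_solution l u g h ->
  -1 < y < 1 -> (forall x, -1 <= x <= 1 -> u y <= u x) -> 0 <= h y.
Proof.
move=> l0 ug ch weak y1 um.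
suff : -1 * h y <= 0 by rewrite mulN1r oppr_le0.
apply: (@weak_max_le0 l (fun x => -1 * u x) (fun x => -1 * g x) (fun x => -1 * h x)) => //.
- exact: acZ.
- by apply: (@cIM _ (fun=> -1)) => //; exact: cI_cst.
- move=> q qg aq q0 q1; have E := weak _ _ aq q0 q1.
  have i : int1 (-1) 1 (fun x => l * (g x * qg x) + h x * q x).
    apply: int1D; first by apply: int1Z; apply: sq2_mul; [exact: ug.1|exact: aq.1].
    by apply: sq2_mul; [exact: sq2_cont|exact: ac_sq2 aq].
  rewrite (@Rint_eq _ _ _ _ (fun x => -1 * (l * (g x * qg x) + h x * q x))).
    by rewrite RintZ// E mulr0.
  by move=> x _; ring.
- by move=> x x1; rewrite !mulN1r lerN2; exact: um.
Qed.

(** Let q be the maximum of |Q|. At an interior maximum of M^2 the equation for M gives M^2 <= 1 + 2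
    c q. Inserted into the equation for Q at a positive maximum, 4 q (q^2 - 1) <= c M^2, this is the
    cubic inequality that bounds q by rho*. *)
Lemma or_bounds l c Q M g k : 0 < l -> 0 < c -> ac Q g -> ac M k ->
  Q (-1) = 1 -> M (-1) = 1 -> Q 1 = -1 -> M 1 = -1 ->
  weak_solution l Q g (fun x => 4 * Q x * (Q x ^+ 2 - 1) - c * M x ^+ 2) ->
  weak_solution l M k (fun x => M x * (M x ^+ 2 - 1) - 2 * c * Q x * M x) ->
  forall y, -1 <= y <= 1 ->
    `|Q y| <= rho_star c /\ M y ^+ 2 <= 1 + 2 * c * rho_star c.
Proof.
move=> l0 c0 aQ aM Q0 M0 Q1 M1 wQ wM.
have cQ := ac_cI aQ; have cM := ac_cI aM.
have chQ : cI (fun x => 4 * Q x * (Q x ^+ 2 - 1) - c * M x ^+ 2) by tac_cI.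
have chM : cI (fun x => M x * (M x ^+ 2 - 1) - 2 * c * Q x * M x) by tac_cI.
have N11 : (-1 : R) <= 1 by rewrite ge0_cp.
have [yQ yQI maxQ] : exists2 y, -1 <= y <= 1 & forall x, -1 <= x <= 1 -> Q x ^+ 2 <= Q y ^+ 2.
  have [y] := @EVT_max _ (fun x => Q x ^+ 2) _ _ N11 (cIX2 cQ).
  by rewrite in_itv/= => yI ym; exists y => // x xI; apply: ym; rewrite in_itv.
have [yM yMI maxM] : exists2 y, -1 <= y <= 1 & forall x, -1 <= x <= 1 -> M x ^+ 2 <= M y ^+ 2.
  have [y] := @EVT_max _ (fun x => M x ^+ 2) _ _ N11 (cIX2 cM).
  by rewrite in_itv/= => yI ym; exists y => // x xI; apply: ym; rewrite in_itv.
pose q := `|Q yQ|; have q0 : 0 <= q by exact: normr_ge0.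
have Qq x : -1 <= x <= 1 -> `|Q x| <= q.
  by move=> /maxQ; rewrite -(real_normK (num_real (Q x))) -(real_normK (num_real (Q yQ))) ler_sqr ?nnegrE.
have split_itv y : -1 <= y <= 1 -> [\/ y = -1, y = 1 | -1 < y < 1].
  move=> /andP[]; rewrite !le_eqVlt => /predU1P[<-|y1]; first by constructor 1.
  by move=> /predU1P[->|y2]; [constructor 2|constructor 3; rewrite y1].
have sqr_mono (a b : R) : a ^+ 2 <= b ^+ 2 -> - `|b| <= a <= `|b|.
  rewrite -(real_normK (num_real a)) -(real_normK (num_real b)) ler_sqr ?nnegrE//.
  by rewrite ler_norml.
have boundM : M yM ^+ 2 <= 1 + 2 * c * q.
  have cq : 0 <= c * q by rewrite mulr_ge0// ltW.
  case: (split_itv _ yMI) => [->|->|yM1].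
  - by rewrite M0; lra.
  - by rewrite M1; lra.
  have := Qq _ yMI; rewrite ler_norml => /andP[_ Qy].
  have cQq : c * Q yM <= c * q by rewrite ler_pM2l.
  have [mpos|mneg|m0] := ltgtP 0 (M yM).
  - have : M yM * (M yM ^+ 2 - 1) - 2 * c * Q yM * M yM <= 0.
      apply: (weak_max_le0 l0 aM chM wM yM1) => x /maxM/sqr_mono/andP[_].
      by rewrite gtr0_norm.
    have -> : M yM * (M yM ^+ 2 - 1) - 2 * c * Q yM * M yM =
      M yM * (M yM ^+ 2 - 1 - 2 * c * Q yM) by ring.
    rewrite pmulr_rle0//; lra.
  - have : 0 <= M yM * (M yM ^+ 2 - 1) - 2 * c * Q yM * M yM.
      apply: (weak_min_ge0 l0 aM chM wM yM1) => x /maxM/sqr_mono/andP[+ _].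
      by rewrite ltr0_norm// opprK.
    have -> : M yM * (M yM ^+ 2 - 1) - 2 * c * Q yM * M yM =
      M yM * (M yM ^+ 2 - 1 - 2 * c * Q yM) by ring.
    rewrite nmulr_rge0//; lra.
  - by rewrite -m0 expr2 mul0r; lra.
have rho1 := rho_star_ge1 c0.
have boundq : q <= rho_star c.
  case: (split_itv _ yQI) => [E|E|yQ1].
  - by rewrite /q E Q0 normr1.
  - by rewrite /q E Q1 normrN1.
  have My : M yQ ^+ 2 <= 1 + 2 * c * q by apply: le_trans boundM; exact: maxM.
  have cMy : c * M yQ ^+ 2 <= c * (1 + 2 * c * q) by rewrite ler_pM2l.
  have cM0 : 0 <= c * M yQ ^+ 2 by rewrite mulr_ge0 ?sqr_ge0// ltW.
  have [qpos|qneg|qz] := ltgtP 0 (Q yQ).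
  - have : 4 * Q yQ * (Q yQ ^+ 2 - 1) - c * M yQ ^+ 2 <= 0.
      apply: (weak_max_le0 l0 aQ chQ wQ yQ1) => x /maxQ/sqr_mono/andP[_].
      by rewrite gtr0_norm.
    have qE : Q yQ = q by rewrite /q gtr0_norm.
    rewrite qE => H; apply: le_rho_star => //.
    have -> : q ^+ 3 = q * q ^+ 2 by rewrite exprS.
    lra.
  (* At a negative minimum the coupling term has the favourable sign, and q <= 1 follows. *)
  - have : 0 <= 4 * Q yQ * (Q yQ ^+ 2 - 1) - c * M yQ ^+ 2.
      apply: (weak_min_ge0 l0 aQ chQ wQ yQ1) => x /maxQ/sqr_mono/andP[+ _].
      by rewrite ltr0_norm// opprK.
    have qE : Q yQ = - q by rewrite /q ltr0_norm// opprK.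
    have q1 : 0 < q by lra.
    rewrite qE sqrrN => H; apply: le_trans rho1.
    have : q * (q ^+ 2 - 1) <= 0 by lra.
    rewrite pmulr_rle0// subr_le0 -[leRHS](expr1n _ 2) ler_sqr ?nnegrE//.
  - by rewrite /q -qz normr0; lra.
move=> y yI; split; first exact: le_trans (Qq _ yI) boundq.
apply: le_trans (maxM _ yI) (le_trans boundM _).
by rewrite lerD2l ler_pM2l// mulr_gt0.
Qed.

End MaximumPrinciple.

(** * Semiconvexity of the bulk potential at points (x, 0, m, 0) *)

Section Remainders.
Variables (R : realType) (c B : R).
Hypotheses (c0 : 0 < c) (B0 : 0 <= B).
Variables (x m : R).
Hypotheses (xB : x ^+ 2 <= B) (mB : m ^+ 2 <= B).
Variables (d d' e e' : R).
Let S := d ^+ 2 + d' ^+ 2 + (e ^+ 2 + e' ^+ 2).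

(** The 2 covers the -1 in the two wells. In the coupling, 2 d m e <= d^2 + B e^2 and |x| <= 1 + B,
    which x^2 <= B implies. *)
Lemma V2_ge : - (2 + c * (2 + 2 * B)) * S <= V2 c x 0 m 0 d d' e e'.
Proof.
have := B0; have := xB => xB' B0'.
have x20 := sqr_ge0 x; have m20 := sqr_ge0 m.
have D0 : 0 <= d ^+ 2 + d' ^+ 2 by rewrite addr_ge0 ?sqr_ge0.
have E0 : 0 <= e ^+ 2 + e' ^+ 2 by rewrite addr_ge0 ?sqr_ge0.
have h1 : 2 * d * m * e <= d ^+ 2 + B * e ^+ 2.
  have := sqr_ge0 (d - m * e); have := ler_wpM2r (sqr_ge0 e) mB; lra.
have h2 : 2 * d' * m * e' <= d' ^+ 2 + B * e' ^+ 2.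
  have := sqr_ge0 (d' - m * e'); have := ler_wpM2r (sqr_ge0 e') mB; lra.
have h3 : x * (e ^+ 2 - e' ^+ 2) <= (1 + B) * (e ^+ 2 + e' ^+ 2).
  have q1 : 0 <= (1 + B - x) * e ^+ 2.
    apply: mulr_ge0 (sqr_ge0 e); have := sqr_ge0 (x - 1); lra.
  have q2 : 0 <= (1 + B + x) * e' ^+ 2.
    apply: mulr_ge0 (sqr_ge0 e'); have := sqr_ge0 (x + 1); lra.
  lra.
set T := 2 * d * (m * e - 0 * e') + 2 * d' * (m * e' + 0 * e)
         + x * (e ^+ 2 - e' ^+ 2) + 2 * 0 * e * e'.
have hT : T <= (2 + 2 * B) * S.
  have : 0 <= B * (d ^+ 2 + d' ^+ 2) by rewrite mulr_ge0.
  rewrite /T /S; lra.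
have hcT : c * T <= c * ((2 + 2 * B) * S) by rewrite ler_pM2l.
have q3 : 0 <= 2 * x ^+ 2 * (d ^+ 2 + d' ^+ 2) by rewrite -mulrA; apply: mulr_ge0 => //; exact: mulr_ge0.
have q4 : 0 <= 1 / 2 * m ^+ 2 * (e ^+ 2 + e' ^+ 2).
  by rewrite -mulrA; apply: mulr_ge0; [lra|exact: mulr_ge0].
rewrite /V2 -/T.
have -> : - (2 + c * (2 + 2 * B)) * S = - (2 * S) - c * ((2 + 2 * B) * S) by ring.
have := sqr_ge0 (x * d + 0 * d'); have := sqr_ge0 (m * e + 0 * e').
move: q3 q4 hcT; rewrite /S; lra.
Qed.

(** The quartic term absorbs the cubic one by Young's inequality, at the price of a multiple of S:
    1/2 of D^2 is spent on the Q part, and 1/16 + 2/32 = 1/8 of the available 1/4 of E^2 on the M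
    part and the coupling. The parameter [th] takes the values 1, 0 and 3/4. *)
Lemma V34_ge (th : R) : -1 <= th <= 1 ->
  - (12 * B + 8 * c ^+ 2) * S <= th * V3 c x 0 m 0 d d' e e' + V4 d d' e e'.
Proof.
move=> /andP[th1 th2].
have th2' : th ^+ 2 <= 1 by nra.
set D := d ^+ 2 + d' ^+ 2; set E := e ^+ 2 + e' ^+ 2.
have d0 := sqr_ge0 d; have d0' := sqr_ge0 d'; have e0 := sqr_ge0 e; have e0' := sqr_ge0 e'.
have D0 : 0 <= D by rewrite addr_ge0.
have E0 : 0 <= E by rewrite addr_ge0.
have sq_le (p q : R) : p ^+ 2 <= B -> (th * p) ^+ 2 * q ^+ 2 <= B * q ^+ 2.
  move=> pB; rewrite ler_wpM2r ?sqr_ge0// exprMn.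
  by apply: le_trans pB; have := ler_wpM2r (sqr_ge0 p) th2'; rewrite mul1r.
have h1 : - (1 / 2 * D ^+ 2 + 8 * B * D) <= th * (4 * (x * d) * D).
  have := sqr_ge0 (D + 4 * (th * x) * d); have := sq_le x d xB.
  have : 0 <= B * d' ^+ 2 by rewrite mulr_ge0.
  rewrite /D; lra.
have h2 : - (1 / 16 * E ^+ 2 + 4 * B * E) <= th * (m * e * E).
  have := sqr_ge0 (E + 8 * (th * m) * e); have := sq_le m e mB.
  have : 0 <= B * e' ^+ 2 by rewrite mulr_ge0.
  rewrite /E; lra.
have h3 (r p : R) : r ^+ 2 <= E ^+ 2 ->
    th * (c * (p * r)) <= 1 / 32 * E ^+ 2 + 8 * c ^+ 2 * p ^+ 2.
  move=> rE; have := sqr_ge0 (r - 16 * th * c * p).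
  have : th ^+ 2 * (c ^+ 2 * p ^+ 2) <= c ^+ 2 * p ^+ 2.
    by have := ler_wpM2r (mulr_ge0 (sqr_ge0 c) (sqr_ge0 p)) th2'; rewrite mul1r.
  lra.
have r1 : (e ^+ 2 - e' ^+ 2) ^+ 2 <= E ^+ 2.
  have : 0 <= e ^+ 2 * e' ^+ 2 by rewrite mulr_ge0.
  rewrite /E; lra.
have r2 : (2 * e * e') ^+ 2 <= E ^+ 2.
  have := sqr_ge0 (e ^+ 2 - e' ^+ 2); rewrite /E; lra.
have h4 := h3 _ d r1; have h5 := h3 _ d' r2.
have SE : S = D + E by [].
have V3E : th * V3 c x 0 m 0 d d' e e' = th * (4 * (x * d) * D) + th * (m * e * E)
   - th * (c * (d * (e ^+ 2 - e' ^+ 2))) - th * (c * (d' * (2 * e * e'))).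
  by rewrite /V3 -/D -/E; ring.
have V4E : V4 d d' e e' = D ^+ 2 + 1 / 4 * E ^+ 2 by [].
rewrite V3E V4E SE.
have q1 : 0 <= B * D by rewrite mulr_ge0.
have q2 : 0 <= B * E by rewrite mulr_ge0.
have q3 : 0 <= c ^+ 2 * E by rewrite mulr_ge0// sqr_ge0.
have q4 : 8 * c ^+ 2 * d ^+ 2 + 8 * c ^+ 2 * d' ^+ 2 = 8 * c ^+ 2 * D by rewrite /D; ring.
have := sqr_ge0 D; have := sqr_ge0 E.
have -> : - (12 * B + 8 * c ^+ 2) * (D + E) = - (12 * (B * D) + 12 * (B * E) + 8 * c ^+ 2 * D + 8 * (c ^+ 2 * E)) by ring.
lra.
Qed.

(** The factors 2 and 4 are those of [gradient_remainder_ge], where 2 V2 + 3 V3 + 4 V4 = 2 V2 + 4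
    (3/4 V3 + V4); the other two remainders need only factors 1. *)
Definition Kc := 2 * (2 + c * (2 + 2 * B)) + 4 * (12 * B + 8 * c ^+ 2).

Lemma Kc_ge0 : 0 <= Kc.
Proof.
have := B0; have := c0 => c0' B0'.
rewrite /Kc; have := sqr_ge0 c; have : 0 <= c * (2 + 2 * B) by apply: mulr_ge0; lra.
lra.
Qed.

Let S0 : 0 <= S. Proof. by rewrite !addr_ge0 ?sqr_ge0. Qed.

Lemma remainder_ge : - Kc * S <= V2 c x 0 m 0 d d' e e' + V3 c x 0 m 0 d d' e e' + V4 d d' e e'.
Proof.
have := B0; have := c0 => c0' B0'.
have := V2_ge; have /V34_ge : -1 <= (1 : R) <= 1 by lra.
rewrite mul1r /Kc.
have : 0 <= c * (2 + 2 * B) * S by apply: mulr_ge0 S0; apply: mulr_ge0; lra.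
have : 0 <= (12 * B + 8 * c ^+ 2) * S by apply: mulr_ge0 S0; have := sqr_ge0 c; lra.
have := S0; lra.
Qed.

(** Half the sum of the remainders in the directions v and -v, as needed at a midpoint. *)
Lemma remainder_even_ge : - Kc * S <= V2 c x 0 m 0 d d' e e' + V4 d d' e e'.
Proof.
have := B0; have := c0 => c0' B0'.
have := V2_ge; have /V34_ge : -1 <= (0 : R) <= 1 by lra.
rewrite mul0r add0r /Kc.
have : 0 <= c * (2 + 2 * B) * S by apply: mulr_ge0 S0; apply: mulr_ge0; lra.
have : 0 <= (12 * B + 8 * c ^+ 2) * S by apply: mulr_ge0 S0; have := sqr_ge0 c; lra.
have := S0; lra.
Qed.

(** The right-hand side is the derivative at t = 1 of t^2 V2 + t^3 V3 + t^4 V4. *)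
Lemma gradient_remainder_ge : - Kc * S <=
  2 * V2 c x 0 m 0 d d' e e' + 3 * V3 c x 0 m 0 d d' e e' + 4 * V4 d d' e e'.
Proof.
have := B0; have := c0 => c0' B0'.
have := V2_ge; have /V34_ge : -1 <= (3 / 4 : R) <= 1 by lra.
rewrite /Kc; lra.
Qed.

End Remainders.

(** * Poincare and Young inequalities *)

Section Poincare.
Variables (R : realType).
Local Notation mu := (@lebesgue_measure R).
Local Notation I := (`[(-1 : R), 1]%classic).
Implicit Types (u g : R -> R) (x y : R).


Lemma sqnorm_ge0 g : 0 <= sqnorm g.
Proof. by rewrite sqnormE; apply: Rint_ge0 => x _; exact: sqr_ge0. Qed.

Lemma ac_sqr_le_node u g x y h : ac u g -> -1 <= x <= 1 -> -1 <= y <= 1 ->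
  `|x - y| <= h -> u x ^+ 2 <= 2 * u y ^+ 2 + 2 * h * sqnorm g.
Proof.
move=> ug x1 y1 xy.
have := ac_sqr_leI ug y1 x1; rewrite -sqnormE => H.
have := ler_wpM2r (sqnorm_ge0 g) xy.
have := sqr_ge0 (u x - 2 * u y); lra.
Qed.

Lemma ac_bounded u g x : ac u g -> -1 <= x <= 1 ->
  u x ^+ 2 <= 2 * u (-1) ^+ 2 + 4 * sqnorm g.
Proof.
move=> ug x1.
have := @ac_sqr_le_node u g x (-1) 2 ug x1; rewrite lexx ge0_cp//=.
have -> : `|x - -1| <= 2 by rewrite opprK ger0_norm; lra.
by move=> /(_ isT isT); lra.
Qed.

Lemma int_sqr_le u g (K : R) : ac u g -> (forall x, -1 <= x <= 1 -> u x ^+ 2 <= K) ->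
  sqnorm u <= 2 * K.
Proof.
move=> ug uK; rewrite sqnormE; apply: (@le_trans _ _ (\int[mu]_(x in I) K)).
  by apply: Rint_le => //; exact: (ac_sq2 ug).2.
by rewrite Rint_cst; lra.
Qed.

(** The constant is the pointwise 4 of [ac_bounded] times the length 2 of the interval. *)
Lemma poincare u g : ac u g -> u (-1) = 0 ->
  sqnorm u <= 8 * sqnorm g.
Proof.
move=> ug u0; apply: (le_trans (@int_sqr_le u g (4 * sqnorm g) ug _)); last by lra.
by move=> x /(ac_bounded ug); rewrite u0 expr0n/= mulr0 add0r.
Qed.

Lemma sqnorm_eq0 u g : ac u g -> u (-1) = 0 -> sqnorm g <= 0 ->
  forall x, -1 <= x <= 1 -> u x = 0.
Proof.
move=> ug u0 D0 x x1; have := ac_bounded ug x1.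
rewrite u0 expr0n/= mulr0 add0r => H.
by apply/eqP; rewrite -sqrf_eq0 eq_le sqr_ge0 andbT; apply: le_trans H _; lra.
Qed.

(** Young's inequality with a free weight, later 2^-j, to balance a fixed f against a g that tends
    to 0. *)
Lemma int_mul_ge (f g : R -> R) (th : R) : sq2 (-1) 1 f -> sq2 (-1) 1 g -> 0 < th ->
  - (1 / 2 * (th * sqnorm f + th^-1 * sqnorm g)) <= \int[mu]_(x in I) (f x * g x).
Proof.
move=> sf sg th0.
have ifg := sq2_mul sf sg.
have i1 := int1Z th sf.2; have i2 := int1Z th^-1 sg.2.
have : 0 <= \int[mu]_(x in I) ((th * f x ^+ 2 + th^-1 * g x ^+ 2) + 2 * (f x * g x)).
  apply: Rint_ge0 => x _.
  have -> : th * f x ^+ 2 + th^-1 * g x ^+ 2 + 2 * (f x * g x) = th * (f x + th^-1 * g x) ^+ 2.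
    have tt : th * th^-1 = 1 by rewrite mulfV// gt_eqF.
    have -> : th * (f x + th^-1 * g x) ^+ 2 = th * f x ^+ 2 + 2 * (th * th^-1) * (f x * g x) + (th * th^-1) * th^-1 * g x ^+ 2 by ring.
    by rewrite tt; ring.
  by rewrite mulr_ge0 ?sqr_ge0// ltW.
rewrite (RintD (int1D i1 i2) (int1Z 2 ifg)) (RintD i1 i2).
rewrite (RintZ _ sf.2) (RintZ _ sg.2) (RintZ _ ifg) -!sqnormE; lra.
Qed.

End Poincare.

(** * Compactness for vectors of nodal values *)

Section Subsequence.
Variable R : realType.

(** A cluster point of the vectors in a compact box. The choice [f] need not be increasing; j <= f j
    is enough to keep the energies almost minimal. *)
Lemma bounded_subseq (k : nat) (a : nat -> nat -> R) (B : R) :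
  (forall n i, `|a n i| <= B) ->
  exists (p : nat -> R) (f : nat -> nat), forall j, (j <= f j)%N /\
    forall i, (i < k)%N -> `|a (f j) i - p i| <= (1/4) ^+ j.
Proof.
move=> aB.
pose A n : 'rV[R]_k := \row_(i < k) a n i.
have cV : compact [set v : 'rV[R]_k | forall i, `[- B, B]%classic (v ord0 i)].
  by apply: (@rV_compact R k (fun=> `[- B, B]%classic)) => i; exact: segment_compact.
have [|q [_ cq]] := cV (A @ \oo) _.
  exists 0%N => // n _ i; rewrite /= mxE in_itv/= -ler_norml; exact: aB.
have H j : exists m, (j <= m)%N /\ forall i : 'I_k, `|a m i - q ord0 i| <= (1/4) ^+ j.
  have e0 : (0 : R) < (1/4) ^+ j by rewrite exprn_gt0.
  have [|v [[m /= jm <-] qv]] := cq [set A m | m in [set m | (j <= m)%N]] (ball q ((1/4) ^+ j)) _ (nbhsx_ballx _ _ e0).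
    by exists j => // m /= jm; exists m.
  exists m; split => // i.
  have := qv; case => _ /(_ ord0 i); rewrite mxE /ball/= distrC => /ltW; exact.
have [f fP] := choice H.
(* The default 0 concerns only i >= k, about which nothing is claimed. *)
exists (fun i => if insub i is Some o then q ord0 o else 0), f => j.
have [jf fq] := fP j; split => // i ik.
by rewrite insubT; exact: fq (Ordinal ik).
Qed.

Lemma node_near (N : nat) (x : R) : (0 < N)%N -> -1 <= x <= 1 ->
  exists i, [/\ (i < N.+1)%N, -1 <= (-1 + i%:R * (2 / N%:R) : R) <= 1 &
    `|x - (-1 + i%:R * (2 / N%:R))| <= 2 / N%:R].
Proof.
move=> N0 /andP[x1 x2].
have n0 : (0 : R) < N%:R by rewrite ltr0n.
have h0 : 0 < 2 / N%:R :> R by rewrite divr_gt0.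
have hN : N%:R * (2 / N%:R) = 2 :> R by rewrite mulrC divfK// gt_eqF.
(* The position of x in mesh widths; its integer part is the node just left of x, and is N when x =
   1. *)
pose t := (x + 1) / (2 / N%:R).
have tE : t * (2 / N%:R) = x + 1 by rewrite /t divfK// gt_eqF.
have t0 : 0 <= t by apply: divr_ge0; [lra|exact: ltW].
have /andP[i1 i2] := truncn_itv t0.
set i := Num.trunc t in i1 i2 *.
have i1' : i%:R * (2 / N%:R) <= x + 1 by rewrite -tE ler_pM2r.
have i2' : x + 1 < (i%:R + 1) * (2 / N%:R) by rewrite -tE ltr_pM2r// natr1.
have ih0 : 0 <= i%:R * (2 / N%:R) :> R by rewrite mulr_ge0// ltW.
exists i; split.
- rewrite ltnS -(ler_nat R) -(ler_pM2r h0) hN; lra.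
- by apply/andP; split; lra.
- rewrite ger0_norm; lra.
Qed.

End Subsequence.

(** The order reconstruction energy as a restriction of the full one, so that one expansion serves
    both; locked like [sqnorm]. *)
HB.lock Definition Fe (R : realType) (l c : R) (Q M : R -> R) : R :=
  full_energy l c Q (cst 0) M (cst 0).

(** * Integrated remainder, coercivity and the midpoint inequality *)

Section IntegralRemainder.
Variables (R : realType) (l c : R).
Local Notation mu := (@lebesgue_measure R).
Local Notation I := (`[(-1 : R), 1]%classic).
Implicit Types (Q M u v w g h k : R -> R).

Lemma int_remainder_ge u1 u2 u3 u4 g1 g2 g3 g4 v1 v2 v3 v4 h1 h2 h3 h4 (al be ga K : R) :
  ac u1 g1 -> ac u2 g2 -> ac u3 g3 -> ac u4 g4 ->
  ac v1 h1 -> ac v2 h2 -> ac v3 h3 -> ac v4 h4 ->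
  (forall x, -1 <= x <= 1 ->
    - K * (v1 x ^+ 2 + v2 x ^+ 2 + (v3 x ^+ 2 + v4 x ^+ 2)) <=
      al * V2 c (u1 x) (u2 x) (u3 x) (u4 x) (v1 x) (v2 x) (v3 x) (v4 x)
      + be * V3 c (u1 x) (u2 x) (u3 x) (u4 x) (v1 x) (v2 x) (v3 x) (v4 x)
      + ga * V4 (v1 x) (v2 x) (v3 x) (v4 x)) ->
  al * (l / 2 * (sqnorm h1 + sqnorm h2 + (sqnorm h3 + sqnorm h4)))
    - K * (sqnorm v1 + sqnorm v2 + (sqnorm v3 + sqnorm v4)) <=
  al * (\int[mu]_(x in I) dens2 l c u1 u2 u3 u4 v1 v2 v3 v4 h1 h2 h3 h4 x)
  + be * (\int[mu]_(x in I) dens3 c u1 u2 u3 u4 v1 v2 v3 v4 x)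
  + ga * (\int[mu]_(x in I) dens4 v1 v2 v3 v4 x).
Proof.
move=> a1 a2 a3 a4 b1 b2 b3 b4 H.
have i2 := int1_dens2 l c a1 a2 a3 a4 b1 b2 b3 b4.
have i3 := int1_dens3 c a1 a2 a3 a4 b1 b2 b3 b4.
have i4 := int1_dens4 a1 a2 a3 a4 b1 b2 b3 b4.
rewrite -(RintZ al i2) -(RintZ be i3) -(RintZ ga i4).
rewrite -(RintD (int1Z al i2) (int1Z be i3)).
rewrite -(RintD (int1D (int1Z al i2) (int1Z be i3)) (int1Z ga i4)).
have [d1 d2 d3 d4] : [/\ int1 (-1) 1 (fun x => h1 x ^+ 2), int1 (-1) 1 (fun x => h2 x ^+ 2),
    int1 (-1) 1 (fun x => h3 x ^+ 2) & int1 (-1) 1 (fun x => h4 x ^+ 2)].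
  by split; [exact: b1.1.2|exact: b2.1.2|exact: b3.1.2|exact: b4.1.2].
have [s1 s2 s3 s4] : [/\ int1 (-1) 1 (fun x => v1 x ^+ 2), int1 (-1) 1 (fun x => v2 x ^+ 2),
    int1 (-1) 1 (fun x => v3 x ^+ 2) & int1 (-1) 1 (fun x => v4 x ^+ 2)].
  by split; [exact: (ac_sq2 b1).2|exact: (ac_sq2 b2).2|exact: (ac_sq2 b3).2|exact: (ac_sq2 b4).2].
have dd := int1D (int1D d1 d2) (int1D d3 d4).
have ss := int1D (int1D s1 s2) (int1D s3 s4).
rewrite !sqnormE -(RintD d1 d2) -(RintD d3 d4) -(RintD (int1D d1 d2) (int1D d3 d4)).
rewrite -(RintD s1 s2) -(RintD s3 s4) -(RintD (int1D s1 s2) (int1D s3 s4)).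
rewrite -(RintZ (l / 2) dd) -(RintZ al (int1Z (l / 2) dd)) -(RintZ K ss).
rewrite -(RintB (int1Z al (int1Z (l / 2) dd)) (int1Z K ss)).
apply: Rint_le.
- exact: (int1B (int1Z al (int1Z (l / 2) dd)) (int1Z K ss)).
- exact: (int1D (int1D (int1Z al i2) (int1Z be i3)) (int1Z ga i4)).
by move=> x /H; rewrite /dens2 /dens3 /dens4; lra.
Qed.

Definition z0 : R -> R := cst 0.
Lemma ac_z0 : ac z0 z0. Proof. exact: ac_cst. Qed.

Local Notation Fe := (Fe l c).

Lemma FeE Q M : Fe Q M = full_energy l c Q z0 M z0.
Proof. by rewrite unlock. Qed.

Lemma sqnorm_z0 : sqnorm z0 = 0.
Proof.
rewrite !sqnormE (@Rint_eq _ _ _ _ (fun=> 0)); first by rewrite Rint_cst ?mul0r ?ge0_cp.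
by move=> x _; rewrite /z0 expr0n.
Qed.

Lemma Fe_taylor Q g M k v h w s (t : R) : ac Q g -> ac M k -> ac v h -> ac w s ->
  Fe (fun x => Q x + t * v x) (fun x => M x + t * w x) =
  Fe Q M + t * (\int[mu]_(x in I) dens1 l c Q z0 M z0 g z0 k z0 v z0 w z0 h z0 s z0 x)
  + t ^+ 2 * (\int[mu]_(x in I) dens2 l c Q z0 M z0 v z0 w z0 h z0 s z0 x)
  + t ^+ 3 * (\int[mu]_(x in I) dens3 c Q z0 M z0 v z0 w z0 x)
  + t ^+ 4 * (\int[mu]_(x in I) dens4 v z0 w z0 x).
Proof.
move=> aQ aM av aw.
rewrite !FeE -(full_energy_taylor l c aQ ac_z0 aM ac_z0 av ac_z0 aw ac_z0).
set Z := fun x => z0 x + t * z0 x.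
by have -> : Z = z0 by apply/funext => x; rewrite /Z /z0 /= mulr0 addr0.
Qed.

(** The coupling is absorbed by c Q M^2 <= M^4 / 8 + 2 c^2 Q^2; what remains is completed to squares
    in Q^2 and M^2. The outer 2 is the length of the interval. *)
Lemma Fe_coercive Q g M k : ac Q g -> ac M k ->
  l / 2 * (sqnorm g + sqnorm k) <= Fe Q M + 2 * ((1 + c ^+ 2) ^+ 2 + 1).
Proof.
move=> aQ aM.
rewrite FeE (full_energyE l c aQ ac_z0 aM ac_z0).
set C := (_ ^+ 2 + 1).
have i0 := int1_dens l c aQ ac_z0 aM ac_z0.
have -> : 2 * C = \int[mu]_(x in I) C by rewrite Rint_cst ?ge0_cp//; ring.
rewrite -(RintD i0 (int1_cst _ _ C)).
rewrite !sqnormE -(RintD aQ.1.2 aM.1.2) -(RintZ (l / 2) (int1D aQ.1.2 aM.1.2)).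
apply: Rint_le.
- exact: int1Z _ (int1D aQ.1.2 aM.1.2).
- exact: int1D i0 (int1_cst _ _ C).
move=> x _; rewrite /dens /V /z0 /= /C.
have := sqr_ge0 (Q x ^+ 2 - (1 + c ^+ 2)); have := sqr_ge0 (M x ^+ 2 - 2).
have := sqr_ge0 (M x ^+ 2 - 4 * c * Q x); lra.
Qed.

Definition half_sum u v : R -> R := fun x => 1/2 * (u x + v x).
Definition half_diff u v : R -> R := fun x => 1/2 * (u x - v x).

(** Both pairs are the midpoint plus or minus the half difference, so in the sum of the two
    expansions the linear and cubic terms cancel and only the even remainder is left. *)
Lemma Fe_midpoint (B : R) Q1 g1 M1 k1 Q2 g2 M2 k2 : 0 < c -> 0 <= B ->
  ac Q1 g1 -> ac M1 k1 -> ac Q2 g2 -> ac M2 k2 ->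
  (forall x, -1 <= x <= 1 -> [/\ Q1 x ^+ 2 <= B, M1 x ^+ 2 <= B, Q2 x ^+ 2 <= B & M2 x ^+ 2 <= B]) ->
  2 * Fe (half_sum Q1 Q2) (half_sum M1 M2)
    + l * (sqnorm (half_diff g1 g2) + sqnorm (half_diff k1 k2))
    - 2 * Kc c B * (sqnorm (half_diff Q1 Q2) + sqnorm (half_diff M1 M2))
  <= Fe Q1 M1 + Fe Q2 M2.
Proof.
move=> c0 B0 aQ1 aM1 aQ2 aM2 bd.
set v := half_diff Q1 Q2; set w := half_diff M1 M2.
set h := half_diff g1 g2; set s := half_diff k1 k2.
have av : ac v h by apply: acZ; exact: acB.
have aw : ac w s by apply: acZ; exact: acB.
set Qm := half_sum Q1 Q2; set Mm := half_sum M1 M2.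
have aQ : ac Qm (fun x => 1/2 * (g1 x + g2 x)) by apply: acZ; exact: acD.
have aM : ac Mm (fun x => 1/2 * (k1 x + k2 x)) by apply: acZ; exact: acD.
have EP f g : (fun x => half_sum f g x + 1 * half_diff f g x) = f.
  by apply/funext => x; rewrite /half_sum /half_diff; field.
have EN f g : (fun x => half_sum f g x + (-1) * half_diff f g x) = g.
  by apply/funext => x; rewrite /half_sum /half_diff; field.
have E1 : Fe Q1 M1 = Fe (fun x => Qm x + 1 * v x) (fun x => Mm x + 1 * w x).
  by rewrite !EP.
have E2 : Fe Q2 M2 = Fe (fun x => Qm x + (-1) * v x) (fun x => Mm x + (-1) * w x).
  by rewrite !EN.
rewrite E1 E2 !(Fe_taylor _ aQ aM av aw).
have sq (a b : R) : a ^+ 2 <= B -> b ^+ 2 <= B -> (1/2 * (a + b)) ^+ 2 <= B.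
  by move=> aB bB; have := sqr_ge0 (a - b); lra.
have := @int_remainder_ge Qm z0 Mm z0 _ _ _ _ v z0 w z0 _ _ _ _ 1 0 1 (Kc c B)
  aQ ac_z0 aM ac_z0 av ac_z0 aw ac_z0.
rewrite sqnorm_z0.
have H : forall x, -1 <= x <= 1 -> - Kc c B * (v x ^+ 2 + z0 x ^+ 2 + (w x ^+ 2 + z0 x ^+ 2)) <=
   1 * V2 c (Qm x) (z0 x) (Mm x) (z0 x) (v x) (z0 x) (w x) (z0 x) +
   0 * V3 c (Qm x) (z0 x) (Mm x) (z0 x) (v x) (z0 x) (w x) (z0 x) +
   1 * V4 (v x) (z0 x) (w x) (z0 x).
  move=> x /bd[b1 b2 b3 b4]; rewrite mul0r addr0 !mul1r.
  by apply: (remainder_even_ge c0 B0); exact: sq.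
move=> /(_ H).
have -> : (-1 : R) ^+ 2 = 1 by ring.
have -> : (-1 : R) ^+ 3 = -1 by ring.
have -> : (-1 : R) ^+ 4 = 1 by ring.
rewrite !expr1n; lra.
Qed.

End IntegralRemainder.

(** * Existence of a minimiser *)

Section Existence.
Variables (R : realType) (l c : R).
Hypotheses (l0 : 0 < l) (c0 : 0 < c).
Local Notation mu := (@lebesgue_measure R).
Local Notation I := (`[(-1 : R), 1]%classic).
Local Notation z0 := (@z0 R).
Local Notation Fe := (Fe l c).
Implicit Types (Q M u v w g h k : R -> R) (a b C e : R).

Lemma le0_of_pow2 a C : (forall j, a <= C * (1/2) ^+ j) -> a <= 0.
Proof.
move=> H; rewrite leNgt; apply/negP => a0.
pose i := Num.bound (C / a).
have := upper_nthrootP (leqnn i); rewrite ltr_pdivrMr// => Ci.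
have p0 : (0 : R) < 2 ^+ i by rewrite exprn_gt0.
have := H i; rewrite expr_div_n expr1n mulrA mulr1 ler_pdivlMr// mulrC leNgt.
by rewrite Ci.
Qed.

Lemma pow4_le_pow2 j : (1/4 : R) ^+ j <= (1/2) ^+ j.
Proof. by rewrite lerXn2r ?nnegrE ?divr_ge0//; lra. Qed.

Definition gradQ Q M x : R := 4 * Q x * (Q x ^+ 2 - 1) - c * M x ^+ 2.
Definition gradM Q M x : R := M x * (M x ^+ 2 - 1) - 2 * c * Q x * M x.

Lemma cI_gradQ Q M : cI Q -> cI M -> cI (gradQ Q M).
Proof. by move=> cQ cM; rewrite /gradQ; tac_cI. Qed.

Lemma cI_gradM Q M : cI Q -> cI M -> cI (gradM Q M).
Proof. by move=> cQ cM; rewrite /gradM; tac_cI. Qed.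

(** The directions v2 and v4 drop out: F is invariant under changing the signs of Q12 and M2
    together. This is why critical points of the reduced energy are critical for F. *)
Lemma dens1_or Q g M k v1 v2 v3 v4 h1 h2 h3 h4 : ac Q g -> ac M k ->
  ac v1 h1 -> ac v2 h2 -> ac v3 h3 -> ac v4 h4 ->
  \int[mu]_(x in I) dens1 l c Q z0 M z0 g z0 k z0 v1 v2 v3 v4 h1 h2 h3 h4 x =
  \int[mu]_(x in I) (l * (g x * h1 x) + gradQ Q M x * v1 x)
  + \int[mu]_(x in I) (l * (k x * h3 x) + gradM Q M x * v3 x).
Proof.
move=> aQ aM b1 b2 b3 b4.
have cQ := ac_cI aQ; have cM := ac_cI aM.
rewrite -RintD.
- by apply: Rint_eq => x _; rewrite /dens1 /V1 /gradQ /gradM /z0 /=; ring.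
- apply: int1D; first by apply: int1Z; apply: sq2_mul; [exact: aQ.1|exact: b1.1].
  by apply: sq2_mul; [exact: sq2_cont (cI_gradQ cQ cM)|exact: ac_sq2 b1].
- apply: int1D; first by apply: int1Z; apply: sq2_mul; [exact: aM.1|exact: b3.1].
  by apply: sq2_mul; [exact: sq2_cont (cI_gradM cQ cM)|exact: ac_sq2 b3].
Qed.

(** The weight 2^-j balances the fixed f against the bound C 4^-j, and both contribute a multiple of
    2^-j. *)
Lemma int_mul_pow_ge (f g : R -> R) C j : sq2 (-1) 1 f -> sq2 (-1) 1 g ->
  sqnorm g <= C * (1/4) ^+ j ->
  - ((sqnorm f + C) * (1/2) ^+ j) <= \int[mu]_(x in I) (f x * g x).
Proof.
move=> sf sg gC.
have th0 : (0 : R) < (1/2) ^+ j by rewrite exprn_gt0// divr_gt0.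
have := int_mul_ge sf sg th0; apply: le_trans.
rewrite lerN2.
have E4 : (1/4 : R) ^+ j = (1/2) ^+ j * (1/2) ^+ j.
  by rewrite -exprMn; congr (_ ^+ _); field.
have : ((1/2 : R) ^+ j)^-1 * sqnorm g <= C * (1/2) ^+ j.
  by rewrite mulrC ler_pdivrMr// -mulrA -E4.
have := mulr_ge0 (ltW th0) (sqnorm_ge0 f).
have : 0 <= ((1/2 : R) ^+ j)^-1 * sqnorm g by rewrite mulr_ge0 ?sqnorm_ge0// invr_ge0 ltW.
lra.
Qed.

(* Lower semicontinuity: expand the energy of [Q j, M j] around the limit; the
   linear term is O(2^-j) and the remainder is bounded below by O(4^-j). *)
Lemma Fe_lsc Qs gQ Ms gM (Q M g k : nat -> R -> R) C e :
  ac Qs gQ -> ac Ms gM -> (forall j, ac (Q j) (g j)) -> (forall j, ac (M j) (k j)) ->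
  (forall j, Q j (-1) = Qs (-1)) -> (forall j, M j (-1) = Ms (-1)) ->
  (forall j, sqnorm (fun x => g j x - gQ x) <= C * (1/4) ^+ j) ->
  (forall j, sqnorm (fun x => k j x - gM x) <= C * (1/4) ^+ j) ->
  (forall j, Fe (Q j) (M j) <= e + (1/4) ^+ j) -> Fe Qs Ms <= e.
Proof.
move=> aQ aM aQj aMj Q0 M0 hg hk HF.
have cQ := ac_cI aQ; have cM := ac_cI aM.
have l0' := l0; have c0' := c0.
pose B := (2 * Qs (-1) ^+ 2 + 4 * sqnorm gQ) + (2 * Ms (-1) ^+ 2 + 4 * sqnorm gM).
have [B1 B2] : 0 <= 2 * Qs (-1) ^+ 2 + 4 * sqnorm gQ /\ 0 <= 2 * Ms (-1) ^+ 2 + 4 * sqnorm gM.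
  by split; apply: addr_ge0; apply: mulr_ge0; rewrite ?sqr_ge0 ?sqnorm_ge0.
have B0 : 0 <= B by exact: addr_ge0.
(* Collects the coefficients of 2^-j: the elastic and bulk linear terms, the L^2 loss with 8 C for
   each component by the Poincare inequality, and 1 for the slack 4^-j in the energies. *)
pose A := (l * (sqnorm gQ + C) + (sqnorm (gradQ Qs Ms) + 8 * C))
  + (l * (sqnorm gM + C) + (sqnorm (gradM Qs Ms) + 8 * C)) + Kc c B * (16 * C) + 1.
rewrite -subr_le0; apply: (@le0_of_pow2 _ A) => j.
set p2 : R := (1/2) ^+ j; set p4 : R := (1/4) ^+ j.
have HFj : Fe (Q j) (M j) <= e + p4 := HF j.
pose v x := Q j x - Qs x; pose h x := g j x - gQ x.
pose w x := M j x - Ms x; pose s x := k j x - gM x.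
have av : ac v h by exact: acB.
have aw : ac w s by exact: acB.
have v0 : v (-1) = 0 by rewrite /v Q0 subrr.
have w0 : w (-1) = 0 by rewrite /w M0 subrr.
have vC : sqnorm v <= 8 * C * (1/4) ^+ j.
  by apply: le_trans (poincare av v0) _; have := hg j; rewrite -/h; lra.
have wC : sqnorm w <= 8 * C * (1/4) ^+ j.
  by apply: le_trans (poincare aw w0) _; have := hk j; rewrite -/s; lra.
have E : Fe (Q j) (M j) = Fe (fun x => Qs x + 1 * v x) (fun x => Ms x + 1 * w x).
  have -> : (fun x => Qs x + 1 * v x) = Q j by apply/funext => x; rewrite /v; ring.
  by have -> : (fun x => Ms x + 1 * w x) = M j by apply/funext => x; rewrite /w; ring.
move: HFj; rewrite E (Fe_taylor _ _ _ aQ aM av aw) !expr1n !mul1r.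
rewrite (dens1_or aQ aM av (ac_z0 R) aw (ac_z0 R)).
have i1 := sq2_mul aQ.1 av.1; have i2 := sq2_mul aM.1 aw.1.
have sGQ := sq2_cont (cI_gradQ cQ cM); have sGM := sq2_cont (cI_gradM cQ cM).
have i3 := sq2_mul sGQ (ac_sq2 av); have i4 := sq2_mul sGM (ac_sq2 aw).
rewrite (RintD (int1Z l i1) i3) (RintD (int1Z l i2) i4) (RintZ l i1) (RintZ l i2).
have b1 := int_mul_pow_ge aQ.1 av.1 (hg j); have b2 := int_mul_pow_ge aM.1 aw.1 (hk j).
have b3 := int_mul_pow_ge sGQ (ac_sq2 av) vC; have b4 := int_mul_pow_ge sGM (ac_sq2 aw) wC.
rewrite -/p2 in b1 b2 b3 b4.
have lb1 := ler_wpM2l (ltW l0) b1; have lb2 := ler_wpM2l (ltW l0) b2.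
have := @int_remainder_ge R l c Qs z0 Ms z0 _ _ _ _ v z0 w z0 _ _ _ _ 1 1 1 (Kc c B)
  aQ (ac_z0 R) aM (ac_z0 R) av (ac_z0 R) aw (ac_z0 R).
rewrite sqnorm_z0 !mul1r !addr0.
have H : forall x, -1 <= x <= 1 -> - Kc c B * (v x ^+ 2 + z0 x ^+ 2 + (w x ^+ 2 + z0 x ^+ 2)) <=
   1 * V2 c (Qs x) (z0 x) (Ms x) (z0 x) (v x) (z0 x) (w x) (z0 x) +
   1 * V3 c (Qs x) (z0 x) (Ms x) (z0 x) (v x) (z0 x) (w x) (z0 x) +
   1 * V4 (v x) (z0 x) (w x) (z0 x).
  move=> x x1; rewrite !mul1r.
  apply: (remainder_ge c0 B0).
    by apply: le_trans (ac_bounded aQ x1) _; rewrite /B lerDl.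
  by apply: le_trans (ac_bounded aM x1) _; rewrite /B lerDr.
move=> /(_ H).
have DD : 0 <= l / 2 * (sqnorm h + sqnorm s).
  by apply: mulr_ge0; [rewrite divr_ge0// ltW|apply: addr_ge0; exact: sqnorm_ge0].
have KK : Kc c B * (sqnorm v + sqnorm w) <= Kc c B * (16 * C) * p4.
  rewrite -mulrA; apply: ler_wpM2l; first exact: Kc_ge0.
  by rewrite -/p4 in vC wC; lra.
have C0 : 0 <= C.
  have p40 : (0 : R) < (1/4) ^+ j by rewrite exprn_gt0// divr_gt0.
  by have := le_trans (sqnorm_ge0 _) (hg j); rewrite pmulr_lge0.
have KP : Kc c B * (16 * C) * p4 <= Kc c B * (16 * C) * p2.
  apply: ler_wpM2l; last exact: pow4_le_pow2.
  by apply: mulr_ge0; [exact: Kc_ge0|rewrite mulr_ge0].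
have p42 : p4 <= p2 := pow4_le_pow2 j.
rewrite /A; lra.
Qed.

Lemma or_FeE Q M : or_admissible Q M -> or_energy l c Q M = Fe Q M.
Proof. move=> [wQ wM _ _]; rewrite FeE; exact: or_full (W12_ac wQ) (W12_ac wM). Qed.

Lemma or_admissible_exists : or_admissible (fun x : R => -1 * x) (fun x => -1 * x).
Proof.
have a := acZ (-1) (@ac_id R).
by split; [exact: ac_W12 a|exact: ac_W12 a|split; rewrite mulrNN mulr1|split; rewrite mulr1].
Qed.

Lemma Fe_lbound Q M : or_admissible Q M -> - (2 * ((1 + c ^+ 2) ^+ 2 + 1)) <= Fe Q M.
Proof.
have l0' := l0.
move=> [/W12_ac aQ /W12_ac aM _ _]; have := Fe_coercive l c aQ aM.
have : 0 <= l / 2 * (sqnorm (wderiv Q) + sqnorm (wderiv M)).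
  by apply: mulr_ge0; [lra|apply: addr_ge0; exact: sqnorm_ge0].
lra.
Qed.

(* At the midpoint the energy drops by a multiple of the squared W^{1,2} distance, up
   to K times the squared L^2 distance; on a fine enough subdivision the values at the
   nodes and a small multiple of the gradient control the latter. *)
Lemma minimising_cauchy (B K e eps : R) (N : nat) Q1 M1 Q2 M2 :
  0 <= B -> K = Kc c B -> (0 < N)%N -> 32 * K <= l * N%:R ->
  0 <= eps -> eps <= 1 ->
  (forall Q M, or_admissible Q M -> e <= Fe Q M) ->
  or_admissible Q1 M1 -> or_admissible Q2 M2 ->
  (forall x, -1 <= x <= 1 -> [/\ Q1 x ^+ 2 <= B, M1 x ^+ 2 <= B, Q2 x ^+ 2 <= B & M2 x ^+ 2 <= B]) ->
  Fe Q1 M1 <= e + eps -> Fe Q2 M2 <= e + eps ->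
  (forall i, (i < N.+1)%N -> let y := -1 + i%:R * (2 / N%:R) in
     `|Q1 y - Q2 y| <= 2 * eps /\ `|M1 y - M2 y| <= 2 * eps) ->
  sqnorm (fun x => wderiv Q1 x - wderiv Q2 x) <= 8 * (2 + 16 * K) / l * eps /\
  sqnorm (fun x => wderiv M1 x - wderiv M2 x) <= 8 * (2 + 16 * K) / l * eps.
Proof.
move=> B0 KE N0 KN eps0 eps1 emin adm1 adm2 bd F1 F2 nodes.
have l0' := l0.
have K0 : 0 <= K by rewrite KE; exact: Kc_ge0.
have [/W12_ac aQ1 /W12_ac aM1 [q1 m1] [q1' m1']] := adm1.
have [/W12_ac aQ2 /W12_ac aM2 [q2 m2] [q2' m2']] := adm2.
have n0 : (0 : R) < N%:R by rewrite ltr0n.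
set h : R := 2 / N%:R.
have h0 : 0 < h by rewrite divr_gt0.
have Kh : 16 * (K * h) <= l.
  by rewrite /h !mulrA ler_pdivrMr//; lra.
(* The admissible set is convex, so the midpoint is a competitor. *)
have mid : e <= Fe (half_sum Q1 Q2) (half_sum M1 M2).
  apply: emin; split.
  - by apply: ac_W12 (acZ (1/2) (acD aQ1 aQ2)).
  - by apply: ac_W12 (acZ (1/2) (acD aM1 aM2)).
  - by rewrite /half_sum q1 q2 m1 m2; split; field.
  - by rewrite /half_sum q1' q2' m1' m2'; split; field.
have := Fe_midpoint l c0 B0 aQ1 aM1 aQ2 aM2 bd.
rewrite -KE.
have av : ac (half_diff Q1 Q2) (half_diff (wderiv Q1) (wderiv Q2)) by apply: acZ; exact: acB.
have aw : ac (half_diff M1 M2) (half_diff (wderiv M1) (wderiv M2)) by apply: acZ; exact: acB.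
set v := half_diff Q1 Q2 in av *; set w := half_diff M1 M2 in aw *.
set vg := half_diff (wderiv Q1) _ in av *; set wg := half_diff (wderiv M1) _ in aw *.
(* Since eps <= 1, the natural bound eps^2 is relaxed to eps. *)
have half_sqr (a b : R) : `|a - b| <= 2 * eps -> (1/2 * (a - b)) ^+ 2 <= eps.
  move=> ab; rewrite -(real_normK (num_real (1/2 * (a - b)))) normrM ger0_norm; last by lra.
  have := normr_ge0 (a - b); nra.
have small u ug : ac u ug ->
    (forall i, (i < N.+1)%N -> u (-1 + i%:R * h) ^+ 2 <= eps) ->
    sqnorm u <= 4 * eps + 4 * h * sqnorm ug.
  move=> aug un.
  have -> : 4 * eps + 4 * h * sqnorm ug = 2 * (2 * eps + 2 * h * sqnorm ug) by ring.
  apply: (int_sqr_le aug) => x x1.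
  have [i [iN iI xi]] := node_near N0 x1.
  apply: le_trans (ac_sqr_le_node aug x1 iI xi) _.
  by rewrite lerD2r ler_pM2l//; exact: un.
have sv := small v vg av (fun i iN => half_sqr _ _ (nodes i iN).1).
have sw := small w wg aw (fun i iN => half_sqr _ _ (nodes i iN).2).
have dE g1 g2 : sq2 (-1) 1 g1 -> sq2 (-1) 1 g2 ->
    sqnorm (fun x => g1 x - g2 x) = 4 * sqnorm (half_diff g1 g2).
  move=> s1 s2; rewrite !sqnormE -RintZ; last by apply: (sq2Z (1/2) (sq2B s1 s2)).2.
  by apply: Rint_eq => x _; rewrite /half_diff; field.
rewrite (dE _ _ aQ1.1 aQ2.1) (dE _ _ aM1.1 aM2.1) -/vg -/wg.
move: (sqnorm_ge0 vg) (sqnorm_ge0 wg) sv sw mid F1 F2.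
move: (sqnorm v) (sqnorm w) (sqnorm vg) (sqnorm wg) (Fe _ _) (Fe _ _) (Fe _ _).
move=> nv nw d1 d2 f0 f1 f2 d1_ge0 d2_ge0 sv sw mid F1 F2 Hm.
clear - l0' K0 h0 Kh eps0 d1_ge0 d2_ge0 sv sw mid F1 F2 Hm.
(* The factor 2 K of the midpoint inequality turns the gradient part into 8 K h (d1 + d2), which the
   mesh size keeps below half of the gain l (d1 + d2). *)
have Ks : K * (nv + nw) <= K * (8 * eps) + 4 * (K * h) * (d1 + d2).
  have := ler_wpM2l K0 (lerD sv sw); clear; lra.
have Khd : 16 * (K * h) * (d1 + d2) <= l * (d1 + d2).
  by apply: ler_wpM2r => //; exact: addr_ge0.
have fin : l * (d1 + d2) <= 2 * (2 + 16 * K) * eps.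
  by move: Ks Khd Hm mid F1 F2; clear; lra.
have conc a : l * a <= 2 * (2 + 16 * K) * eps -> 4 * a <= 8 * (2 + 16 * K) / l * eps.
  by move=> la; rewrite [leRHS]mulrAC ler_pdivlMr//; move: la; clear; lra.
by split; apply: conc; apply: le_trans fin; rewrite ler_pM2l// ?lerDl ?lerDr.
Qed.

Lemma or_minimiser_exists : exists Q M, or_minimiser l c Q M.
Proof.
have l0' := l0.
pose S := [set E : R | exists Q M, or_admissible Q M /\ E = Fe Q M].
have S0 : S !=set0 by exists (Fe (fun x => -1 * x) (fun x => -1 * x)), (fun x => -1 * x), (fun x => -1 * x); split => //; exact: or_admissible_exists.
have Slb : has_lbound S by exists (- (2 * ((1 + c ^+ 2) ^+ 2 + 1))) => _ [Q [M [adm ->]]]; exact: Fe_lbound.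
pose e := inf S.
have emin Q M : or_admissible Q M -> e <= Fe Q M.
  by move=> adm; apply: ge_inf => //; exists Q, M.
have Hs n : exists P : (R -> R) * (R -> R), or_admissible P.1 P.2 /\ Fe P.1 P.2 <= e + (1/4) ^+ n.
  have p0 : (0 : R) < (1/4) ^+ n by rewrite exprn_gt0.
  have [_ [Q [M [adm ->]]] lt] := inf_adherent p0 (conj S0 Slb).
  by exists (Q, M); split => //; exact: ltW.
have [s sP] := choice Hs.
pose C0 := 2 * ((1 + c ^+ 2) ^+ 2 + 1).
pose Dm := 2 / l * (e + 1 + C0).
have pow1 n : (1/4 : R) ^+ n <= 1 by rewrite exprn_ile1//; lra.
have pow0 n : (0 : R) <= (1/4) ^+ n by rewrite exprn_ge0.
have HD n : sqnorm (wderiv (s n).1) <= Dm /\ sqnorm (wderiv (s n).2) <= Dm.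
  have [[/W12_ac aQ /W12_ac aM _ _] Fn] := sP n.
  have := Fe_coercive l c aQ aM; rewrite -/C0 => H.
  have d1 := sqnorm_ge0 (wderiv (s n).1); have d2 := sqnorm_ge0 (wderiv (s n).2).
  have H2 : l / 2 * (sqnorm (wderiv (s n).1) + sqnorm (wderiv (s n).2)) <= e + 1 + C0.
    by have := pow1 n; lra.
  have H3 : sqnorm (wderiv (s n).1) + sqnorm (wderiv (s n).2) <= Dm.
    by rewrite /Dm mulrAC ler_pdivlMr//; lra.
  by split; lra.
pose B := 2 + 4 * Dm.
have Dm0 : 0 <= Dm by apply: le_trans (HD 0%N).1; exact: sqnorm_ge0.
have B0 : 0 <= B by rewrite /B; lra.
have HB n x : -1 <= x <= 1 -> (s n).1 x ^+ 2 <= B /\ (s n).2 x ^+ 2 <= B.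
  move=> x1; have [[/W12_ac aQ /W12_ac aM [q0 m0] _] _] := sP n; have [D1 D2] := HD n.
  have := ac_bounded aQ x1; have := ac_bounded aM x1.
  by rewrite q0 m0 expr1n /B => ? ?; split; lra.
pose K := Kc c B.
(* The mesh is fixed by K and l, so one finite set of nodes serves the whole minimising sequence. *)
pose N := (Num.trunc (32 * K / l)).+1.
have KN : 32 * K <= l * N%:R.
  by rewrite [l * _]mulrC; apply: ltW; rewrite -ltr_pdivrMr//; exact: truncnS_gt.
(* The clamp moves no node in range and keeps [aB] true for every index. The vector [a] lists the N
   + 1 values of Q, then those of M. *)
pose node i : R := clamp (-1 + i%:R * (2 / N%:R)).
pose a n i := if (i < N.+1)%N then (s n).1 (node i) else (s n).2 (node (i - N.+1)%N).
have aB n i : `|a n i| <= 1 + B.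
  have sqB (b : R) : b ^+ 2 <= B -> `|b| <= 1 + B.
    rewrite -(real_normK (num_real b)); have := sqr_ge0 (`|b| - 1); lra.
  by rewrite /a; case: ifP => _; apply: sqB; rewrite /node;
    [exact: (HB n _ (clampP _)).1|exact: (HB n _ (clampP _)).2].
have [p [f fP]] := @bounded_subseq R (N.+1 + N.+1) a (1 + B) aB.
pose Q j := (s (f j)).1; pose M j := (s (f j)).2.
have adm j : or_admissible (Q j) (M j) := (sP (f j)).1.
have FQ j m : (j <= m)%N -> Fe (Q m) (M m) <= e + (1/4) ^+ j.
  move=> jm; apply: le_trans (sP (f m)).2 _; rewrite lerD2l.
  by apply: ler_wiXn2l; [lra|lra|exact: leq_trans (fP m).1].
have pmono j m : (j <= m)%N -> (1/4 : R) ^+ m <= (1/4) ^+ j.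
  by move=> jm; apply: ler_wiXn2l => //; lra.
pose C := 8 * (2 + 16 * K) / l.
have cauchy j m : (j <= m)%N ->
   sqnorm (fun x => wderiv (Q j) x - wderiv (Q m) x) <= C * (1/4) ^+ j /\
   sqnorm (fun x => wderiv (M j) x - wderiv (M m) x) <= C * (1/4) ^+ j.
  move=> jm; apply: (@minimising_cauchy B K e ((1/4) ^+ j) N) => //.
  - by move=> x x1; have [? ?] := HB (f j) _ x1; have [? ?] := HB (f m) _ x1.
  - exact: FQ.
  - exact: FQ.
  move=> i iN y.
  have yE : clamp y = y.
    apply: clamp_id; rewrite /y; have n0 : (0 : R) < N%:R by rewrite ltr0n.
    have hN : N%:R * (2 / N%:R) = 2 :> R by rewrite mulrC divfK// gt_eqF.
    have h0 : 0 < 2 / N%:R :> R by rewrite divr_gt0.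
    have i0 : 0 <= i%:R * (2 / N%:R) :> R by rewrite mulr_ge0// ltW.
    have i1 : i%:R * (2 / N%:R) <= N%:R * (2 / N%:R) :> R by rewrite ler_pM2r// ler_nat.
    by apply/andP; split; lra.
  have tri (b1 b2 b3 : R) : `|b1 - b3| <= (1/4) ^+ j -> `|b2 - b3| <= (1/4) ^+ m -> `|b1 - b2| <= 2 * (1/4) ^+ j.
    move=> H1 H2; have := ler_distD b3 b1 b2; rewrite (distrC b3 b2).
    by have := pmono _ _ jm; lra.
  split.
    have iNN : (i < N.+1 + N.+1)%N by rewrite ltn_addr.
    have := (fP j).2 i iNN; have := (fP m).2 i iNN.
    by rewrite /a iN /node -/y yE => /[swap]; exact: tri.
  have iNN : (i + N.+1 < N.+1 + N.+1)%N by rewrite ltn_add2r.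
  have := (fP j).2 _ iNN; have := (fP m).2 _ iNN.
  rewrite /a ltnNge leq_addl/= addnK /node -/y yE => /[swap]; exact: tri.
have sQ j : sq2 (-1) 1 (wderiv (Q j)) by have [/W12_ac[]] := adm j.
have sM j : sq2 (-1) 1 (wderiv (M j)) by have [_ /W12_ac[]] := adm j.
have [gQ sgQ gQC] := sq2_complete sQ (fun n m nm => (cauchy n m nm).1).
have [gM sgM gMC] := sq2_complete sM (fun n m nm => (cauchy n m nm).2).
(* Integrating the limits of the derivatives builds in the value 1 at -1; the value at 1 is
   recovered by [endpoint], through the uniform bound on a function in terms of its derivative. *)
pose Qs x := 1 + \int[mu]_(t in `[(-1)%R, x]) gQ t.
pose Ms x := 1 + \int[mu]_(t in `[(-1)%R, x]) gM t.
have aQs : ac Qs gQ by split => // x _; rewrite /Qs Rint_point addr0.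
have aMs : ac Ms gM by split => // x _; rewrite /Ms Rint_point addr0.
have Qs0 : Qs (-1) = 1 by rewrite /Qs Rint_point addr0.
have Ms0 : Ms (-1) = 1 by rewrite /Ms Rint_point addr0.
have C_ge0 : 0 <= C.
  by have := le_trans (sqnorm_ge0 _) (gQC 0%N); rewrite expr0 mulr1.
have endpoint u ug (us : nat -> R -> R) (b : R) : ac u ug -> (forall j, ac (us j) (wderiv (us j))) ->
    (forall j, us j (-1) = u (-1)) -> (forall j, us j 1 = b) ->
    (forall j, sqnorm (fun x => wderiv (us j) x - ug x) <= C * (1/4) ^+ j) -> u 1 = b.
  move=> au aus us0 us1 usC.
  apply/eqP; rewrite eq_sym -subr_eq0 -sqrf_eq0 eq_le sqr_ge0 andbT.
  apply: (@le0_of_pow2 _ (4 * C)) => j.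
  have I1 : -1 <= (1 : R) <= 1 by rewrite lexx ge0_cp.
  have := ac_bounded (acB (aus j) au) I1.
  rewrite us0 us1 subrr expr0n/= mulr0 add0r => H; apply: le_trans H _.
  have := ler_wpM2l C_ge0 (pow4_le_pow2 j); have := usC j; lra.
have admQ j : ac (Q j) (wderiv (Q j)) by have [/W12_ac] := adm j.
have admM j : ac (M j) (wderiv (M j)) by have [_ /W12_ac] := adm j.
have Q0 j : Q j (-1) = Qs (-1) by have [_ _ [->]] := adm j.
have M0 j : M j (-1) = Ms (-1) by have [_ _ [_ ->]] := adm j.
have Q1 j : Q j 1 = -1 by have [_ _ _ [->]] := adm j.
have M1 j : M j 1 = -1 by have [_ _ _ [_ ->]] := adm j.
have Qs1 : Qs 1 = -1 by exact: (endpoint Qs gQ Q _ aQs admQ Q0 Q1 gQC).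
have Ms1 : Ms 1 = -1 by exact: (endpoint Ms gM M _ aMs admM M0 M1 gMC).
have adms : or_admissible Qs Ms.
  by split => //; [exact: ac_W12 aQs|exact: ac_W12 aMs].
exists Qs, Ms; split => // Q' M' adm'.
rewrite !or_FeE//; apply: le_trans (emin _ _ adm').
exact: (Fe_lsc aQs aMs admQ admM Q0 M0 gQC gMC (fun j => FQ j j (leqnn j))).
Qed.

End Existence.

(** * The Euler-Lagrange equations of a minimiser *)

Section CriticalPoint.
Variables (R : realType) (l c : R).
Hypotheses (l0 : 0 < l) (c0 : 0 < c).
Local Notation mu := (@lebesgue_measure R).
Local Notation I := (`[(-1 : R), 1]%classic).
Local Notation z0 := (@z0 R).
Implicit Types (Q M u v w g h k q m : R -> R).

(** Along each admissible line the energy minus its minimum is a nonnegative quartic without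
    constant term, so its linear coefficient is 0. Perturbing one component at a time separates the
    two equations. *)
Lemma or_minimiser_weak Q M : or_minimiser l c Q M ->
  weak_solution l Q (wderiv Q) (gradQ c Q M) /\ weak_solution l M (wderiv M) (gradM c Q M).
Proof.
move=> [adm min]; have [/W12_ac aQ /W12_ac aM [q0 m0] [q1 m1]] := adm.
have az := ac_z0 R.
have first q qg m mg : ac q qg -> ac m mg -> q (-1) = 0 -> q 1 = 0 -> m (-1) = 0 -> m 1 = 0 ->
   \int[mu]_(x in I) (l * (wderiv Q x * qg x) + gradQ c Q M x * q x)
   + \int[mu]_(x in I) (l * (wderiv M x * mg x) + gradM c Q M x * m x) = 0.
  move=> aq am q0' q1' m0' m1'.
  rewrite -(dens1_or l c aQ aM aq az am az).
  apply: (@poly4_ge0 _ _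
    (\int[mu]_(x in I) dens2 l c Q z0 M z0 q z0 m z0 qg z0 mg z0 x)
    (\int[mu]_(x in I) dens3 c Q z0 M z0 q z0 m z0 x)
    (\int[mu]_(x in I) dens4 q z0 m z0 x)) => t.
  have admt : or_admissible (fun x => Q x + t * q x) (fun x => M x + t * m x).
    split.
    - exact: ac_W12 (acD aQ (acZ t aq)).
    - exact: ac_W12 (acD aM (acZ t am)).
    - by rewrite q0' m0' !mulr0 !addr0.
    - by rewrite q1' m1' !mulr0 !addr0.
  have := min _ _ admt.
  by rewrite !or_FeE// (Fe_taylor l c t aQ aM aq am) -!addrA lerDl.
split=> q qg aq q0' q1'.
  have := first _ _ _ _ aq az q0' q1' erefl erefl.
  rewrite [X in _ + X](@Rint_eq _ _ _ _ (fun=> 0)); last by move=> x _; rewrite /z0/=; ring.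
  by rewrite Rint_cst ?ge0_cp// mul0r addr0.
have := first _ _ _ _ az aq erefl erefl q0' q1'.
rewrite [X in X + _](@Rint_eq _ _ _ _ (fun=> 0)); last by move=> x _; rewrite /z0/=; ring.
by rewrite Rint_cst ?ge0_cp// mul0r add0r.
Qed.

Lemma or_minimiser_system Q M : or_minimiser l c Q M ->
  full_system l c Q (cst 0) M (cst 0).
Proof.
move=> min; have [wQ wM] := or_minimiser_weak min.
have [[/W12_ac aQ /W12_ac aM _ _] _] := min.
have cQ := ac_cI aQ; have cM := ac_cI aM.
have alg (a b q m z s : R) : l * q = 4 * a * (a ^+ 2 - 1) - c * b ^+ 2 ->
    l * m = b * (b ^+ 2 - 1) - 2 * c * a * b -> s = 0 -> z = 0 ->
    [/\ l * q = 4 * a * (a ^+ 2 + z ^+ 2 - 1) - c * (b ^+ 2 - z ^+ 2),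
      l * s = 4 * z * (a ^+ 2 + z ^+ 2 - 1) - 2 * c * b * z,
      l * m = b * (b ^+ 2 + z ^+ 2 - 1) - 2 * c * a * b - 2 * c * z * z &
      l * s = z * (b ^+ 2 + z ^+ 2 - 1) + 2 * c * a * z - 2 * c * z * b].
  by move=> -> -> -> ->; split; ring.
move=> y y1.
have [dQ eQ] := weak_solution_C2 l0 aQ (cI_gradQ cQ cM) wQ y1.
have [dM eM] := weak_solution_C2 l0 aM (cI_gradM cQ cM) wM y1.
have d0 : derive1 (cst 0 : R -> R) = cst 0 by apply/funext => x; rewrite derive1_cst.
have dz : twice_derivable (cst 0 : R -> R) y.
  by split; [apply: filterE => z; exact: derivable_cst|rewrite d0; exact: derivable_cst].
have ez : derive1n 2 (cst 0 : R -> R) y = 0 by rewrite /derive1n/= !d0.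
split; first by split.
exact: (alg _ _ _ _ _ _ eQ eM ez erefl).
Qed.

Lemma or_minimiser_admissible Q M : or_minimiser l c Q M -> admissible Q (cst 0) M (cst 0).
Proof.
move=> [[wQ wM [q0 m0] [q1 m1]] _].
by split => //; split => //; exact: ac_W12 (ac_z0 R).
Qed.

Lemma or_minimiser_dens1 Q M v1 v2 v3 v4 h1 h2 h3 h4 : or_minimiser l c Q M ->
  ac v1 h1 -> ac v2 h2 -> ac v3 h3 -> ac v4 h4 ->
  v1 (-1) = 0 -> v1 1 = 0 -> v3 (-1) = 0 -> v3 1 = 0 ->
  \int[mu]_(x in I) dens1 l c Q z0 M z0 (wderiv Q) z0 (wderiv M) z0 v1 v2 v3 v4 h1 h2 h3 h4 x = 0.
Proof.
move=> min b1 b2 b3 b4 v10 v11 v30 v31; have [wQ wM] := or_minimiser_weak min.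
have [[/W12_ac aQ /W12_ac aM _ _] _] := min.
by rewrite (dens1_or l c aQ aM b1 b2 b3 b4) wQ// wM// addr0.
Qed.

Lemma or_minimiser_critical Q M : or_minimiser l c Q M ->
  full_critical l c Q (cst 0) M (cst 0).
Proof.
move=> min; split; first exact: or_minimiser_admissible.
have [[/W12_ac aQ /W12_ac aM _ _] _] := min.
move=> q1 q2 m1 m2 [/W12_ac b1 v10 v11] [/W12_ac b2 _ _] [/W12_ac b3 v30 v31] [/W12_ac b4 _ _].
have := full_energy_derive l c aQ (ac_z0 R) aM (ac_z0 R) b1 b2 b3 b4.
by rewrite or_minimiser_dens1.
Qed.

Lemma or_minimiser_bounds Q M : or_minimiser l c Q M -> forall y, -1 <= y <= 1 ->
  `|Q y| <= rho_star c /\ M y ^+ 2 <= 1 + 2 * c * rho_star c.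
Proof.
move=> min; have [wQ wM] := or_minimiser_weak min.
have [[/W12_ac aQ /W12_ac aM [q0 m0] [q1 m1]] _] := min.
exact: (or_bounds l0 c0 aQ aM q0 m0 q1 m1 wQ wM).
Qed.

End CriticalPoint.

Lemma sum4_le0 (R : realDomainType) (n1 n2 n3 n4 : R) :
  0 <= n1 -> 0 <= n2 -> 0 <= n3 -> 0 <= n4 -> n1 + n2 + (n3 + n4) <= 0 ->
  [/\ n1 <= 0, n2 <= 0, n3 <= 0 & n4 <= 0].
Proof. by move=> *; split; lra. Qed.

(** * Uniqueness for large l *)

Section LargeElasticConstant.
Variables (R : realType) (l c : R).
Hypothesis (c0 : 0 < c).
Local Notation mu := (@lebesgue_measure R).
Local Notation I := (`[(-1 : R), 1]%classic).
Local Notation z0 := (@z0 R).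

(** One bound for both Q^2 and M^2. It depends on c alone, so the threshold for l can be fixed
    before l and the minimiser. *)
Definition sup_bound : R := rho_star c ^+ 2 + (1 + 2 * c * rho_star c).
(* The constant 8 of the Poincare inequality turns the loss [Kc |v|^2] into [8 Kc |v'|^2],
   to be beaten by the elastic term [l/2 |v'|^2]. *)
Definition elastic_threshold : R := 16 * Kc c sup_bound + 1.

Lemma sup_bound_ge0 : 0 <= sup_bound.
Proof.
have r0 := ltW (rho_star_gt0 c0); have c0' := ltW c0.
by rewrite /sup_bound !addr_ge0 ?sqr_ge0// !mulr_ge0.
Qed.

Lemma elastic_threshold_gt0 : 0 < elastic_threshold.
Proof. by have := Kc_ge0 c0 sup_bound_ge0; rewrite /elastic_threshold; lra. Qed.

Hypothesis lL : elastic_threshold <= l.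
Let l0 : 0 < l. Proof. exact: lt_le_trans elastic_threshold_gt0 lL. Qed.

Variables (Q M : R -> R).
Hypothesis min : or_minimiser l c Q M.
Variables (u1 u2 u3 u4 : R -> R).
Hypothesis adm : admissible u1 u2 u3 u4.

Let v1 x := u1 x - Q x.
Let v2 x := u2 x - z0 x.
Let v3 x := u3 x - M x.
Let v4 x := u4 x - z0 x.
Let h1 x := wderiv u1 x - wderiv Q x.
Let h2 x := wderiv u2 x - z0 x.
Let h3 x := wderiv u3 x - wderiv M x.
Let h4 x := wderiv u4 x - z0 x.
Let D := sqnorm h1 + sqnorm h2 + (sqnorm h3 + sqnorm h4).

Let aQ : ac Q (wderiv Q). Proof. by case: min => [[/W12_ac]]. Qed.
Let aM : ac M (wderiv M). Proof. by case: min => [[_ /W12_ac]]. Qed.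
Let b1 : ac v1 h1. Proof. by apply: acB aQ; case: adm => [[/W12_ac]]. Qed.
Let b2 : ac v2 h2. Proof. by apply: acB (ac_z0 R); case: adm => [[_ /W12_ac]]. Qed.
Let b3 : ac v3 h3. Proof. by apply: acB aM; case: adm => [[_ _ /W12_ac]]. Qed.
Let b4 : ac v4 h4. Proof. by apply: acB (ac_z0 R); case: adm => [[_ _ _ /W12_ac]]. Qed.

Let bc : [/\ v1 (-1) = 0, v2 (-1) = 0, v3 (-1) = 0 & v4 (-1) = 0] /\
  [/\ v1 1 = 0, v2 1 = 0, v3 1 = 0 & v4 1 = 0].
Proof.
have [[_ _ [q0 m0] [q1 m1]] _] := min.
have [_ [a0 c0'] [a1 c1] [d0 d1] [e0 e1]] := adm.
rewrite /v1 /v2 /v3 /v4 q0 m0 q1 m1 a0 c0' a1 c1 d0 d1 e0 e1 /z0 /=.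
by rewrite !subrr.
Qed.

Let T2 := \int[mu]_(x in I) dens2 l c Q z0 M z0 v1 v2 v3 v4 h1 h2 h3 h4 x.
Let T3 := \int[mu]_(x in I) dens3 c Q z0 M z0 v1 v2 v3 v4 x.
Let T4 := \int[mu]_(x in I) dens4 v1 v2 v3 v4 x.
Let F0 := full_energy l c Q z0 M z0.

(** The line from the minimiser (t = 0) to the competitor u (t = 1); the linear term vanishes
    because the minimiser is critical for F. *)
Let energy_line (t : R) :
  full_energy l c (fun x => Q x + t * v1 x) (fun x => z0 x + t * v2 x)
    (fun x => M x + t * v3 x) (fun x => z0 x + t * v4 x) =
  F0 + t ^+ 2 * T2 + t ^+ 3 * T3 + t ^+ 4 * T4.
Proof.
have [[v10 _ v30 _] [v11 _ v31 _]] := bc.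
rewrite (full_energy_taylor l c aQ (ac_z0 R) aM (ac_z0 R) b1 b2 b3 b4).
by rewrite (or_minimiser_dens1 min b1 b2 b3 b4)// mulr0 addr0.
Qed.

Let bound x : -1 <= x <= 1 -> Q x ^+ 2 <= sup_bound /\ M x ^+ 2 <= sup_bound.
Proof.
move=> x1; have [Qx Mx] := or_minimiser_bounds l0 c0 min x1.
have r0 := ltW (rho_star_gt0 c0).
have cr : 0 <= c * rho_star c by rewrite mulr_ge0// ltW.
have Q2 : Q x ^+ 2 <= rho_star c ^+ 2.
  by rewrite -(real_normK (num_real (Q x))) ler_sqr ?nnegrE.
have := sqr_ge0 (rho_star c).
by rewrite /sup_bound; split; lra.
Qed.

Let int_sqr : Kc c sup_bound * (sqnorm v1 + sqnorm v2 + (sqnorm v3 + sqnorm v4)) <= Kc c sup_bound * (8 * D).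
Proof.
have [[v10 v20 v30 v40] _] := bc.
apply: ler_wpM2l; first exact: Kc_ge0 sup_bound_ge0.
have := poincare b1 v10; have := poincare b2 v20.
have := poincare b3 v30; have := poincare b4 v40.
rewrite /D; lra.
Qed.

Let D_ge0 : 0 <= D. Proof. by rewrite !addr_ge0 ?sqnorm_ge0. Qed.

(** The elastic gain l/2 D minus the loss 8 Kc D, for l >= 16 Kc + 1. *)
Let remainder_lower : 1 / 2 * D <= T2 + T3 + T4.
Proof.
have := @int_remainder_ge R l c Q z0 M z0 _ _ _ _ v1 v2 v3 v4 _ _ _ _ 1 1 1 (Kc c sup_bound)
  aQ (ac_z0 R) aM (ac_z0 R) b1 b2 b3 b4.
rewrite !mul1r -/D -/T2 -/T3 -/T4.
have H x : -1 <= x <= 1 -> - Kc c sup_bound * (v1 x ^+ 2 + v2 x ^+ 2 + (v3 x ^+ 2 + v4 x ^+ 2)) <=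
   1 * V2 c (Q x) (z0 x) (M x) (z0 x) (v1 x) (v2 x) (v3 x) (v4 x) +
   1 * V3 c (Q x) (z0 x) (M x) (z0 x) (v1 x) (v2 x) (v3 x) (v4 x) +
   1 * V4 (v1 x) (v2 x) (v3 x) (v4 x).
  by move=> /bound[Qx Mx]; rewrite !mul1r; exact: (remainder_ge c0 sup_bound_ge0).
move=> /(_ H) H2; have := int_sqr; have := ler_wpM2r D_ge0 lL; rewrite /elastic_threshold; lra.
Qed.

(** The right-hand side is the derivative of the energy along the line at t = 1, that is, at u in
    the direction v. A critical u therefore has D <= 0. *)
Let gradient_lower : D <= 2 * T2 + 3 * T3 + 4 * T4.
Proof.
have := @int_remainder_ge R l c Q z0 M z0 _ _ _ _ v1 v2 v3 v4 _ _ _ _ 2 3 4 (Kc c sup_bound)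
  aQ (ac_z0 R) aM (ac_z0 R) b1 b2 b3 b4.
rewrite -/D -/T2 -/T3 -/T4.
have H x : -1 <= x <= 1 -> - Kc c sup_bound * (v1 x ^+ 2 + v2 x ^+ 2 + (v3 x ^+ 2 + v4 x ^+ 2)) <=
   2 * V2 c (Q x) (z0 x) (M x) (z0 x) (v1 x) (v2 x) (v3 x) (v4 x) +
   3 * V3 c (Q x) (z0 x) (M x) (z0 x) (v1 x) (v2 x) (v3 x) (v4 x) +
   4 * V4 (v1 x) (v2 x) (v3 x) (v4 x).
  by move=> /bound[Qx Mx]; exact: (gradient_remainder_ge c0 sup_bound_ge0).
move=> /(_ H) H2; have := int_sqr; have := ler_wpM2r D_ge0 lL; rewrite /elastic_threshold.
have := mulr_ge0 (Kc_ge0 c0 sup_bound_ge0) D_ge0; lra.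
Qed.

Let u_line (t : R) : [/\ (fun x => u1 x + t * v1 x) = (fun x => Q x + (1 + t) * v1 x),
  (fun x => u2 x + t * v2 x) = (fun x => z0 x + (1 + t) * v2 x),
  (fun x => u3 x + t * v3 x) = (fun x => M x + (1 + t) * v3 x) &
  (fun x => u4 x + t * v4 x) = (fun x => z0 x + (1 + t) * v4 x)].
Proof. by split; apply/funext => x; rewrite /v1 /v2 /v3 /v4; ring. Qed.

Let energy_u : full_energy l c u1 u2 u3 u4 = F0 + T2 + T3 + T4.
Proof.
have u0 (u v : R -> R) : (fun x => u x + 0 * v x) = u.
  by apply/funext => x; rewrite mul0r addr0.
have [e1 e2 e3 e4] := u_line 0.
have := energy_line (1 + 0); rewrite -e1 -e2 -e3 -e4 addr0 !expr1n !mul1r => <-.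
by rewrite (u0 u1 v1) (u0 u2 v2) (u0 u3 v3) (u0 u4 v4).
Qed.

Lemma large_energy_ge : full_energy l c Q (cst 0) M (cst 0) <= full_energy l c u1 u2 u3 u4.
Proof. by rewrite energy_u -/F0; have := remainder_lower; have := D_ge0; lra. Qed.

Let D_le0_eq : D <= 0 -> forall y, -1 <= y <= 1 ->
  [/\ u1 y = Q y, u2 y = 0, u3 y = M y & u4 y = 0].
Proof.
move=> D0 y y1.
have [[v10 v20 v30 v40] _] := bc.
have [p1 p2 p3 p4] : [/\ sqnorm h1 <= 0, sqnorm h2 <= 0, sqnorm h3 <= 0 & sqnorm h4 <= 0].
  exact: sum4_le0 (sqnorm_ge0 h1) (sqnorm_ge0 h2) (sqnorm_ge0 h3) (sqnorm_ge0 h4) D0.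
have e1 := sqnorm_eq0 b1 v10 p1 y1; have e2 := sqnorm_eq0 b2 v20 p2 y1.
have e3 := sqnorm_eq0 b3 v30 p3 y1; have e4 := sqnorm_eq0 b4 v40 p4 y1.
move: e1 e2 e3 e4; rewrite /v1 /v2 /v3 /v4 /z0 /= !subr0.
by move=> /eqP; rewrite subr_eq0 => /eqP -> -> /eqP; rewrite subr_eq0 => /eqP -> ->.
Qed.

Lemma large_energy_unique : full_energy l c u1 u2 u3 u4 <= full_energy l c Q (cst 0) M (cst 0) ->
  forall y, -1 <= y <= 1 -> [/\ u1 y = Q y, u2 y = 0, u3 y = M y & u4 y = 0].
Proof.
rewrite energy_u -/F0 => H; apply: D_le0_eq.
by have := remainder_lower; lra.
Qed.

Lemma large_critical_unique : full_critical l c u1 u2 u3 u4 ->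
  forall y, -1 <= y <= 1 -> [/\ u1 y = Q y, u2 y = 0, u3 y = M y & u4 y = 0].
Proof.
move=> [_ crit]; apply: D_le0_eq.
have [[v10 v20 v30 v40] [v11 v21 v31 v41]] := bc.
have w1 : W012 v1 by split => //; exact: ac_W12 b1.
have w2 : W012 v2 by split => //; exact: ac_W12 b2.
have w3 : W012 v3 by split => //; exact: ac_W12 b3.
have w4 : W012 v4 by split => //; exact: ac_W12 b4.
have d0 := crit _ _ _ _ w1 w2 w3 w4.
have d1 : is_derive (0 : R) 1 (fun t : R => full_energy l c
    (fun y => u1 y + t * v1 y) (fun y => u2 y + t * v2 y)
    (fun y => u3 y + t * v3 y) (fun y => u4 y + t * v4 y)) (2 * T2 + 3 * T3 + 4 * T4).
  (* Expansion in t of F0 + (1 + t)^2 T2 + (1 + t)^3 T3 + (1 + t)^4 T4: moving from u along v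
     continues the same line. *)
  rewrite (_ : (fun t => _) = (fun t => (F0 + T2 + T3 + T4) + t * (2 * T2 + 3 * T3 + 4 * T4)
    + t ^+ 2 * (T2 + 3 * T3 + 6 * T4) + t ^+ 3 * (T3 + 4 * T4) + t ^+ 4 * T4)); first exact: is_derive_poly4.
  by apply/funext => t; have [-> -> -> ->] := u_line t; rewrite energy_line; ring.
have := gradient_lower.
by rewrite -(derive_val (is_derive := d1)) (derive_val (is_derive := d0)).
Qed.

End LargeElasticConstant.

Theorem theorem3p1 (R : realType) :
  (forall l c : R, 0 < l -> 0 < c ->
     (exists Q M : R -> R, or_minimiser l c Q M) /\
     (forall Q M : R -> R, or_minimiser l c Q M ->
        [/\ full_system l c Q (cst 0) M (cst 0),
            full_critical l c Q (cst 0) M (cst 0) &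
            forall y : R, -1 <= y <= 1 ->
              `|Q y| <= rho_star c /\ M y ^+ 2 <= 1 + 2 * c * rho_star c])) /\
  (forall c : R, 0 < c ->
     exists2 L : R, 0 < L &
       forall l : R, L <= l ->
       forall Q M : R -> R, or_minimiser l c Q M ->
         (full_critical l c Q (cst 0) M (cst 0) /\
          forall Q11 Q12 M1 M2 : R -> R, full_critical l c Q11 Q12 M1 M2 ->
            forall y : R, -1 <= y <= 1 ->
              [/\ Q11 y = Q y, Q12 y = 0, M1 y = M y & M2 y = 0]) /\
         (full_minimiser l c Q (cst 0) M (cst 0) /\
          forall Q11 Q12 M1 M2 : R -> R, full_minimiser l c Q11 Q12 M1 M2 ->
            forall y : R, -1 <= y <= 1 ->
              [/\ Q11 y = Q y, Q12 y = 0, M1 y = M y & M2 y = 0])).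
Proof.
split=> [l c l0 c0|c c0].
  split; first exact: or_minimiser_exists.
  move=> Q M min; split.
  - exact: or_minimiser_system.
  - exact: or_minimiser_critical.
  - exact: (or_minimiser_bounds l0 c0 min).
exists (elastic_threshold c); first exact: elastic_threshold_gt0.
move=> l lL Q M min.
split; split.
- exact: or_minimiser_critical.
- by move=> Q11 Q12 M1 M2 crit; exact: (large_critical_unique c0 lL min crit.1 crit).
- split; first exact: or_minimiser_admissible min.
  by move=> Q11 Q12 M1 M2 adm; exact: (large_energy_ge c0 lL min adm).
- move=> Q11 Q12 M1 M2 [adm fmin]; apply: (large_energy_unique c0 lL min adm).
  exact: fmin (or_minimiser_admissible min).
Qed.
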